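(* There exist absolute constants $K,c_0,c_1>0$ such that the following holds for all integers $1\le d\le n$, all $\delta\in(0,1/2)$ and all $\theta\in\mathbf{R}^d$. Let $$\ell^{**}=d\vee\left\lceil n\delta\vee\frac{\delta^{2/3}n^{4/3}\|\theta\|^{4/3}}{d^{1/3}}\vee n \|\theta\|^2 \right\rceil\wedge n .$$ With probability greater than $1-c_1e^{-c_0d}$, the estimator $\tilde\theta(\ell^{**})$ achieves the following. (i) When $\delta\leq\sqrt{d/n}$: $$ L^2(\tilde{\theta}(\ell^{**}),\theta)\le K\cdot \begin{cases} \sqrt{\frac{\delta d}{n}} + \frac{d}{n}, & \|\theta\|^2 \leq \sqrt{\frac{\delta d}{n}}\vee \frac{d}{n},\\[4pt] \left(\frac{\delta d/n}{\|\theta\|}\right)^{2/3}, & \sqrt{\frac{\delta d}{n}}\vee \frac{d}{n} \leq \|\theta\|^2 \leq \frac{\delta^2n}{d}\vee \frac{d}{n},\\[4pt] \frac{d}{n}, & \frac{\delta^2n}{d}\vee \frac{d}{n} \leq \|\theta\|^2. \end{cases} $$ (ii) When $\sqrt{d/n}\leq\delta$: $$ L^2(\tilde{\theta}(\ell^{**}),\theta)\le K\cdot \begin{cases} \sqrt{\frac{\delta d}{n}} +\frac{d}{n}, & \|\theta\|^2 \leq \sqrt{\frac{\delta d}{n}}, \\[4pt] \left(\frac{\delta d/n}{\|\theta\|}\right)^{2/3} , & \sqrt{\frac{\delta d}{n}} \leq \|\theta\|^2 \leq \frac{\sqrt{d/n}}{\delta},\\[4pt] \frac{d}{n}+\frac{d/n}{\|\theta\|^2},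 & \frac{\sqrt{d/n}}{\delta} \leq \|\theta\|^2 . \end{cases} $$ Moreover, $L^2(\tilde{\theta}(\ell^{**}),\theta)\le K\left(\sqrt{\frac{\delta d}{n}} + \frac{d}{n}\right)$ with probability greater than $1-c_1 e^{-c_0d}$.
   Context: Model. For $i=1,\dots,n$ one observes $Y_i=\eta_i\theta+\xi_i\in\mathbf{R}^d$, where $\theta\in\mathbf{R}^d$ is unknown, $\eta_1$ is a Rademacher variable, $(\eta_i)$ is a homogeneous Markov chain on $\{-1,1\}$ with $\eta_{i+1}=\eta_i$ with probability $1-\delta$ and $\eta_{i+1}=-\eta_i$ with probability $\delta$, $\delta\in(0,1/2)$, and $\xi_1,\dots,\xi_n$ are i.i.d. isotropic ($\mathbf{E}\,\xi_i\xi_i^\top=\mathbf{I}_d$) $1$-sub-Gaussian vectors, independent of $\eta$. A random vector $\omega\in\mathbf{R}^d$ is $1$-sub-Gaussian if $\mathbf{E}\exp(\langle v,\omega\rangle)\le\exp(\|v\|^2/2)$ for all $v\in\mathbf{R}^d$. Absolute constants do not depend on $n,d,\delta,\theta$ or the noise distribution. Notation. $a\vee b=\max(a,b)$, $a\wedge b=\min(a,b)$, $\|\cdot\|$ is the Euclidean norm, $x_+=\max(x,0)$. The loss is $L(\tilde\theta,\theta)=\min\{\|\tilde\theta-\theta\|,\|\tilde\theta+\theta\|\}$. Estimator. For a number of buckets $\ell\le n$, it is assumed (without loss of generality, in the paper) that $n=k\ell$ with $k$ an integer (in particular for the value of $\ell$ used in the claim). The indices $1,\dots,n$ are divided into $\ell$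 consecutive blocks $I_1,\dots,I_\ell$ of length $k$. Set $\tilde Y_i=\frac1k\sum_{j\in I_i}Y_j$, let $\tilde Y\in\mathbf{R}^{d\times\ell}$ be the matrix with columns $\tilde Y_i$, and $\hat\Sigma=\frac1\ell\tilde Y\tilde Y^\top$. Let $\lambda_{max}(\hat\Sigma)$ and $v_{max}(\hat\Sigma)$ be its top eigenvalue and a corresponding unit eigenvector. The estimator is $$\tilde{\theta}(\ell) = \sqrt{\Big(\lambda_{max}(\hat{\Sigma})-\frac{1}{k}\Big)_+}\; v_{max}(\hat{\Sigma}).$$ Convention on the case distinctions: where ranges of $\|\theta\|^2$ overlap at endpoints, the first applicable case is used. *)

(* Defs.v *)
From HB Require Import structures.
From mathcomp Require Import all_boot all_order all_algebra.
From mathcomp Require Import all_classical all_reals all_analysis.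
Set Implicit Arguments.
Unset Strict Implicit.
Unset Printing Implicit Defensive.
Import Order.TTheory GRing.Theory Num.Theory.
Import numFieldNormedType.Exports.
Local Open Scope classical_set_scope.
Local Open Scope ring_scope.

(* The library norm on matrices is the sup norm, hence the definitions of the
   Euclidean inner product and norm. *)
Definition edot (R : realType) (d : nat) (u v : 'cV[R]_d) : R :=
  \sum_(a < d) u a 0 * v a 0.

Definition enorm (R : realType) (d : nat) (v : 'cV[R]_d) : R :=
  Num.sqrt (edot v v).

Definition loss (R : realType) (d : nat) (t theta : 'cV[R]_d) : R :=
  Num.min (enorm (t - theta)) (enorm (t + theta)).

(* R^d with its Borel sigma-algebra; convertible to 'cV[R]_d. *)
Notation borel_cV R d := (g_sigma_algebraType (@open 'cV[R]_d)).

Section Probability.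
Context (R : realType) (disp : measure_display) (T : measurableType disp).
Variable P : probability T R.

(* A need not be measurable (the estimator involves an arbitrary choice of
   eigenvector): it has to contain a measurable event of probability > p,
   which means p < P A when A is measurable. *)
Definition with_prob_gt (p : R) (A : set T) : Prop :=
  exists E : set T, [/\ measurable E, E `<=` A & (p%:E < P E)%E].

Definition cprob (A B : set T) : R := fine (P (A `&` B)) / fine (P B).

Definition mutually_independent (disp' : measure_display)
    (T' : measurableType disp') (I : finType) (X : I -> {RV P >-> T'}) : Prop :=
  forall (J : {set I}) (B : I -> set T'), (forall i, measurable (B i)) ->
    P (\bigcap_(i in [set` J]) (X i @^-1` B i)) =
      (\prod_(i in J) P (X i @^-1` B i))%E.

Definition identically_distributed (disp' : measure_display)
    (T' : measurableType disp') (I : finType) (X : I -> {RV P >-> T'}) : Prop :=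
  forall (i j : I) (B : set T'), measurable B ->
    distribution P (X i) B = distribution P (X j) B.

(* the sigma-algebra on T generated by the family X *)
Definition sigma_of (disp' : measure_display) (T' : measurableType disp')
    (I : finType) (X : I -> {RV P >-> T'}) : set (set T) :=
  <<s \bigcup_i preimage_set_system setT (X i) measurable >>.

Definition independent_families
    (disp1 disp2 : measure_display) (T1 : measurableType disp1)
    (T2 : measurableType disp2) (I J : finType)
    (X : I -> {RV P >-> T1}) (Y : J -> {RV P >-> T2}) : Prop :=
  forall A B : set T, sigma_of X A -> sigma_of Y B ->
    P (A `&` B) = (P A * P B)%E.

Definition sub_gaussian (d : nat) (X : T -> 'cV[R]_d) : Prop :=
  forall v : 'cV[R]_d,
    ('E_P[fun w => expR (edot v (X w))] <= (expR (enorm v ^+ 2 / 2))%:E)%E.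

Definition isotropic (d : nat) (X : T -> 'cV[R]_d) : Prop :=
  forall a b : 'I_d,
    ('E_P[fun w => (X w *m (X w)^T) a b] = ((1%:M : 'M[R]_d) a b)%:E)%E.

(* Indices start at 0, so that eta_1 is the element of index 0.  Only the
   values s m with m <= i matter for the history s up to time i. *)
Definition sign_markov_chain (delta : R) (n : nat)
    (eta : 'I_n -> {RV P >-> R}) : Prop :=
  [/\ forall (i : 'I_n) (w : T), eta i w = 1 \/ eta i w = - 1,
      forall i : 'I_n, i = 0%N :> nat ->
        P (eta i @^-1` [set 1]) = (2^-1)%:E /\
        P (eta i @^-1` [set - 1]) = (2^-1)%:E &
      forall (i j : 'I_n), j = i.+1 :> nat ->
      forall s : 'I_n -> R, (forall m, s m = 1 \/ s m = - 1) ->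
      let past := [set w | forall m : 'I_n, (m <= i)%N -> eta m w = s m] in
        P past != 0%E ->
        cprob (eta j @^-1` [set s i]) past = 1 - delta /\
        cprob (eta j @^-1` [set - s i]) past = delta].

Definition model (delta : R) (n d : nat) (eta : 'I_n -> {RV P >-> R})
    (xi : 'I_n -> {RV P >-> borel_cV R d}) : Prop :=
  [/\ sign_markov_chain delta eta,
      mutually_independent xi,
      identically_distributed xi,
      (forall i, isotropic (xi i) /\ sub_gaussian (xi i)) &
      independent_families xi eta].

Definition observation (n d : nat) (theta : 'cV[R]_d)
    (eta : 'I_n -> {RV P >-> R}) (xi : 'I_n -> {RV P >-> borel_cV R d})
    (w : T) : 'I_n -> 'cV[R]_d :=
  fun i => eta i w *: theta + (xi i w : 'cV[R]_d).

End Probability.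

Section Estimator.
Context (R : realType).

(* The spectrum is finite, and nonempty for a symmetric A when 0 < d: the
   supremum is then the largest eigenvalue. *)
Definition lambda_max (d : nat) (A : 'M[R]_d) : R :=
  sup [set a | eigenvalue A a].

Definition top_eigenvector_choice (d : nat) (vmax : 'M[R]_d -> 'cV[R]_d) : Prop :=
  forall A : 'M[R]_d, A^T = A ->
    A *m vmax A = lambda_max A *: vmax A /\ enorm (vmax A) = 1.

(* Column i averages the i-th of ell consecutive blocks of length n / ell;
   meant for ell dividing n. *)
Definition block_means (n d ell : nat) (Y : 'I_n -> 'cV[R]_d) : 'M[R]_(d, ell) :=
  let k := (n %/ ell)%N in
  \matrix_(a < d, i < ell)
    (k%:R^-1 * \sum_(j < n | (j %/ k == i)%N) Y j a 0).

Definition Sigma_hat (n d ell : nat) (Y : 'I_n -> 'cV[R]_d) : 'M[R]_d :=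
  ell%:R^-1 *: (block_means ell Y *m (block_means ell Y)^T).

Definition theta_tilde (n d : nat) (vmax : 'M[R]_d -> 'cV[R]_d) (ell : nat)
    (Y : 'I_n -> 'cV[R]_d) : 'cV[R]_d :=
  let S := Sigma_hat ell Y in
  let k := (n %/ ell)%N in
  Num.sqrt (Num.max (lambda_max S - k%:R^-1) 0) *: vmax S.

End Estimator.

Section Rates.
Context (R : realType).
Variables (n d : nat) (delta : R) (theta : 'cV[R]_d).
Let t := enorm theta.
Let N : R := n%:R.
Let D : R := d%:R.

(* The argument of the ceiling is nonnegative, so that the absolute value only
   casts it from int to nat.  Bracketing as maxn d (minn _ n) gives the same
   number, as d <= n. *)
Definition ell_star : nat :=
  let x : R := Num.max (N * delta)
    (Num.max (delta `^ (2 / 3) * N `^ (4 / 3) * t `^ (4 / 3) / D `^ (1 / 3))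
             (N * t ^+ 2)) in
  minn (maxn d (absz (Num.ceil x))) n.

(* the rate in the regime delta <= sqrt (d / n) *)
Definition rate_small_delta : R :=
  if t ^+ 2 <= Num.max (Num.sqrt (delta * D / N)) (D / N)
  then Num.sqrt (delta * D / N) + D / N
  else if t ^+ 2 <= Num.max (delta ^+ 2 * N / D) (D / N)
  then (delta * D / N / t) `^ (2 / 3)
  else D / N.

(* the rate in the regime sqrt (d / n) <= delta *)
Definition rate_large_delta : R :=
  if t ^+ 2 <= Num.sqrt (delta * D / N)
  then Num.sqrt (delta * D / N) + D / N
  else if t ^+ 2 <= Num.sqrt (D / N) / delta
  then (delta * D / N / t) `^ (2 / 3)
  else D / N + D / N / t ^+ 2.

End Rates.

(* Main.v *)
Require Import Defs.
From HB Require Import structures.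
From mathcomp Require Import all_boot all_order all_algebra.
From mathcomp Require Import all_classical all_reals all_analysis.
From mathcomp Require Import measurable_realfun.
From mathcomp Require Import ring lra zify.
Set Implicit Arguments.
Unset Strict Implicit.
Unset Printing Implicit Defensive.
Import Order.TTheory GRing.Theory Num.Theory.
Import numFieldNormedType.Exports.
Local Open Scope classical_set_scope.
Local Open Scope ring_scope.

(** The sample covariance of the block averages splits exactly
    ([Sigma_hat_decomposition]) as
<<
      I/k + s^2 theta theta^T + E,     E = theta u^T + u theta^T + W,
>>
    where [s^2] is the mean square of the block averages of the signs, [u] is
    the noise averaged against these sign averages, and [W] is the centred
    sample covariance of the averaged noise.  Write [t = |theta|], [p = d/n],
    [L = ell/n].  Three estimates hold outside an event of probability
    [4 exp(-d)] ([good_event]):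

    - [|u|] is of order [sqrt p].  The signs are independent of the noise, so
      they can be frozen ([indep_integral_le]); then the inner product of [u]
      with a fixed vector is a sub-Gaussian linear form in the noise
      ([cross_mgf]).
    - The operator norm of [W] is of order [sqrt (L p)].  Its quadratic form at
      a fixed vector is a centred sum of squares over independent blocks, whose
      Laplace transform is controlled by [subg_quad_mgf]; the condition
      [d <= ell] keeps the deviation of order [d] in the sub-Gaussian range.
      As for [u], a net of the sphere with [exp(6 d)] points ([net_exists]) makes
      the bound uniform.
    - [(1 - s^2) L <= 2 (delta + p)].  Only a block with a sign change loses
      energy ([block_defect]), and the number of sign changes has an exponential
      tail, because each step multiplies the expectation of [exp(flips/2)] by at
      most [1 + delta] ([growth_step]).

    Hence [E] has quadratic form at most [e], of order [t sqrt p + sqrt (L p)],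
    and the estimator, which is read off the leading eigenpair, satisfies
    [loss^2 <= 4 t^2 + 2 e] in any case ([spiked_loss_coarse]) and
    [loss^2 <= 50 (e/(s t))^2 + 2 ((1 - s) t)^2], the variance and the squared bias
    ([spiked_loss_fine]).

    What remains is arithmetic with the number of buckets, for which [L] is, up
    to constants and truncation at 1, the largest of [p], [delta], [t^2] and
    [a = (delta^2 t^4 / p)^(1/3)].  Put [r = (delta p / t)^(2/3)], so that
    [a p = r t^2]; this [a] balances the variance [L p / t^2] against the squared
    bias [(delta t / L)^2].  If [t^2] is at most a constant times
    [sqrt (delta p) + p], the coarse bound is of that order ([risk_weak_signal]);
    otherwise the fine bound gives [p + r] ([risk_strong_signal]), and
    [p + p/t^2] when the blocks have length one and there is no bias
    ([risk_fine_blocks]).  The case distinctions compare [t^2] with the values at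
    which these expressions cross: [r] meets [sqrt (delta p)] at
    [t^2 = sqrt (delta p)], it meets [p] at [t^2 = delta^2 / p], and [a] reaches 1
    at [t^2 = sqrt p / delta].  All the inequalities, the uniform one included,
    are consequences of the same event. *)

(** * Independence *)

Section Independence.
Context (R : realType) (disp : measure_display) (T : measurableType disp).
Variable P : probability T R.
Local Open Scope ereal_scope.

(** The joint law of independent [X] and [Y] agrees with the product of their
    laws on rectangles, hence everywhere, and Fubini-Tonelli applies to it. *)
Lemma indep_fubini d1 d2 (T1 : measurableType d1) (T2 : measurableType d2)
    (X : {RV P >-> T1}) (Y : {RV P >-> T2}) (H : T1 * T2 -> \bar R) :
  (forall A B, measurable A -> measurable B ->
     P (X @^-1` A `&` Y @^-1` B) = P (X @^-1` A) * P (Y @^-1` B)) ->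
  measurable_fun [set: T1 * T2] H -> (forall z, 0 <= H z) ->
  \int[P]_w H (X w, Y w) =
  \int[distribution P Y]_y \int[distribution P X]_x H (x, y).
Proof.
move=> XY mH H0.
have mXY : measurable_fun setT (fun w => (X w, Y w)).
  exact: measurable_fun_pair.
pose Z : {mfun T >-> (T1 * T2)%type} :=
  HB.pack (fun w => (X w, Y w)) (isMeasurableFun.Build _ _ _ _ _ mXY).
rewrite -(fubini_tonelli2 (m1 := distribution P X) (m2 := distribution P Y) H mH H0).
rewrite (eq_measure_integral (distribution P Z)); last first.
  by move=> A mA _; apply: product_measure_unique.
by rewrite ge0_integral_distribution.
Qed.

Lemma indep_integralM d1 d2 (T1 : measurableType d1) (T2 : measurableType d2)
    (X : {RV P >-> T1}) (Y : {RV P >-> T2})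
    (F : T1 -> \bar R) (G : T2 -> \bar R) :
  (forall A B, measurable A -> measurable B ->
     P (X @^-1` A `&` Y @^-1` B) = P (X @^-1` A) * P (Y @^-1` B)) ->
  measurable_fun setT F -> measurable_fun setT G ->
  (forall x, 0 <= F x) -> (forall y, 0 <= G y) ->
  \int[P]_w (F (X w) * G (Y w)) = \int[P]_w F (X w) * \int[P]_w G (Y w).
Proof.
move=> XY mF mG F0 G0.
rewrite (@indep_fubini _ _ _ _ X Y (fun z => F z.1 * G z.2)) //=; last 2 first.
- by apply: emeasurable_funM; exact: measurableT_comp.
- by move=> z; rewrite mule_ge0.
under eq_integral => y _.
  rewrite ge0_integralZr //.
  over.
rewrite ge0_integralZl //; last exact: integral_ge0.
by rewrite !ge0_integral_distribution.
Qed.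

(** An average over [X] that is bounded for each frozen value of [Y] is bounded
    for the random [Y]; below, [X] carries the noise and [Y] the signs. *)
Lemma indep_integral_le d1 d2 (T1 : measurableType d1) (T2 : measurableType d2)
    (X : {RV P >-> T1}) (Y : {RV P >-> T2}) (H : T1 * T2 -> \bar R) (M : R) :
  (forall A B, measurable A -> measurable B ->
     P (X @^-1` A `&` Y @^-1` B) = P (X @^-1` A) * P (Y @^-1` B)) ->
  measurable_fun [set: T1 * T2] H -> (forall z, 0 <= H z) ->
  (forall y, \int[P]_w H (X w, y) <= M%:E) ->
  \int[P]_w H (X w, Y w) <= M%:E.
Proof.
move=> XY mH H0 HM; rewrite indep_fubini //.
have -> : M%:E = \int[distribution P Y]_y (cst M%:E y).
  by rewrite integral_cst// -[LHS]mule1; congr (_ * _); exact/esym/probability_setT.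
apply: ge0_le_integral => //.
- by move=> y _; exact: integral_ge0.
- exact: (measurable_fun_fubini_tonelli_G (m1 := distribution P X) H mH H0).
move=> y _; rewrite ge0_integral_distribution//; first exact: HM.
by apply: measurableT_comp => //; exact: measurable_fun_pair.
Qed.

(** A pi-system that generates the events determined by the coordinates in [J];
    the index set of [B] is all of [I] so that cylinders over different sets
    [J] can be compared. *)
Definition cylinder {d} {T' : measurableType d} {I : finType}
    (X : I -> {RV P >-> T'}) (J : {set I}) : set (set T) :=
  [set \bigcap_(i in [set` J]) (X i @^-1` B i) | B in
     [set B : I -> set T' | forall i, measurable (B i)]].

Section Cylinders.
Context {d : measure_display} {T' : measurableType d} {I : finType}.
Variable X : I -> {RV P >-> T'}.
Hypothesis indX : mutually_independent X.

Lemma setI_closed_cylinder J : setI_closed (cylinder X J).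
Proof.
move=> _ _ [B mB <-] [C mC <-].
exists (fun i => B i `&` C i); first by move=> i; exact: measurableI.
rewrite -bigcapI; apply: eq_bigcapr => i _.
by rewrite preimage_setI.
Qed.

Lemma measurable_preim i (B : set T') : measurable B -> measurable (X i @^-1` B).
Proof. by move=> mB; rewrite -[_ @^-1` _]setTI; exact: measurable_funP. Qed.

Lemma cylinder_measurable J : cylinder X J `<=` measurable.
Proof.
move=> _ [B mB <-]; apply: fin_bigcap_measurable.
  exact: finite_finset.
by move=> i _; exact: measurable_preim.
Qed.

Lemma g_cylinder_measurable J : <<s cylinder X J >> `<=` measurable.
Proof.
apply: smallest_sub; last exact: cylinder_measurable.
exact: sigma_algebra_measurable.
Qed.

(** The sets independent of [A] form a lambda-system, so it is enough to check
    independence on a pi-system. *)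
Lemma indep_dynkin (G : set (set T)) (A : set T) : measurable A ->
  G `<=` measurable -> setI_closed G ->
  (forall B, G B -> P (A `&` B) = P A * P B) ->
  forall B, <<s G >> B -> P (A `&` B) = P A * P B.
Proof.
move=> mA mG IG AG B sB.
have sm : <<s G >> `<=` measurable.
  by apply: smallest_sub => //; exact: sigma_algebra_measurable.
apply: (@dynkin_induction _ (g_sigma_algebraType G) G
  (fun B => P (A `&` B) = P A * P B)) => //.
- by rewrite setIT probability_setT mule1.
- move=> S /sm mS PS; have {}PS : P (A `&` (S : set T)) = P A * P (S : set T) by [].
  rewrite -setDE measureD ?probability_setC//; last first.
    by rewrite ltey_eq fin_num_measure.
  transitivity (P A - P A * P S); first by congr (_ - _).
  rewrite -(@fineK _ (P A)) ?fin_num_measure// -(@fineK _ (P S)) ?fin_num_measure//.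
  by rewrite -EFinM -!EFinB -EFinM; congr EFin; ring.
move=> F mF tF PF; rewrite setI_bigcupr.
have mF' n : (measurable (F n : set T)) := sm _ (mF n).
rewrite !measure_bigcup//=; last first.
- by apply: trivIset_setIl.
- by move=> n _; exact: measurableI.
rewrite -(@fineK _ (P A)) ?fin_num_measure// -nneseriesZl //.
by apply: eq_eseriesr => n _; rewrite fineK ?fin_num_measure//; exact: PF.
Qed.

Let T_ J := g_sigma_algebraType (cylinder X J).

(** Grouping: two applications of the pi-lambda argument, one for each side,
    reduce the claim to cylinders, where it is mutual independence over the
    union of [J] and [K]. *)
Lemma cylinder_indep (J K : {set I}) (A B : set T) : [disjoint J & K]%B ->
  <<s cylinder X J >> A -> <<s cylinder X K >> B -> P (A `&` B) = P A * P B.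
Proof.
move=> JK sA sB.
apply: (indep_dynkin (G := cylinder X K)) => //.
- exact: g_cylinder_measurable sA.
- exact: cylinder_measurable.
- exact: setI_closed_cylinder.
move=> {B sB} B cB; rewrite setIC muleC.
apply: (indep_dynkin (G := cylinder X J)) => //.
- exact: cylinder_measurable cB.
- exact: cylinder_measurable.
- exact: setI_closed_cylinder.
move=> {A sA} A cA; rewrite setIC muleC.
case: cA => C mC <-; case: cB => D mD <-.
pose E i := if i \in J then C i else D i.
have mE i : measurable (E i) by rewrite /E; case: ifP.
have EJ : \bigcap_(i in [set` J]) (X i @^-1` C i) =
          \bigcap_(i in [set` J]) (X i @^-1` E i).
  by apply: eq_bigcapr => i /= iJ; rewrite /E iJ.
have EK : \bigcap_(i in [set` K]) (X i @^-1` D i) =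
          \bigcap_(i in [set` K]) (X i @^-1` E i).
  apply: eq_bigcapr => i /= iK; rewrite /E ifF//.
  by apply: (disjointFl JK).
rewrite EJ EK !indX//.
transitivity (\prod_(i in (J :|: K)%SET) P (X i @^-1` E i)); last first.
  by rewrite (eq_bigl [predU J & K]) ?bigU// => i; rewrite !inE.
rewrite -indX //.
congr (P _); apply/seteqP; split => w.
  by move=> [wJ wK] i /=; rewrite inE => /orP[]; [exact: wJ|exact: wK].
by move=> wJK; split => i iJ; apply: wJK => /=; rewrite inE iJ ?orbT.
Qed.

Lemma measurable_fun_coord (J : {set I}) i : i \in J ->
  measurable_fun setT (X i : T_ J -> T').
Proof.
move=> iJ _ B mB; rewrite setTI; apply: sub_sigma_algebra.
exists (fun j => if j == i then B else setT); first by move=> j; case: ifP.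
apply/seteqP; split => w /=; last by move=> wB j _ /=; case: eqP => // ->.
by move=> /(_ i iJ) /=; rewrite eqxx.
Qed.

Lemma measurable_fun_gid J : measurable_fun setT (idfun : T -> T_ J).
Proof. by move=> _ B mB; rewrite setTI; exact: g_cylinder_measurable mB. Qed.

Lemma cylinderS (J K : {set I}) : J \subset K -> cylinder X J `<=` cylinder X K.
Proof.
move=> JK _ [B mB <-]; exists (fun i => if i \in J then B i else setT).
  by move=> i; case: ifP.
apply/seteqP; split => w /= wB i /= iJ.
  by have := wB i (fintype.subsetP JK _ iJ); rewrite /= iJ.
by case: ifPn => // {}iJ; exact: wB.
Qed.

Lemma measurable_fun_gS d2 (T2 : measurableType d2) (J K : {set I}) (f : T -> T2) :
  J \subset K -> measurable_fun setT (f : T_ J -> T2) ->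
  measurable_fun setT (f : T_ K -> T2).
Proof.
move=> JK mf _ B mB; have := mf measurableT B mB.
by apply: sub_sigma_algebra2; exact: cylinderS.
Qed.

Lemma cylinder_integralM (J K : {set I}) (F G : T -> \bar R) : [disjoint J & K]%B ->
  measurable_fun setT (F : T_ J -> \bar R) ->
  measurable_fun setT (G : T_ K -> \bar R) ->
  (forall x, 0 <= F x) -> (forall y, 0 <= G y) ->
  \int[P]_w (F w * G w) = \int[P]_w F w * \int[P]_w G w.
Proof.
move=> JK mF mG F0 G0.
pose XJ : {RV P >-> T_ J} :=
  HB.pack (idfun : T -> T_ J) (isMeasurableFun.Build _ _ _ _ _ (@measurable_fun_gid J)).
pose XK : {RV P >-> T_ K} :=
  HB.pack (idfun : T -> T_ K) (isMeasurableFun.Build _ _ _ _ _ (@measurable_fun_gid K)).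
apply: (@indep_integralM _ _ _ _ XJ XK F G) => // A B mA mB.
exact: (cylinder_indep JK).
Qed.

(** Product rule for functions of disjoint blocks of coordinates.  A square of a
    block sum couples all the coordinates of its block, so the product rule for
    single coordinates would not do. *)
Lemma cylinder_integral_prod m (J : 'I_m -> {set I}) (f : 'I_m -> T -> R) :
  (forall a b, a != b -> [disjoint J a & J b]%B) ->
  (forall a, measurable_fun setT (f a : T_ (J a) -> R)) ->
  (forall a x, (0 <= f a x)%R) ->
  \int[P]_w ((\prod_(a < m) f a w)%R)%:E = \prod_(a < m) \int[P]_w (f a w)%:E.
Proof.
elim: m => [|m IH] in J f *.
  move=> _ _ _; rewrite big_ord0; under eq_integral do rewrite big_ord0.
  by rewrite integral_cst// mul1e; exact: probability_setT.
move=> dJ mf f0; rewrite big_ord_recl /=.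
under eq_integral do rewrite big_ord_recl EFinM.
pose K := (\bigcup_(a < m) J (lift ord0 a))%SET.
rewrite (@cylinder_integralM (J ord0) K
  (EFin \o f ord0) (fun w => (\prod_(a < m) f (lift ord0 a) w)%:E)) //; first last.
- by move=> y; rewrite lee_fin; exact: prodr_ge0.
- by move=> y; rewrite lee_fin.
- apply/measurable_EFinP; apply: (@measurable_prod _ (T_ K)) => a _.
  apply: (measurable_fun_gS (J := J (lift ord0 a))) => //.
  exact: (finset.bigcup_sup a).
- exact/measurable_EFinP.
- by apply/bigcup_disjointP => a _; exact: dJ.
congr (_ * _); apply: (IH (fun a => J (lift ord0 a)) (fun a => f (lift ord0 a))) => // a b ab; apply: dJ.
by rewrite (inj_eq lift_inj).
Qed.

End Cylinders.
End Independence.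

(** * Expectations and exponential inequalities *)

Ltac mfun := repeat first
  [ assumption
  | match goal with |- measurable_fun _ (fun _ => ?c) => exact: measurable_cst end
  | match goal with |- measurable_fun _ (fun w => expR (@?f w)) =>
      refine (measurableT_comp (@measurable_expR _) (_ : measurable_fun setT f)) end
  | match goal with |- measurable_fun _ (fun w => (@?f w) ^+ ?n) =>
      refine (@measurable_funX _ _ _ setT f n _) end
  | match goal with |- measurable_fun _ (fun w => - (@?f w)) =>
      refine (measurable_funN (f := f) _) end
  | match goal with |- measurable_fun _ (fun w => (@?f w) + (@?g w)) =>
      refine (measurable_funD (f := f) (g := g) _ _) end
  | match goal with |- measurable_fun _ (fun w => (@?f w) * (@?g w)) =>
      refine (measurable_funM (f := f) (g := g) _ _) end
  | match goal with |- measurable_fun _ (fun w => \sum_(i <- ?r) (@?f w i)) =>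
      refine (@measurable_sum _ _ _ setT _ r (fun i w => f w i) _); intro end
  | match goal with H : forall _, measurable_fun _ _ |- _ => exact: H end ].

(** Extended-real values spare all integrability hypotheses: the functions below
    are nonnegative, and finiteness comes out of the upper bounds. *)
Definition expect (R : realType) (disp : measure_display)
    (T : measurableType disp) (P : probability T R) (f : T -> R) : \bar R :=
  (\int[P]_w (f w)%:E)%E.
Arguments expect {R disp T} P f%_R.

Section Expectation.
Context (R : realType) (disp : measure_display) (T : measurableType disp).
Variable P : probability T R.

Local Notation Ex f := (expect P f%R).

Lemma Ex_ge0 (f : T -> R) : (forall w, 0 <= f w) -> (0 <= Ex f)%E.
Proof. by move=> f0; apply: integral_ge0 => w _; rewrite lee_fin. Qed.

Lemma Ex_le (f g : T -> R) : measurable_fun setT f -> measurable_fun setT g ->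
  (forall w, 0 <= f w) -> (forall w, f w <= g w) -> (Ex f <= Ex g)%E.
Proof.
move=> mf mg f0 fg; apply: ge0_le_integral => //.
- by move=> w _; rewrite lee_fin.
- exact/measurable_EFinP.
- exact/measurable_EFinP.
- by move=> w _; rewrite lee_fin.
Qed.

Lemma Ex_cst c : Ex (fun=> c) = c%:E.
Proof.
rewrite /expect integral_cst// -[RHS]mule1; congr (_ * _)%E; exact: probability_setT.
Qed.

Lemma ExD (f g : T -> R) : measurable_fun setT f -> measurable_fun setT g ->
  (forall w, 0 <= f w) -> (forall w, 0 <= g w) ->
  Ex (fun w => f w + g w) = (Ex f + Ex g)%E.
Proof.
move=> mf mg f0 g0; rewrite /expect; under eq_integral do rewrite EFinD.
by rewrite ge0_integralD //; try (by move=> w _; rewrite lee_fin); exact/measurable_EFinP.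
Qed.

Lemma ExZ c (f : T -> R) : measurable_fun setT f -> 0 <= c -> (forall w, 0 <= f w) ->
  Ex (fun w => c * f w) = (c%:E * Ex f)%E.
Proof.
move=> mf c0 f0; rewrite /expect; under eq_integral do rewrite EFinM.
rewrite ge0_integralZl_EFin //; last exact/measurable_EFinP.
by move=> w _; rewrite lee_fin.
Qed.

Lemma eq_Ex (f g : T -> R) : f =1 g -> Ex f = Ex g.
Proof. by move=> fg; apply: eq_integral => w _; rewrite fg. Qed.

(** Chernoff's method; [M] bounds the Laplace transform. *)
Lemma markov_exp (f : T -> R) (t M : R) : measurable_fun setT f ->
  (Ex (fun w => expR (f w)) <= M%:E)%E ->
  (P [set w | (t <= f w)%R] <= (M * expR (- t))%:E)%E.
Proof.
move=> mf EM.
have mA : measurable [set w | (t <= f w)%R].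
  have := measurable_fun_le measurableT (measurable_cst t) mf.
  by rewrite setTI.
rewrite -(@expectation_indic _ _ _ P) // unlock.
have : (Ex (fun w => expR (- t) * expR (f w)) <= (M * expR (- t))%:E)%E.
  rewrite ExZ ?expR_ge0//; first by rewrite mulrC EFinM lee_wpmul2l// lee_fin expR_ge0.
  by mfun.
apply: le_trans; apply: Ex_le; [exact: measurable_indic|by mfun| |].
  by move=> w.
move=> w; rewrite indicE; case: (boolP (w \in _)) => [|_].
  rewrite inE /= => tf; rewrite -expRD -expR0 ler_expR; lra.
by rewrite mulr_ge0 ?expR_ge0.
Qed.

End Expectation.

Section ExpBounds.
Context (R : realType).
Implicit Types x y z : R.

Lemma expR_quad_ge z : 0 <= z -> 1 + z + z ^+ 2 / 2 <= expR z.
Proof.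
move=> z0; rewrite /expR.
have -> : 1 + z + z ^+ 2 / 2 = series (exp_coeff z) 3.
  rewrite /series /= big_mkord !big_ord_recr big_ord0 /= /exp_coeff /= expr0 expr1.
  by rewrite add0r divr1 (_ : 1`! = 1%N)// (_ : 2`! = 2%N)// divr1.
apply: nondecreasing_cvgn_le; last exact: is_cvg_series_exp_coeff.
by apply: nondecreasing_series => n _ _; exact: exp_coeff_ge0.
Qed.

(** With [e = exp(y/2)] the difference is [(e - 1/e)^2 - y^2], and [2 sinh(y/2)]
    dominates [y] for [y >= 0]. *)
Lemma cosh_ge y : 2 + y ^+ 2 <= expR y + expR (- y).
Proof.
wlog y0 : y / 0 <= y.
  move=> H; have [/H//|/ltW y0] := leP 0 y.
  by have := H (- y); rewrite oppr_ge0 opprK sqrrN [_ + expR y]addrC; exact.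
pose z := y / 2; have z0 : 0 <= z by rewrite divr_ge0.
have E1 := expR_quad_ge z0; have E0 := expR_gt0 z.
have -> : expR y = expR z ^+ 2 by rewrite -expRM_natl; congr expR; rewrite /z; field.
have -> : expR (- y) = (expR z)^-1 ^+ 2.
  by rewrite -expRN -expRM_natl; congr expR; rewrite /z; field.
have -> : y = 2 * z by rewrite /z; field.
set e := expR z in E1 E0 *.
have H : 2 * z <= e - e^-1.
  rewrite -(ler_pM2r E0) mulrBl mulVf ?gt_eqF//; nra.
have ee : e * e^-1 = 1 by rewrite divff// gt_eqF.
nra.
Qed.

(** Second-order Taylor bound with a remainder valid for both signs of [y]. *)
Lemma expR_quad_le y : expR y <= 1 + y + y ^+ 2 * expR `|y|.
Proof.
have H : expR y - 1 <= y * expR y.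
  have := expR_ge1Dx (- y); rewrite expRN => H.
  have E0 := expR_gt0 y.
  have := ler_wpM2r (ltW E0) H; rewrite mulVf ?gt_eqF//; lra.
have [y0|y0] := leP 0 y.
  by rewrite ger0_norm//; have := expR_gt0 y; nra.
have e1 : expR y <= 1 by rewrite expR_le1 ltW.
have E1 : 1 <= expR `|y| by rewrite -expR0 ler_expR.
have := expR_ge1Dx y; nra.
Qed.

End ExpBounds.

(** * Second moments of sub-Gaussian variables *)

Section SubGaussianReal.
Context (R : realType) (disp : measure_display) (T : measurableType disp).
Variable P : probability T R.
Local Notation Ex f := (expect P f%R).

(** [s] is the variance proxy. *)
Definition subg (X : T -> R) (s : R) : Prop :=
  forall v : R, (Ex (fun w => expR (v * X w)) <= (expR (v ^+ 2 * s / 2))%:E)%E.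

(** The hyperbolic cosine bound gives [l^2 E X^2 <= 2 exp(l^2 s / 2) - 2]; divide
    by [l^2] and let [l] tend to 0. *)
Lemma subg_second_moment (X : T -> R) (s : R) : measurable_fun setT X ->
  0 <= s -> subg X s -> (Ex (fun w => X w ^+ 2) <= s%:E)%E.
Proof.
move=> mX s0 sX.
have key (h : R) : 0 < h ->
    (h%:E * Ex (fun w => X w ^+ 2) <= (2 * expR (h * s / 2) - 2)%:E)%E.
  move=> h0; pose l := Num.sqrt h.
  have l2 : l ^+ 2 = h by rewrite sqr_sqrtr// ltW.
  have H1 := sX l; have H2 := sX (- l).
  rewrite sqrrN l2 in H2; rewrite l2 in H1.
  have H : (Ex (fun w => 2 + h * X w ^+ 2) <=
      Ex (fun w => expR (l * X w) + expR (- l * X w)))%E.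
    apply: Ex_le; [by mfun|by mfun| |] => w.
      by rewrite addr_ge0// mulr_ge0 ?sqr_ge0// ltW.
    by rewrite mulNr -l2 -exprMn; exact: cosh_ge.
  move: H; rewrite !ExD; try (by mfun); try (by move=> w; rewrite ?expR_ge0);
    last by move=> w; rewrite mulr_ge0 ?sqr_ge0// ltW.
  rewrite Ex_cst ExZ; [|by mfun|exact: ltW|by move=> w; exact: sqr_ge0].
  move=> H; rewrite EFinB leeBrDr// addeC.
  apply: (le_trans H); rewrite mulrC mulr2n mulrDr mulr1 EFinD.
  exact: leeD.
have m0 : (0 <= Ex (fun w => X w ^+ 2))%E by apply: Ex_ge0 => w; exact: sqr_ge0.
have mfin : Ex (fun w => X w ^+ 2) \is a fin_num.
  rewrite ge0_fin_numE//; have := key 1 ltr01; rewrite mul1e => /le_lt_trans; apply.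
  exact: ltry.
rewrite -(fineK mfin) lee_fin; set m := fine _.
have {}key (h : R) : 0 < h -> h * m <= 2 * expR (h * s / 2) - 2.
  by move=> /key; rewrite -(fineK mfin) -EFinM lee_fin.
apply/ler_addgt0Pr => e e0.
(* h is chosen so small that the second-order error h C is at most e, while
   h s <= 1 keeps the exponential below exp 1. *)
pose C := s ^+ 2 * expR 1 / 2 + 1.
have C0 : 0 < C.
  by rewrite ltr_pwDr// divr_ge0// mulr_ge0 ?sqr_ge0// ltW// expR_gt0.
have D0 : 0 < e * s + C by rewrite ltr_wpDl// mulr_ge0// ltW.
pose h := e / (e * s + C).
have h0 : 0 < h by rewrite divr_gt0.
have hD : h * (e * s + C) = e by rewrite divfK// gt_eqF.
have hs0 : 0 <= h * s by rewrite mulr_ge0// ltW.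
have hs : h * s <= 1.
  have : h * (e * s) <= e by rewrite -hD; have := mulr_gt0 h0 C0; nra.
  by rewrite mulrCA -[leRHS]mulr1 ler_pM2l.
have hC : h * C <= e by rewrite -hD [in leRHS]mulrDr lerDr mulr_ge0 ?(ltW h0)// mulr_ge0// ltW.
have := key h h0; have := expR_quad_le (h * s / 2).
have -> : `|h * s / 2| = h * s / 2 by rewrite ger0_norm// divr_ge0.
have E1 : expR (h * s / 2) <= expR 1 by rewrite ler_expR; lra.
rewrite /C in hC; clearbody h.
set F := expR 1 in E1 hC *; set E := expR (h * s / 2) in E1 *.
move=> H1 H2.
have H3 : (h * s / 2) ^+ 2 * E <= (h * s / 2) ^+ 2 * F by rewrite ler_wpM2l// sqr_ge0.
have : h * m <= h * (s + e).
  have -> : h * (s + e) = h * s + h * e by ring.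
  have : h * (h * (s ^+ 2 * F / 2 + 1)) <= h * e by rewrite ler_pM2l.
  set q := h * s in H1 H3 *.
  have -> : h * (h * (s ^+ 2 * F / 2 + 1)) = q ^+ 2 * F / 2 + h ^+ 2 by rewrite /q; field.
  have : 0 <= h ^+ 2 by exact: sqr_ge0.
  move: H2; set A := h * m; set B := h * e; set h2 := h ^+ 2.
  move: H3; have -> : (q / 2) ^+ 2 * F = q ^+ 2 * F / 4 by field.
  set G := q ^+ 2 * F; set G' := (q / 2) ^+ 2 * E in H1 *; lra.
by rewrite ler_pM2l.
Qed.

(** By the parallelogram identity the two bounds add up to an equality, so both
    are equalities.  This stands in for the vanishing of the cross term
    [E X Y]. *)
Lemma parallelogram_moment (X Y : T -> R) (a b : R) :
  measurable_fun setT X -> measurable_fun setT Y ->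
  Ex (fun w => X w ^+ 2) = a%:E -> Ex (fun w => Y w ^+ 2) = b%:E ->
  (Ex (fun w => (X w + Y w) ^+ 2) <= (a + b)%:E)%E ->
  (Ex (fun w => (X w - Y w) ^+ 2) <= (a + b)%:E)%E ->
  Ex (fun w => (X w + Y w) ^+ 2) = (a + b)%:E.
Proof.
move=> mX mY EX EY.
have H : (Ex (fun w => (X w + Y w) ^+ 2) + Ex (fun w => (X w - Y w) ^+ 2) =
  (2 * (a + b))%:E)%E.
  rewrite -ExD; try (by mfun); try (by move=> w; exact: sqr_ge0).
  rewrite (@eq_Ex _ _ _ _ _ (fun w => 2 * (X w ^+ 2 + Y w ^+ 2))%R); last first.
    by move=> w; ring.
  rewrite ExZ//; [|by mfun|by move=> w; rewrite addr_ge0 ?sqr_ge0].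
  by rewrite ExD ?EX ?EY//; try (by mfun); try (by move=> w; exact: sqr_ge0).
move: H; case: (Ex (fun w => (X w + Y w) ^+ 2)) => [u| |] //;
  case: (Ex (fun w => (X w - Y w) ^+ 2)) => [v| |] //=.
rewrite -EFinD => -[uv]; rewrite !lee_fin => ua va; congr EFin; lra.
Qed.

(** Sub-Gaussianity of all linear combinations bounds their second moments by
    those of an orthonormal system; with unit variances there is equality, by
    adding one coordinate at a time with either sign. *)
Lemma second_moment_sum (I : finType) (X : I -> T -> R) :
  (forall i, measurable_fun setT (X i)) ->
  (forall c : I -> R, subg (fun w => \sum_i c i * X i w) (\sum_i c i ^+ 2)) ->
  (forall i, Ex (fun w => X i w ^+ 2) = 1%:E) ->
  forall c : I -> R,
    Ex (fun w => (\sum_i c i * X i w) ^+ 2) = (\sum_i c i ^+ 2)%:E.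
Proof.
move=> mX sX EX c.
have sub (r : seq I) (c' : I -> R) : uniq r ->
    (Ex (fun w => (\sum_(i <- r) c' i * X i w) ^+ 2) <=
      (\sum_(i <- r) c' i ^+ 2)%:E)%E.
  move=> ur; apply: subg_second_moment; first by mfun.
    by apply: sumr_ge0 => i _; exact: sqr_ge0.
  have := sX (fun i => if i \in r then c' i else 0).
  rewrite (_ : (fun w => _) = (fun w => \sum_(i <- r) c' i * X i w)); last first.
    apply/funext => w; rewrite [RHS]big_uniq//= [RHS]big_mkcond/=.
    by apply: eq_bigr => i _; case: ifP => _; rewrite ?mul0r.
  rewrite (_ : \sum_i _ = \sum_(i <- r) c' i ^+ 2)//.
  rewrite [RHS]big_uniq//= [RHS]big_mkcond/=.
  by apply: eq_bigr => i _; case: ifP => _; rewrite ?expr0n.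
have -> : index_enum I = enum I by rewrite enumT.
have : uniq (enum I) by exact: enum_uniq.
elim: (enum I) => [_|i r IH /= /andP[ir ur]].
  rewrite big_nil -(Ex_cst P); apply: eq_Ex => w.
  by rewrite big_nil expr0n.
rewrite big_cons.
rewrite (@eq_Ex _ _ _ _ _ (fun w => (c i * X i w + \sum_(j <- r) c j * X j w) ^+ 2)%R);
  last by move=> w; rewrite big_cons.
apply: parallelogram_moment; [by mfun|by mfun| |exact: IH| |].
- under eq_Ex do rewrite exprMn.
  rewrite ExZ ?sqr_ge0//; [by rewrite EX mule1|by mfun|by move=> w; exact: sqr_ge0].
- have := sub (i :: r) c; rewrite big_cons /= ir ur => /(_ isT).
  by under [X in (X <= _)%E -> _]eq_Ex do rewrite big_cons.
have := sub (i :: r) (fun j => if j == i then c i else - c j).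
rewrite big_cons /= ir ur eqxx => /(_ isT).
rewrite [in X in (_ <= X)%E -> _](eq_big_seq (fun j => c j ^+ 2)); last first.
  by move=> j jr /=; case: eqP => [ji|_]; rewrite ?sqrrN//; rewrite -ji jr in ir.
rewrite (@eq_Ex _ _ _ _ _ (fun w => (c i * X i w - \sum_(j <- r) c j * X j w) ^+ 2)%R)//.
move=> w; rewrite big_cons eqxx -sumrN; congr ((_ + _) ^+ 2).
apply: eq_big_seq => j jr /=; case: eqP => [ji|_]; last by rewrite mulNr.
by rewrite -ji jr in ir.
Qed.

End SubGaussianReal.

(** * Squares of sub-Gaussian variables *)

Section ChiSquare.
Context (R : realType) (disp : measure_display) (T : measurableType disp).
Variable P : probability T R.
Local Notation Ex f := (expect P f%R).

(** A discrete substitute for writing [exp(x^2/8)] as a Gaussian mixture of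
    exponentials: the term [m = floor(|x|/4)] nearly maximises [m|x| - 2 m^2],
    whose maximum is [x^2/8], and the loss from rounding is at most 2. *)
Lemma expR_sq_le_series (x : R) :
  ((expR (x ^+ 2 / 8))%:E <= \sum_(0 <= m <oo)
    (expR (2 - 2 * m%:R ^+ 2) * (expR (m%:R * x) + expR (- m%:R * x)))%:E)%E.
Proof.
pose m := Num.truncn (`|x| / 4).
have /andP[m1 m2] : m%:R <= `|x| / 4 < m.+1%:R.
  by apply: truncn_itv; rewrite divr_ge0.
apply: le_trans (nneseries_lim_ge (P := predT) (m := 0%N) m.+1 _); last first.
  by move=> n _ _; rewrite lee_fin mulr_ge0 ?addr_ge0 ?expR_ge0.
rewrite sumEFin lee_fin big_mkord big_ord_recr /=.
apply: ler_wpDl.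
  by apply: sumr_ge0 => i _; rewrite mulr_ge0 ?addr_ge0 ?expR_ge0.
apply: (@le_trans _ _ (expR (2 - 2 * m%:R ^+ 2) * expR (m%:R * `|x|))).
  rewrite -expRD ler_expR -[x ^+ 2]real_normK ?num_real//.
  rewrite -[m.+1%:R]natr1 in m2; set q := `|x| / 4 - m%:R.
  have : 0 <= (1 - q) * (1 + q) by rewrite mulr_ge0 /q; lra.
  by rewrite /q; lra.
rewrite ler_wpM2l ?expR_ge0//.
case: (leP 0 x) => x0.
  by rewrite ger0_norm// lerDl expR_ge0.
by rewrite ltr0_norm// mulrN mulNr lerDr expR_ge0.
Qed.

Lemma two_le_e : 2 <= expR 1 :> R.
Proof. by have := expR_ge1Dx (1 : R); lra. Qed.

(** Integrate the series term by term: the [m]-th term costs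
    [exp(2 - 2 m^2 + m^2/2)], which is dominated by a geometric series. *)
Lemma subg_exp_sq (Y : T -> R) : measurable_fun setT Y -> subg P Y 1 ->
  (Ex (fun w => expR (Y w ^+ 2 / 8)) <= (4 * expR 2)%:E)%E.
Proof.
move=> mY sY.
pose f m w := expR (2 - 2 * m%:R ^+ 2) * (expR (m%:R * Y w) + expR (- m%:R * Y w)).
have mf m : measurable_fun setT (f m) by rewrite /f; mfun.
have f0 m w : 0 <= f m w by rewrite /f mulr_ge0 ?addr_ge0 ?expR_ge0.
apply: (@le_trans _ _ (\int[P]_w (\sum_(0 <= m <oo) (f m w)%:E))%E).
  apply: ge0_le_integral => //.
  - apply/measurable_EFinP; mfun.
  - apply: ge0_emeasurable_sum => //.
    by move=> k w _ _; rewrite lee_fin.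
    by move=> k _; exact/measurable_EFinP.
  - by move=> w _; exact: expR_sq_le_series.
rewrite integral_nneseries //; last 2 first.
- by move=> m; exact/measurable_EFinP.
- by move=> m w _; rewrite lee_fin.
apply: le_trans (@epsilon_trick0 _ (4 * expR 2) predT _); last first.
  by rewrite mulr_ge0 ?expR_ge0.
apply: lee_nneseries.
  by move=> m _ _; apply: integral_ge0 => w _; rewrite lee_fin.
move=> m _; rewrite -/(expect P (f m)) /f.
rewrite ExZ ?expR_ge0//; last by mfun.
rewrite ExD; try (by mfun); try (by move=> w; exact: expR_ge0).
have H1 := sY m%:R; have H2 := sY (- m%:R); rewrite sqrrN mulr1 in H2; rewrite mulr1 in H1.
apply: (@le_trans _ _ ((expR (2 - 2 * m%:R ^+ 2))%:E *
   ((expR (m%:R ^+ 2 / 2))%:E + (expR (m%:R ^+ 2 / 2))%:E))%E).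
  by rewrite lee_wpmul2l ?lee_fin ?expR_ge0//; exact: leeD.
rewrite -EFinD -EFinM lee_fin.
have -> : expR (2 - 2 * m%:R ^+ 2) * (expR (m%:R ^+ 2 / 2) + expR (m%:R ^+ 2 / 2))
   = 2 * (expR 2 * expR (- (3 / 2 * m%:R ^+ 2))) :> R.
  set q := m%:R ^+ 2.
  have -> : 2 - 2 * q = 2 + - (3 / 2 * q) + - (q / 2) by field.
  rewrite [expR (2 + _ + _)]expRD [expR (2 + _)]expRD.
  have e1 : expR (q / 2) * expR (- (q / 2)) = 1 by exact: expRxMexpNx_1.
  set a := expR 2 in e1 *; set b := expR (- (3 / 2 * q)) in e1 *.
  set c := expR (- (q / 2)) in e1 *; set d := expR (q / 2) in e1 *.
  transitivity (2 * (a * b) * (d * c)); first by ring.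
  by rewrite e1 mulr1.
rewrite expnS natrM [(2%:R * _)^-1]invfM.
suff : expR (- (3 / 2 * m%:R ^+ 2)) <= ((2 ^ m)%:R)^-1 :> R.
  have := expR_ge0 (2 : R).
  set a := expR 2; set b := expR _; set c := (2 ^ m)%:R^-1 => a0 bc.
  have H : a * b <= a * c by rewrite ler_wpM2l.
  have E : 4 * a * (2%:R^-1 * c) = 2 * (a * c) by field.
  by rewrite E ler_wpM2l.
rewrite expRN lef_pV2 ?posrE ?expR_gt0 ?ltr0n ?expn_gt0//.
rewrite natrX; apply: (@le_trans _ _ (expR 1 ^+ m)).
  by rewrite lerXn2r ?nnegrE ?expR_ge0// two_le_e.
rewrite -expRM_natl mulr1 ler_expR.
case: m {f mf f0 H1 H2} => [|m]; first by rewrite expr0n mulr0.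
have : 1 <= m.+1%:R :> R by rewrite ler1n.
set a := m.+1%:R; nra.
Qed.

(** The remainder constant [2048 exp 1] of [subg_quad_mgf] times the bound of
    [subg_exp_sq]. *)
Definition chi_const : R := 2048 * expR 1 * (4 * expR 2).

(** Second-order expansion in [l]: the linear term has zero mean because [tau] is
    the exact second moment, and for [|l| <= 1/32] the remainder is at most
    [l^2] times a multiple of [exp(Y^2/8)]. *)
Lemma subg_quad_mgf (Y : T -> R) (tau l : R) : measurable_fun setT Y ->
  subg P Y 1 -> 0 <= tau <= 1 -> Ex (fun w => Y w ^+ 2) = tau%:E ->
  `|l| <= 1 / 32 ->
  (Ex (fun w => expR (l * (Y w ^+ 2 - tau))) <= (expR (chi_const * l ^+ 2))%:E)%E.
Proof.
move=> mY sY /andP[t0 t1] EY l32.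
pose B w := l ^+ 2 * (2048 * expR 1) * expR (Y w ^+ 2 / 8).
(* Terms are moved across so that both sides are sums of nonnegative terms,
   whose expectations can be split before finiteness is known. *)
have pw w : expR (l * (Y w ^+ 2 - tau)) + (`|l| * Y w ^+ 2 + (`|l| + l) * tau) <=
    1 + (`|l| + l) * Y w ^+ 2 + (`|l| * tau + B w).
  set y := l * _.
  suff : expR y <= 1 + y + B w by rewrite /y; lra.
  apply: (le_trans (expR_quad_le y)); rewrite lerD2l.
  pose z := (Y w ^+ 2 + 1) / 32.
  have Y0 : 0 <= Y w ^+ 2 by exact: sqr_ge0.
  have z0 : 0 <= z by rewrite divr_ge0// addr_ge0.
  have n1 : `|Y w ^+ 2 - tau| <= Y w ^+ 2 + 1 by rewrite ler_norml; lra.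
  have yz : `|y| <= z.
    rewrite /y normrM /z mulrC; apply: ler_pM => //; lra.
  have y2 : y ^+ 2 <= l ^+ 2 * (32 * z) ^+ 2.
    rewrite /y exprMn ler_wpM2l ?sqr_ge0//.
    rewrite -[_ ^+ 2]real_normK ?num_real// lerXn2r ?nnegrE//; rewrite /z; lra.
  have ez := expR_quad_ge z0.
  have z2 : z ^+ 2 <= 2 * expR z by lra.
  have e1 : expR `|y| <= expR z by rewrite ler_expR.
  apply: (@le_trans _ _ (l ^+ 2 * (32 * z) ^+ 2 * expR z)).
    by apply: ler_pM; rewrite ?sqr_ge0 ?expR_ge0.
  have e2 : expR z * expR z <= expR 1 * expR (Y w ^+ 2 / 8).
    rewrite -!expRD ler_expR /z; lra.
  have : z ^+ 2 * expR z <= 2 * expR z * expR z by rewrite ler_wpM2r ?expR_ge0.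
  move=> e3; rewrite /B.
  have -> : l ^+ 2 * (32 * z) ^+ 2 * expR z = l ^+ 2 * (1024 * (z ^+ 2 * expR z)) by ring.
  rewrite -2![in leRHS]mulrA ler_wpM2l ?sqr_ge0//; lra.
have c0 : 0 <= l ^+ 2 * (2048 * expR 1).
  apply: mulr_ge0; first exact: sqr_ge0.
  by have := expR_ge0 (1 : R); lra.
have B0 w : 0 <= B w by rewrite /B; apply: mulr_ge0 => //; exact: expR_ge0.
have mB : measurable_fun setT B by rewrite /B; mfun.
have ll : 0 <= `|l| + l by have := ler_norm (- l); rewrite normrN; lra.
have : (Ex (fun w => expR (l * (Y w ^+ 2 - tau)) + (`|l| * Y w ^+ 2 + (`|l| + l) * tau))
   <= Ex (fun w => 1 + (`|l| + l) * Y w ^+ 2 + (`|l| * tau + B w)))%E.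
  apply: Ex_le => //; [by mfun|by mfun|].
  move=> w; apply: addr_ge0; first exact: expR_ge0.
  by apply: addr_ge0; apply: mulr_ge0 => //; exact: sqr_ge0.
have EB : (Ex B <= (chi_const * l ^+ 2)%:E)%E.
  rewrite /B ExZ //; last by mfun.
  apply: (@le_trans _ _ ((l ^+ 2 * (2048 * expR 1))%:E * (4 * expR 2)%:E)%E).
    by rewrite lee_wpmul2l ?lee_fin//; exact: subg_exp_sq.
  rewrite -EFinM lee_fin /chi_const.
  set u := expR 1; set v := expR 2; set p := l ^+ 2; lra.
clearbody B.
have t1' : 0 <= `|l| * tau by rewrite mulr_ge0.
have t2' : 0 <= (`|l| + l) * tau by rewrite mulr_ge0.
have nn w : 0 <= `|l| * Y w ^+ 2 by rewrite mulr_ge0 ?sqr_ge0.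
have nn' w : 0 <= (`|l| + l) * Y w ^+ 2 by rewrite mulr_ge0 ?sqr_ge0.
rewrite !ExD ?Ex_cst; try (by mfun);
  try (by move=> w; rewrite ?expR_ge0 ?mulr_ge0); try (by move=> w; apply: addr_ge0).
rewrite !ExZ ?EY //; try (by mfun); try (by move=> w; exact: sqr_ge0).
have EB0 := Ex_ge0 P B0.
case: (Ex B) EB EB0 => [b| |] // EB _.
have E0 : (0 <= Ex (fun w => expR (l * (Y w ^+ 2 - tau))))%E.
  by apply: Ex_ge0 => w; exact: expR_ge0.
case: (Ex _) E0 => [e| |] // _.
rewrite -!EFinM -!EFinD !lee_fin in EB * => H.
apply: le_trans (expR_ge1Dx _); lra.
Qed.

End ChiSquare.

(** * Euclidean space and the largest eigenvalue *)

Lemma sqrD_le (R : realType) (x y : R) : (x + y) ^+ 2 <= 2 * x ^+ 2 + 2 * y ^+ 2.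
Proof. by have := sqr_ge0 (x - y); lra. Qed.

Section EuclideanSpace.
Context (R : realType) (d : nat).
Implicit Types (u v x y z : 'cV[R]_d) (A : 'M[R]_d).

Lemma edotC u v : edot u v = edot v u.
Proof. by apply: eq_bigr => i _; rewrite mulrC. Qed.

Lemma edotDl u v x : edot (u + v) x = edot u x + edot v x.
Proof. by rewrite -big_split; apply: eq_bigr => i _; rewrite mxE mulrDl. Qed.

Lemma edotZl a u x : edot (a *: u) x = a * edot u x.
Proof. by rewrite mulr_sumr; apply: eq_bigr => i _; rewrite mxE mulrA. Qed.

Lemma edotNl u x : edot (- u) x = - edot u x.
Proof. by rewrite -scaleN1r edotZl mulN1r. Qed.

Lemma edotBl u v x : edot (u - v) x = edot u x - edot v x.
Proof. by rewrite edotDl edotNl. Qed.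

Lemma edotDr u v x : edot x (u + v) = edot x u + edot x v.
Proof. by rewrite edotC edotDl !(edotC x). Qed.

Lemma edotZr a u x : edot x (a *: u) = a * edot x u.
Proof. by rewrite edotC edotZl !(edotC x). Qed.

Lemma edotNr u x : edot x (- u) = - edot x u.
Proof. by rewrite edotC edotNl !(edotC x). Qed.

Lemma edotBr u v x : edot x (u - v) = edot x u - edot x v.
Proof. by rewrite edotDr edotNr. Qed.

Lemma edot0l x : edot 0 x = 0.
Proof. by rewrite -(scale0r (0 : 'cV[R]_d)) edotZl mul0r. Qed.

Lemma edot0r x : edot x 0 = 0.
Proof. by rewrite edotC edot0l. Qed.

Lemma edot_ge0 x : 0 <= edot x x.
Proof. by apply: sumr_ge0 => i _; rewrite -expr2 sqr_ge0. Qed.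

Lemma enorm_ge0 x : 0 <= enorm x.
Proof. exact: sqrtr_ge0. Qed.

Lemma enorm_sq x : enorm x ^+ 2 = edot x x.
Proof. by rewrite sqr_sqrtr// edot_ge0. Qed.

Lemma edot_eq0 x : edot x x = 0 -> x = 0.
Proof.
move=> /eqP; rewrite psumr_eq0; last by move=> i _; rewrite -expr2 sqr_ge0.
move=> /allP H; apply/matrixP => i j; rewrite ord1 mxE.
by have := H i (mem_index_enum _) => /=; rewrite mulf_eq0 orbb => /eqP.
Qed.

Lemma enorm_eq0 x : enorm x = 0 -> x = 0.
Proof. by move=> x0; apply: edot_eq0; rewrite -enorm_sq x0 expr0n. Qed.

Lemma enormZ a x : enorm (a *: x) = `|a| * enorm x.
Proof.
by rewrite /enorm edotZl edotZr mulrA -expr2 sqrtrM ?sqr_ge0// sqrtr_sqr.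
Qed.

Lemma enormN x : enorm (- x) = enorm x.
Proof. by rewrite -scaleN1r enormZ normrN1 mul1r. Qed.

Lemma edot_mulmx m (A : 'M[R]_(m, d)) x (y : 'cV[R]_m) :
  edot (A *m x) y = edot x (A^T *m y).
Proof.
rewrite /edot; under eq_bigr do rewrite mxE mulr_suml.
rewrite exchange_big; apply: eq_bigr => j _ /=.
rewrite mxE mulr_sumr; apply: eq_bigr => i _; rewrite mxE; ring.
Qed.

Lemma quadD A x y : A^T = A ->
  edot (x + y) (A *m (x + y)) =
  edot x (A *m x) + 2 * edot x (A *m y) + edot y (A *m y).
Proof.
move=> sA; rewrite mulmxDr !edotDl !edotDr.
have -> : edot y (A *m x) = edot x (A *m y) by rewrite edotC edot_mulmx sA.
ring.
Qed.

Lemma quadZ A a x : edot (a *: x) (A *m (a *: x)) = a ^+ 2 * edot x (A *m x).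
Proof. by rewrite -scalemxAr edotZl edotZr mulrA. Qed.

(** Cauchy-Schwarz for the semi-inner product defined by [A]: the quadratic in
    [t] given by [t *: x + y] has no negative value. *)
Lemma psd_cauchy_schwarz A x y : A^T = A ->
  (forall z, 0 <= edot z (A *m z)) ->
  edot x (A *m y) ^+ 2 <= edot x (A *m x) * edot y (A *m y).
Proof.
move=> sA pA.
set a := edot x (A *m x); set b := edot x (A *m y); set c := edot y (A *m y).
have H t : 0 <= t ^+ 2 * a + 2 * t * b + c.
  have := pA (t *: x + y); rewrite quadD// quadZ edotZl -/a -/b -/c; lra.
have a0 : 0 <= a by exact: pA.
have c0 : 0 <= c by exact: pA.
have [a_gt0|a_le0] := ltP 0 a.
  have := H (- b / a); have -> : (- b / a) ^+ 2 * a + 2 * (- b / a) * b + c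
     = (a * c - b ^+ 2) / a by field; rewrite gt_eqF.
  by rewrite pmulr_lge0 ?invr_gt0// subr_ge0.
have a00 : a = 0 by apply/eqP; rewrite eq_le a_le0 a0.
rewrite a00 mul0r; have [->|b0] := eqVneq b 0; first by rewrite expr0n.
(* an affine function of t with nonzero slope takes the value -1 *)
have := H (- (c + 1) / (2 * b)); rewrite a00 mulr0 add0r.
have -> : 2 * (- (c + 1) / (2 * b)) * b + c = - 1 by field.
lra.
Qed.

Lemma cauchy_schwarz x y : edot x y ^+ 2 <= edot x x * edot y y.
Proof.
have := @psd_cauchy_schwarz 1%:M x y (trmx1 _ _); rewrite !mul1mx; apply.
by move=> z; rewrite mul1mx edot_ge0.
Qed.

Lemma ler_edot x y : `|edot x y| <= enorm x * enorm y.
Proof.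
rewrite -sqrtrM ?edot_ge0// -sqrtr_sqr ler_sqrt ?mulr_ge0 ?edot_ge0//.
exact: cauchy_schwarz.
Qed.

Lemma enormD x y : enorm (x + y) <= enorm x + enorm y.
Proof.
rewrite -(@ler_pXn2r _ 2) ?nnegrE ?addr_ge0 ?enorm_ge0//.
rewrite enorm_sq edotDl !edotDr sqrrD !enorm_sq (edotC y x).
have := le_trans (ler_norm _) (ler_edot x y); lra.
Qed.

Lemma enormB x y : enorm (x - y) <= enorm x + enorm y.
Proof. by rewrite -[enorm y]enormN enormD. Qed.

Lemma enorm_mulmx_le A : exists2 M, 0 <= M & forall x, enorm (A *m x) <= M * enorm x.
Proof.
exists (Num.sqrt (\sum_i edot ((row i A)^T) ((row i A)^T))); first exact: sqrtr_ge0.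
move=> x; rewrite /enorm -sqrtrM; last by apply: sumr_ge0 => i _; exact: edot_ge0.
rewrite ler_sqrt; last by rewrite mulr_ge0 ?edot_ge0//; apply: sumr_ge0 => i _; exact: edot_ge0.
rewrite {1}/edot mulr_suml; apply: ler_sum => i _; rewrite -expr2.
have -> : (A *m x) i 0 = edot ((row i A)^T) x.
  by rewrite mxE; apply: eq_bigr => j _; rewrite !mxE.
exact: cauchy_schwarz.
Qed.

Lemma quad_le_bound A : exists2 M, 0 <= M & forall x, `|edot x (A *m x)| <= M * edot x x.
Proof.
have [M M0 H] := enorm_mulmx_le A; exists M => // x.
apply: (le_trans (ler_edot _ _)); rewrite -enorm_sq.
have := H x; have := enorm_ge0 x; nra.
Qed.

(** Polarization, and the parallelogram identity for the sum of the squared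
    norms of [x + y] and [x - y]. *)
Lemma polarization_bound A (q : R) : A^T = A ->
  (forall x, `|edot x (A *m x)| <= q * edot x x) ->
  forall x y, enorm x = 1 -> enorm y = 1 -> `|edot x (A *m y)| <= q.
Proof.
move=> sA H x y x1 y1.
have E : 4 * edot x (A *m y) =
    edot (x + y) (A *m (x + y)) - edot (x - y) (A *m (x - y)).
  have -> : x - y = x + (-1) *: y by rewrite scaleN1r.
  rewrite !quadD// quadZ -scalemxAr edotZr; ring.
have N : edot (x + y) (x + y) + edot (x - y) (x - y) = 4.
  rewrite !edotDl !edotDr !edotNl !edotNr -!enorm_sq x1 y1; ring.
have H1 := H (x + y); have H2 := H (x - y).
have : q * edot (x + y) (x + y) + q * edot (x - y) (x - y) = 4 * q.
  by rewrite -mulrDr N mulrC.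
rewrite !ler_norml in H1 H2 *; lra.
Qed.

(** The supremum [mu] of the Rayleigh quotients is an eigenvalue: [mu - A] is
    positive semidefinite, and were it invertible its quadratic form would be
    bounded below by a positive [c], so that [mu - c] would still bound the
    quotients.  As every eigenvalue is a Rayleigh quotient, [mu] is
    [lambda_max A]. *)
Lemma rayleigh_le_lambda_max A x : A^T = A ->
  edot x (A *m x) <= lambda_max A * edot x x.
Proof.
move=> sA.
have [M M0 HM] := quad_le_bound A.
have [->|xn0] := eqVneq x 0; first by rewrite mulmx0 !edot0l mulr0.
have x_gt0 z : z != 0 -> 0 < edot z z.
  by move=> z0; rewrite lt_def edot_ge0 andbT; apply: contraNneq z0 => /edot_eq0 ->.
pose S : set R := [set edot z (A *m z) / edot z z | z in [set z | z != 0]].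
have Sub r : S r -> r <= M.
  move=> [z z0 <-]; rewrite ler_pdivrMr ?x_gt0//.
  exact: le_trans (ler_norm _) (HM z).
have hS : has_sup S by split; [exists (edot x (A *m x) / edot x x), x|exists M].
pose mu := sup S.
have Hmu z : edot z (A *m z) <= mu * edot z z.
  have [->|z0] := eqVneq z 0; first by rewrite mulmx0 !edot0l mulr0.
  by rewrite -ler_pdivrMr ?x_gt0//; apply: ub_le_sup; [case: hS|exists z].
pose B := mu%:M - A.
have sB : B^T = B by rewrite /B linearB /= tr_scalar_mx sA.
have EB z : edot z (B *m z) = mu * edot z z - edot z (A *m z).
  by rewrite /B mulmxBl mul_scalar_mx edotBr edotZr.
have pB z : 0 <= edot z (B *m z) by rewrite EB subr_ge0.
have muE : eigenvalue A mu.
  apply: contraT => nev.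
  have uB : B \in unitmx.
    rewrite -row_free_unit -kermx_eq0 /B.
    have := nev; rewrite /eigenvalue negbK /eigenspace => /eqP k0.
    apply/eqP/row_matrixP => i; rewrite row0.
    have H : (row i (kermx (mu%:M - A)) *m (A - mu%:M)) = 0.
      rewrite -[A - mu%:M]opprB mulmxN; apply/eqP; rewrite oppr_eq0; apply/eqP.
      by apply/sub_kermxP; exact: row_sub.
    by move/sub_kermxP : H; rewrite k0 submx0 => /eqP.
  have [N N0 HN] := enorm_mulmx_le (invmx B).
  have [L L0 HL] := quad_le_bound B.
  (* |z| <= N |B z| and |B z|^2 <= L <z, B z>, the latter by Cauchy-Schwarz for
     B; hence c bounds B below. *)
  pose c := ((L + 1) * (N ^+ 2 + 1))^-1.
  have LN : 0 < (L + 1) * (N ^+ 2 + 1).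
    by rewrite mulr_gt0// ltr_wpDl// sqr_ge0.
  have c0 : 0 < c by rewrite invr_gt0.
  have key z : c * edot z z <= edot z (B *m z).
    set y := B *m z.
    have zE : z = invmx B *m y by rewrite /y mulKmx.
    have n1 : edot z z <= N ^+ 2 * edot y y.
      rewrite -!enorm_sq -exprMn lerXn2r ?nnegrE ?mulr_ge0 ?enorm_ge0//.
      by rewrite {1}zE.
    have cs := psd_cauchy_schwarz y z sB pB; rewrite -/y in cs.
    have yy := edot_ge0 y; have zz := edot_ge0 z.
    have n2 : edot y y <= L * edot z y.
      have [y0|y0] := eqVneq (edot y y) 0; first by rewrite y0 mulr_ge0//; exact: pB.
      have y1 : 0 < edot y y by rewrite lt_def y0.
      rewrite -(ler_pM2l y1) -expr2; apply: (le_trans cs).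
      have := le_trans (ler_norm _) (HL y); have := pB z; rewrite -/y => p1 p2.
      have : edot y (B *m y) * edot z y <= L * edot y y * edot z y by rewrite ler_wpM2r.
      lra.
    have p := pB z; rewrite -/y in p.
    rewrite /c ler_pdivrMl//.
    apply: (le_trans n1).
    apply: (@le_trans _ _ (N ^+ 2 * (L * edot z y))).
      by rewrite ler_wpM2l ?sqr_ge0.
    have := sqr_ge0 N; set n := N ^+ 2 => n0.
    have : 0 <= n * edot z y by rewrite mulr_ge0.
    have : 0 <= L * edot z y by rewrite mulr_ge0.
    lra.
  have : mu <= mu - c.
    apply: ge_sup; first by case: hS.
    move=> _ [z z0 <-]; rewrite ler_pdivrMr ?x_gt0//.
    by have := key z; rewrite EB; lra.
  lra.
apply: (le_trans (Hmu x)); rewrite ler_wpM2r ?edot_ge0//.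
apply: ub_le_sup => //; exists mu => a /eigenvalueP[v vA v0].
have v0' : v^T != 0 by rewrite -trmx_eq0 trmxK.
have := Hmu v^T.
have -> : A *m v^T = a *: v^T.
  by rewrite -[A in LHS]sA -trmx_mul vA linearZ.
by rewrite edotZr ler_pM2r// x_gt0.
Qed.

End EuclideanSpace.

(** * Perturbation of a rank-one spike *)

Section Perturbation.
Context (R : realType) (d : nat).
Implicit Types (u v x y z : 'cV[R]_d) (A E S : 'M[R]_d).

Lemma enorm_gt0 x : x != 0 -> 0 < enorm x.
Proof.
by move=> x0; rewrite lt_def enorm_ge0 andbT; apply: contraNneq x0 => /enorm_eq0 ->.
Qed.

Lemma enorm0 : enorm (0 : 'cV[R]_d) = 0.
Proof. by rewrite /enorm edot0l sqrtr0. Qed.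

Lemma bilinear_bound E (q : R) x y : E^T = E ->
  (forall z, `|edot z (E *m z)| <= q * edot z z) ->
  `|edot x (E *m y)| <= q * (enorm x * enorm y).
Proof.
move=> sE H.
have [->|x0] := eqVneq x 0; first by rewrite edot0l normr0 enorm0 mul0r mulr0.
have [->|y0] := eqVneq y 0; first by rewrite mulmx0 edot0r normr0 enorm0 !mulr0.
have xp := enorm_gt0 x0; have yp := enorm_gt0 y0.
have u1 z : 0 < enorm z -> enorm ((enorm z)^-1 *: z) = 1.
  by move=> zp; rewrite enormZ gtr0_norm ?invr_gt0// mulVf// gt_eqF.
have := polarization_bound sE H (u1 _ xp) (u1 _ yp).
rewrite -scalemxAr edotZl edotZr !normrM.
rewrite (@gtr0_norm _ (enorm x)^-1) ?invr_gt0// (@gtr0_norm _ (enorm y)^-1) ?invr_gt0//.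
by rewrite mulrA -invfM mulrC ler_pdivrMr ?mulr_gt0.
Qed.

Lemma lossN (t theta : 'cV[R]_d) : loss (- t) theta = loss t theta :> R.
Proof.
rewrite /loss minC -(enormN (- t + theta)) -(enormN (- t - theta)).
by rewrite !opprD !opprK.
Qed.

Lemma loss_ge0 (t theta : 'cV[R]_d) : 0 <= loss t theta :> R.
Proof. by rewrite /loss le_min !enorm_ge0. Qed.

Lemma loss_le (t theta : 'cV[R]_d) : loss t theta <= enorm (t - theta) :> R.
Proof. by rewrite /loss ge_min lexx. Qed.

Section Spiked.
Variables (S E : 'M[R]_d) (theta v : 'cV[R]_d) (kappa s e : R).
Hypothesis SE : S = kappa%:M + s ^+ 2 *: (theta *m theta^T) + E.
Hypothesis sE : E^T = E.
Hypothesis He : forall x, `|edot x (E *m x)| <= e * edot x x.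
Hypothesis s01 : 0 <= s <= 1.
Hypothesis Sv : S *m v = lambda_max S *: v.
Hypothesis v1 : enorm v = 1.

Let lam := lambda_max S - kappa.
Let est := Num.sqrt (Num.max lam 0) *: v.
Let t := enorm theta.

Let symS : S^T = S.
Proof.
rewrite SE !linearD /= linearZ /= tr_scalar_mx sE trmx_mul trmxK.
by [].
Qed.

Let vv : edot v v = 1. Proof. by rewrite -enorm_sq v1 expr1n. Qed.

Let mul_rank1 x : (theta *m theta^T) *m x = edot theta x *: theta.
Proof.
rewrite -mulmxA; apply/matrixP => i j; rewrite !ord1 mxE big_ord1 mulrC mxE.
by rewrite [RHS]mxE; congr (_ * _); apply: eq_bigr => a _; rewrite mxE.
Qed.

Let quadS x y : edot x (S *m y) =
  kappa * edot x y + s ^+ 2 * (edot theta x * edot theta y) + edot x (E *m y).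
Proof.
rewrite SE !mulmxDl !edotDr mul_scalar_mx edotZr -scalemxAl edotZr mul_rank1 edotZr.
by rewrite (edotC x theta) [edot theta x * _]mulrC.
Qed.

Let e0 : 0 <= e.
Proof. by have := He v; rewrite vv mulr1; apply: le_trans. Qed.

Let lamE : lam = s ^+ 2 * edot theta v ^+ 2 + edot v (E *m v).
Proof.
have := quadS v v; rewrite Sv edotZr vv /lam; lra.
Qed.

Let tt : t ^+ 2 = edot theta theta. Proof. exact: enorm_sq. Qed.

Let cs : edot theta v ^+ 2 <= t ^+ 2.
Proof. by have := cauchy_schwarz theta v; rewrite vv mulr1 -tt. Qed.

Let lam_le : lam <= (s * t) ^+ 2 + e.
Proof.
rewrite lamE exprMn; apply: lerD; first by rewrite ler_wpM2l ?sqr_ge0.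
by have := le_trans (ler_norm _) (He v); rewrite vv mulr1.
Qed.

Let lam_ge : theta != 0 -> (s * t) ^+ 2 - e <= lam.
Proof.
move=> th0; have t0 : 0 < t ^+ 2 by rewrite exprn_gt0// enorm_gt0.
have := rayleigh_le_lambda_max theta symS; rewrite quadS -tt => H.
have := He theta; rewrite -tt ler_norml => /andP[H1 _].
rewrite -(ler_pM2r t0) /lam; lra.
Qed.

Let est_sq : enorm est ^+ 2 = Num.max lam 0.
Proof.
by rewrite enormZ v1 mulr1 ger0_norm ?sqrtr_ge0// sqr_sqrtr// le_max lexx orbT.
Qed.

(** The excess eigenvalue is at most [t^2 + e], hence so is the squared norm of
    the estimator: both vectors are small when [t] is. *)
Lemma spiked_loss_coarse : loss est theta ^+ 2 <= 4 * t ^+ 2 + 2 * e.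
Proof.
have L : loss est theta <= enorm est + t by apply: le_trans (loss_le _ _) (enormB _ _).
have /andP[s0 s1] := s01.
have st : (s * t) ^+ 2 <= t ^+ 2.
  rewrite exprMn ler_piMl ?sqr_ge0// expr_le1//.
have E2 : enorm est ^+ 2 <= t ^+ 2 + e.
  by rewrite est_sq ge_max addr_ge0 ?sqr_ge0//; have := lam_le; lra.
have := loss_ge0 est theta; have := enorm_ge0 est; have t0 : 0 <= t := enorm_ge0 _.
set a := enorm est in L E2 * => a0 l0.
have : loss est theta ^+ 2 <= (a + t) ^+ 2 by rewrite lerXn2r// nnegrE addr_ge0.
by have := sqrD_le a t; lra.
Qed.

(** The estimator is compared with [s *: theta], which leaves the bias [(1 - s) t].
    Taking the inner product of the eigenvector equation with the component [w]
    of [v] orthogonal to [theta] gives [lam |w|^2 = <w, E v>], hence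
    [|w| <= e / lam] (a sin-theta bound), and [sqrt lam] differs from [s t] by at
    most [e/(s t)]. *)
Lemma spiked_loss_fine : theta != 0 -> 0 < s ->
  loss est theta ^+ 2 <= 50 * (e / (s * t)) ^+ 2 + 2 * ((1 - s) * t) ^+ 2.
Proof.
move=> th0 s0; have /andP[_ s1] := s01.
have t0 : 0 < t := enorm_gt0 th0.
pose a := s * t; have a0 : 0 < a by rewrite mulr_gt0.
suff H : exists2 v', v' = v \/ v' = - v &
    enorm (Num.sqrt (Num.max lam 0) *: v' - s *: theta) <= 5 * (e / a).
  have [v' vE D] := H; set est' := Num.sqrt _ *: v' in D.
  have -> : loss est theta = loss est' theta.
    by case: vE => E'; rewrite /est' E' // scalerN lossN.
  have L : loss est' theta <= 5 * (e / a) + (1 - s) * t.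
    apply: (le_trans (loss_le _ _)).
    have -> : est' - theta = (est' - s *: theta) - (1 - s) *: theta.
      by rewrite scalerBl scale1r opprB addrA subrK.
    apply: (le_trans (enormB _ _)); apply: lerD => //.
    by rewrite enormZ ger0_norm ?subr_ge0.
  have ea0 : 0 <= e / a by rewrite divr_ge0// ltW.
  have b0 : 0 <= (1 - s) * t by rewrite mulr_ge0 ?subr_ge0// ltW.
  have l0 := loss_ge0 est' theta.
  set p := e / a in L ea0 *; set q := (1 - s) * t in L b0 *.
  have : loss est' theta ^+ 2 <= (5 * p + q) ^+ 2.
    by rewrite lerXn2r// nnegrE addr_ge0// mulr_ge0.
  by have := sqrD_le (5 * p) q; rewrite (exprMn _ 5 p); lra.
have [v' vE v'0] : exists2 v', v' = v \/ v' = - v & 0 <= edot theta v'.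
  have [p|p] := leP 0 (edot theta v); first by exists v => //; left.
  by exists (- v); [right|rewrite edotNr oppr_ge0 ltW].
exists v' => //.
have v'v' : edot v' v' = 1 by case: vE => ->; rewrite ?edotNl ?edotNr ?opprK.
have v'1 : enorm v' = 1 by rewrite /enorm v'v' sqrtr1.
have Sv' : S *m v' = lambda_max S *: v'.
  by case: vE => ->; rewrite ?mulmxN ?scalerN Sv.
have esq : enorm (Num.sqrt (Num.max lam 0) *: v') ^+ 2 = Num.max lam 0.
  by rewrite enormZ v'1 mulr1 ger0_norm ?sqrtr_ge0// sqr_sqrtr// le_max lexx orbT.
have l1 := lam_le; have l2 := lam_ge th0; rewrite -/a in l1 l2.
have [big|small] := leP (a ^+ 2) (2 * e).
  (* e/(s t) is then at least a multiple of s t, and norms suffice *)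
  apply: (le_trans (enormB _ _)).
  rewrite enormZ gtr0_norm// -/t -/a.
  set r := enorm _ in esq *; have r0 : 0 <= r := enorm_ge0 _.
  have r2 : r ^+ 2 <= 3 * e by rewrite esq ge_max; apply/andP; split; lra.
  have p0 : 0 <= 5 * (e / a) by rewrite mulr_ge0// divr_ge0// ltW.
  rewrite -(@ler_pXn2r _ 2) ?nnegrE ?addr_ge0 ?(ltW a0)//.
  have : 20 * e ^+ 2 / a ^+ 2 <= (5 * (e / a)) ^+ 2.
    have -> : 20 * e ^+ 2 / a ^+ 2 = 20 * (e / a) ^+ 2 by field; rewrite gt_eqF.
    by have := sqr_ge0 (e / a); set p := e / a; lra.
  apply: le_trans.
  rewrite ler_pdivlMr ?exprn_gt0//.
  have X : (r + a) ^+ 2 <= 10 * e.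
    by have := sqrD_le r a; lra.
  have := sqr_ge0 (r + a); have := sqr_ge0 a; set A2 := a ^+ 2 in big *.
  set X2 := (r + a) ^+ 2 in X * => A0 X0.
  have : X2 * A2 <= (10 * e) * (2 * e) by apply: ler_pM.
  lra.
have lam0 : 0 < lam by have := sqr_ge0 a; lra.
rewrite (max_l (ltW lam0)) {esq}.
pose c := edot theta v' / t.
have c0 : 0 <= c by rewrite divr_ge0// ltW.
have thv : edot theta v' = c * t by rewrite divfK// gt_eqF.
pose w := v' - (c / t) *: theta.
have tn0 : t != 0 by rewrite gt_eqF.
have thw : edot theta w = 0.
  by rewrite edotBr edotZr thv -tt; field.
have ww : edot w w = 1 - c ^+ 2.
  rewrite {1}/w edotBl edotZl thw mulr0 subr0 /w edotBr edotZr v'v' edotC thv.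
  by field.
have c1 : c <= 1.
  rewrite -(@ler_pXn2r _ 2) ?nnegrE// expr1n -subr_ge0 -ww; exact: edot_ge0.
have wv : edot w v' = edot w w.
  by rewrite {3}/w edotBr edotZr [edot w theta]edotC thw mulr0 subr0.
have wbound : enorm w <= e / lam.
  have [->|wn0] := eqVneq (enorm w) 0; first by rewrite divr_ge0// ltW.
  have wp : 0 < enorm w by rewrite lt_def wn0 enorm_ge0.
  rewrite ler_pdivlMr// -(ler_pM2r wp).
  have := quadS w v'; rewrite Sv' edotZr wv thw mul0r mulr0 addr0 -enorm_sq.
  have := bilinear_bound w v' sE He; rewrite v'1 mulr1 ler_norml => /andP[_ B] Q.
  rewrite /lam; lra.
set r := Num.sqrt lam.
have r0 : 0 <= r by exact: sqrtr_ge0.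
have r2 : r ^+ 2 = lam by rewrite sqr_sqrtr// ltW.
have ra : `|r - a| <= e / a.
  rewrite ler_pdivlMr// -[X in _ * X]gtr0_norm// -normrM.
  have : `|(r - a) * (r + a)| <= e by rewrite -subr_sqr r2 ler_norml; lra.
  apply: le_trans; rewrite [`|(r - a) * a|]normrM [`|_ * (r + a)|]normrM ler_wpM2l// (gtr0_norm a0) ger0_norm; last first.
    by rewrite addr_ge0// ltW.
  by rewrite lerDr.
(* the squared chord is 2 (1 - c), at most twice 1 - c^2 *)
have dv : enorm (v' - t^-1 *: theta) <= 2 * enorm w.
  rewrite -(@ler_pXn2r _ 2) ?nnegrE ?mulr_ge0 ?enorm_ge0// exprMn !enorm_sq ww.
  have -> : edot (v' - t^-1 *: theta) (v' - t^-1 *: theta) = 2 - 2 * c.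
    rewrite edotBl !edotBr !edotZl !edotZr v'v' [edot v' theta]edotC thv -tt.
    by field.
  have : 0 <= c * (1 - c) by rewrite mulr_ge0// subr_ge0.
  lra.
have -> : r *: v' - s *: theta = (r - a) *: v' + a *: (v' - t^-1 *: theta).
  rewrite scalerBl scalerBr scalerA addrA subrK; congr (_ - _ *: _).
  by rewrite /a mulfK.
apply: (le_trans (enormD _ _)); rewrite !enormZ v'1 mulr1 (gtr0_norm a0).
have lam2 : a ^+ 2 / 2 <= lam by lra.
have el : e / lam <= 2 * (e / a ^+ 2).
  rewrite ler_pdivrMr// -mulrA mulrCA.
  have -> : e = (e / a ^+ 2) * a ^+ 2 :> R by rewrite divfK// gt_eqF// exprn_gt0.
  have ea : 0 <= e / a ^+ 2 by rewrite divr_ge0// sqr_ge0.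
  set z := e / a ^+ 2 in ea *; rewrite mulfK ?gt_eqF ?exprn_gt0//.
  have : z * (a ^+ 2 / 2) <= z * lam by rewrite ler_wpM2l.
  lra.
have : a * enorm (v' - t^-1 *: theta) <= a * (4 * (e / a ^+ 2)).
  by rewrite ler_pM2l//; lra.
have -> : a * (4 * (e / a ^+ 2)) = 4 * (e / a) by field; rewrite gt_eqF.
lra.
Qed.

End Spiked.
End Perturbation.

(** * A net of the unit sphere *)

Section Net.
Context (R : realType).

Definition net_bound (d : nat) : R := expR (6 * d%:R).

(** The points need not lie on the sphere, so that grid points qualify; the
    exponential moments only need their norms to be bounded. *)
Definition is_net (d : nat) (s : seq 'cV[R]_d) : Prop :=
  [/\ (size s)%:R <= net_bound d, forall z, z \in s -> enorm z <= 2 &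
      forall x, enorm x = 1 -> exists2 z, z \in s & enorm (x - z) <= 1 / 4].

Lemma half_sum (N : nat) : \sum_(i < N) (2^-1 : R) ^+ i <= 2.
Proof.
suff -> : \sum_(i < N) (2^-1 : R) ^+ i = 2 - 2 * 2^-1 ^+ N.
  by rewrite gerBl mulr_ge0// exprn_ge0.
elim: N => [|N IH]; first by rewrite big_ord0 expr0; lra.
rewrite big_ord_recr /= IH exprS; lra.
Qed.

(** Lattice points of bounded l1 norm, coded by signs and absolute values, each
    weighted by [2^(-|g|)]: the weights are at least [2^(-w)] on the set that is
    counted, and their total factors over the coordinates. *)
Lemma lattice_count (d N w : nat) :
  (#|[pred g : {ffun 'I_d -> bool * 'I_N} | (\sum_a (g a).2 <= w)%N]|)%:R
    <= 2 ^+ w * 4 ^+ d :> R.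
Proof.
rewrite -sum1_card natr_sum.
pose F (p : bool * 'I_N) : R := 2^-1 ^+ p.2.
have F0 p : 0 <= F p by rewrite exprn_ge0.
apply: (@le_trans _ _ (\sum_(g : {ffun 'I_d -> bool * 'I_N}) 2 ^+ w * \prod_a F (g a))).
  rewrite [X in _ <= X](bigID (fun g : {ffun 'I_d -> bool * 'I_N} =>
    (\sum_a (g a).2 <= w)%N)) /=.
  apply: ler_wpDr.
    by apply: sumr_ge0 => g _; rewrite mulr_ge0 ?exprn_ge0//; exact: prodr_ge0.
  apply: ler_sum => g gw; rewrite /F -expr_sum exprVn ler_pdivlMr ?exprn_gt0//.
  by rewrite mul1r ler_weXn2l// ler1n.
rewrite -mulr_sumr ler_wpM2l ?exprn_ge0//.
rewrite -(bigA_distr_bigA (fun _ p => F p)) /=.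
rewrite prodr_const card_ord lerXn2r ?nnegrE//; first by apply: sumr_ge0.
have -> : \sum_(p : bool * 'I_N) F p = \sum_(b : bool) \sum_(i < N) 2^-1 ^+ i.
  by rewrite pair_bigA.
rewrite big_bool /=; apply: (le_trans (lerD (half_sum N) (half_sum N))); lra.
Qed.

(** Truncate the coordinates of [x] towards 0 on a grid of mesh
    [h = 1/(4 sqrt d)]: the error is at most [h sqrt d = 1/4], and as the l1 norm
    of [x] is at most [sqrt d], the lattice point has l1 norm at most [4 d]. *)
Lemma net_exists (d : nat) : (0 < d)%N -> exists s : seq 'cV[R]_d, is_net s.
Proof.
move=> d0; have D0 : 0 < d%:R :> R by rewrite ltr0n.
pose N := (4 * d).+1.
pose q : R := Num.sqrt d%:R.
have q0 : 0 < q by rewrite sqrtr_gt0.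
have qq : q ^+ 2 = d%:R by rewrite sqr_sqrtr// ltW.
pose h : R := (4 * q)^-1.
have h0 : 0 < h by rewrite invr_gt0 mulr_gt0.
pose T := {ffun 'I_d -> bool * 'I_N}.
pose vec (g : T) : 'cV[R]_d := \col_a ((-1) ^+ (g a).1 * ((g a).2%:R * h)).
pose s := [seq z <- [seq vec g | g in [pred g : T | (\sum_a (g a).2 <= 4 * d)%N]] |
           enorm z <= 2].
exists s; split.
- apply: (@le_trans _ _ (2 ^+ (4 * d) * 4 ^+ d)).
    apply: le_trans (lattice_count d N (4 * d)).
    rewrite ler_nat size_filter; apply: (leq_trans (count_size _ _)).
    by rewrite size_image.
  have -> : 2 ^+ (4 * d) * 4 ^+ d = 2 ^+ (6 * d) :> R.
    have -> : 4 = 2 ^+ 2 :> R by rewrite expr2; lra.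
    by rewrite -exprM -exprD; congr (_ ^+ _); lia.
  rewrite /net_bound -natrM -[X in expR X]mulr1 expRM_natl lerXn2r ?nnegrE ?expR_ge0//.
  exact: two_le_e.
- by move=> z; rewrite mem_filter => /andP[].
move=> x x1.
have xx : edot x x = 1 by rewrite -enorm_sq x1 expr1n.
pose m a := Num.truncn (`|x a 0| / h).
have mE a : (m a)%:R * h <= `|x a 0| < ((m a)%:R + 1) * h.
  have : 0 <= `|x a 0| / h by rewrite divr_ge0// ltW.
  by move=> /truncn_itv; rewrite natr1 ler_pdivlMr// ltr_pdivrMr.
have sx : \sum_a `|x a 0| <= q.
  have cs := @cauchy_schwarz R d (\col_a `|x a 0|) (const_mx 1).
  rewrite -(@ler_pXn2r _ 2) ?nnegrE ?sumr_ge0 ?(ltW q0)// qq.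
  have E1 : edot (\col_a `|x a 0|) (const_mx 1) = \sum_a `|x a 0|.
    by apply: eq_bigr => a _; rewrite !mxE mulr1.
  have E2 : edot (\col_a `|x a 0|) (\col_a `|x a 0|) = 1.
    rewrite -xx; apply: eq_bigr => a _; rewrite !mxE -expr2 real_normK ?num_real//.
  have E3 : edot (const_mx 1 : 'cV[R]_d) (const_mx 1) = d%:R.
    rewrite /edot (eq_bigr (fun=> 1)) => [|a _]; last by rewrite !mxE mulr1.
    by rewrite sumr_const card_ord.
  by rewrite E1 E2 E3 mul1r in cs.
have sm : (\sum_a m a <= 4 * d)%N.
  rewrite -(ler_nat R) natr_sum natrM.
  apply: (@le_trans _ _ (\sum_a `|x a 0| / h)).
    by apply: ler_sum => a _; rewrite ler_pdivlMr//; have /andP[] := mE a.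
  rewrite -mulr_suml ler_pdivrMr//.
  have -> : 4 * d%:R * h = q by rewrite -qq /h; field; rewrite gt_eqF.
  exact: sx.
have mN a : (m a < N)%N.
  rewrite /N ltnS; apply: leq_trans sm.
  by rewrite (bigD1 a)//= leq_addr.
pose g : T := [ffun a => (x a 0 < 0, Ordinal (mN a))].
have dx : enorm (x - vec g) <= 1 / 4.
  rewrite -(@ler_pXn2r _ 2) ?nnegrE ?enorm_ge0 ?divr_ge0// enorm_sq.
  apply: (@le_trans _ _ (\sum_(a < d) h ^+ 2)).
    apply: ler_sum => a _; rewrite !mxE ffunE /= -expr2.
    have /andP[m1 m2] := mE a.
    rewrite -[_ ^+ 2]real_normK ?num_real// lerXn2r ?nnegrE// ?(ltW h0)//.
    case: ltP => x0; rewrite ?expr1 ?expr0 ?mulN1r ?mul1r.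
      by rewrite ltr0_norm// in m1 m2; rewrite ler_norml; lra.
    by rewrite ger0_norm// in m1 m2; rewrite ler_norml; lra.
  rewrite sumr_const card_ord -[X in X <= _]mulr_natr -qq /h.
  have -> : (4 * q)^-1 ^+ 2 * q ^+ 2 = (1 / 4) ^+ 2 by field; rewrite gt_eqF.
  by [].
exists (vec g) => //; rewrite mem_filter; apply/andP; split.
  have -> : vec g = x - (x - vec g) by rewrite subKr.
  by have := enormB x (x - vec g); rewrite x1; lra.
apply/mapP; exists g => //; rewrite mem_enum inE; apply: leq_trans sm.
by rewrite leq_eqVlt; apply/orP; left; apply/eqP/eq_bigr => a _; rewrite ffunE.
Qed.

Section NetBounds.
Variables (d : nat) (s : seq 'cV[R]_d).
Hypothesis net_s : is_net s.

Lemma net_enorm_le (u : 'cV[R]_d) (m : R) : 0 <= m ->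
  (forall z, z \in s -> edot u z <= m) -> enorm u <= 4 / 3 * m.
Proof.
move=> m0 H; have [->|u0] := eqVneq u 0; first by rewrite enorm0 mulr_ge0.
have up := enorm_gt0 u0.
pose x := (enorm u)^-1 *: u.
have x1 : enorm x = 1 by rewrite enormZ gtr0_norm ?invr_gt0// mulVf// gt_eqF.
have ux : edot u x = enorm u.
  by rewrite edotZr -enorm_sq expr2 mulrA mulVf ?mul1r// gt_eqF.
have [_ _ /(_ x x1)[z zs xz]] := net_s.
have E : edot u x = edot u z + edot u (x - z) by rewrite edotBr addrC subrK.
have := le_trans (ler_norm _) (ler_edot u (x - z)).
have : enorm u * enorm (x - z) <= enorm u * (1 / 4) by rewrite ler_pM2l.
have := H z zs; lra.
Qed.

(** Replacing [x] by a net point costs at most [|x - z| |x + z|] times the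
    supremum [q] of the form, and [1/4 * 9/4 < 1] lets [q] absorb it. *)
Lemma net_quad_le (A : 'M[R]_d) (m : R) : A^T = A -> 0 <= m ->
  (forall z, z \in s -> `|edot z (A *m z)| <= m) ->
  forall x, `|edot x (A *m x)| <= 3 * m * edot x x.
Proof.
move=> sA m0 H.
have [M M0 HM] := quad_le_bound A.
pose S : set R := [set `|edot x (A *m x)| | x in [set x | enorm x = 1]].
(* in dimension 0 there is no unit vector, and the supremum is void *)
have [[x0 x01]|nex] := pselect (exists x : 'cV[R]_d, enorm x = 1); last first.
  move=> x; have [->|xn0] := eqVneq x 0; first by rewrite edot0l normr0 edot0l mulr0.
  case: nex; exists ((enorm x)^-1 *: x); have xp := enorm_gt0 xn0.
  by rewrite enormZ gtr0_norm ?invr_gt0// mulVf// gt_eqF.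
have hS : has_sup S.
  split; first by exists `|edot x0 (A *m x0)|, x0.
  exists M => _ [x x1 <-]; have := HM x.
  by rewrite -[edot x x]enorm_sq x1 expr1n mulr1.
pose q := sup S.
have q1 x : enorm x = 1 -> `|edot x (A *m x)| <= q.
  by move=> x1; apply: ub_le_sup; [case: hS|exists x].
have q0 : 0 <= q by apply: le_trans (q1 _ x01).
have Hq x : `|edot x (A *m x)| <= q * edot x x.
  have [->|xn0] := eqVneq x 0; first by rewrite edot0l normr0 edot0l mulr0.
  have xp := enorm_gt0 xn0.
  have := q1 ((enorm x)^-1 *: x); rewrite enormZ gtr0_norm ?invr_gt0// mulVf ?gt_eqF//.
  rewrite quadZ normrM ger0_norm ?sqr_ge0// => /(_ erefl).
  by rewrite exprVn mulrC ler_pdivrMr ?exprn_gt0// enorm_sq.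
suff qm : q <= 3 * m.
  by move=> x; apply: (le_trans (Hq x)); rewrite ler_wpM2r// edot_ge0.
suff : q <= m + 9 / 16 * q by lra.
apply: ge_sup; first by case: hS.
move=> _ [x x1 <-].
have [_ s2 /(_ x x1)[z zs xz]] := net_s.
have E : edot x (A *m x) = edot z (A *m z) + edot (x - z) (A *m (x + z)).
  rewrite mulmxDr edotBl !edotDr.
  have -> : edot z (A *m x) = edot x (A *m z) by rewrite edotC edot_mulmx sA.
  ring.
have B := bilinear_bound (x - z) (x + z) sA Hq.
have z1 : enorm z <= 5 / 4.
  have -> : z = x - (x - z) by rewrite subKr.
  by have := enormB x (x - z); rewrite x1; lra.
have xz1 : enorm (x + z) <= 9 / 4 by have := enormD x z; rewrite x1; lra.
have P : enorm (x - z) * enorm (x + z) <= 1 / 4 * (9 / 4).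
  by apply: ler_pM => //; exact: enorm_ge0.
have : q * (enorm (x - z) * enorm (x + z)) <= q * (1 / 4 * (9 / 4)) by rewrite ler_wpM2l.
have := H z zs; rewrite E; have := ler_normD (edot z (A *m z)) (edot (x - z) (A *m (x + z))).
lra.
Qed.

End NetBounds.
End Net.

(** * Arithmetic of the risk bounds *)

Section Rates.
Context (R : realType).
Implicit Types (x y : R).

Lemma cube_le x y : 0 <= y -> x ^+ 3 <= y ^+ 3 -> x <= y.
Proof.
move=> y0 H; have [x0|x0] := leP 0 x; last by rewrite (le_trans (ltW x0)).
by rewrite -(@ler_pXn2r _ 3) ?nnegrE.
Qed.

Lemma pow4 x : x ^+ 4 = (x ^+ 2) ^+ 2.
Proof. by rewrite -exprM. Qed.

Lemma sq_le x y : 0 <= y -> x ^+ 2 <= y ^+ 2 -> x <= y.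
Proof.
move=> y0 H; have [x0|x0] := leP 0 x; last by rewrite (le_trans (ltW x0)).
by rewrite -(@ler_pXn2r _ 2) ?nnegrE.
Qed.

(* p = d/n, L = ell/n, t = |theta|, q = sqrt (delta p), w = sqrt p, g = sqrt (L p),
   r = (delta p / t)^(2/3) is the intermediate rate and a = (delta^2 t^4 / p)^(1/3)
   the term of ell/n that balances variance and bias.  The powers enter through
   their cubes, which turns every comparison into a polynomial one.  Q is the
   squared loss, e the size of the perturbation, s^2 the sign energy. *)
Variables (p delta t L q w g r a Ce e s Q : R).
Hypotheses (p0 : 0 < p) (d0 : 0 < delta) (t0 : 0 <= t) (L0 : 0 < L) (L1 : L <= 1).
Hypotheses (q0 : 0 <= q) (qE : q ^+ 2 = delta * p).
Hypothesis wE : w ^+ 2 = p.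
Hypotheses (g0 : 0 <= g) (gE : g ^+ 2 = L * p).
Hypotheses (r0 : 0 <= r) (rE : 0 < t -> r ^+ 3 * t ^+ 2 = delta ^+ 2 * p ^+ 2).
Hypotheses (a0 : 0 <= a) (aE : a ^+ 3 * p = delta ^+ 2 * t ^+ 4).
Hypothesis LU : L <= 2 * p + delta + a + t ^+ 2.
Hypothesis LL : L = 1 \/ [/\ p <= L, delta <= L, a <= L & t ^+ 2 <= L].
Hypotheses (Ce0 : 1 <= Ce) (eE : e = Ce * (t * w + g)).
Hypotheses (s01 : 0 <= s <= 1) (sL : (1 - s ^+ 2) * L <= 2 * (delta + p)) (sL1 : L = 1 -> s = 1).
Hypothesis Q1 : Q <= 4 * t ^+ 2 + 2 * e.
Hypothesis Q2 : 0 < t -> 0 < s -> Q <= 50 * (e / (s * t)) ^+ 2 + 2 * ((1 - s) * t) ^+ 2.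

(** Every term of [L p] is of the order of the square of [q + p], so the coarse bound
    is of the order [q + p]. *)
Lemma risk_weak_signal : t ^+ 2 <= 64 * (q + p) -> Q <= (400 * Ce + 256) * (q + p).
Proof.
move=> tt.
have m0 : 0 <= q + p by rewrite addr_ge0// ltW.
set m := q + p in tt m0 *.
have qm : q <= m by rewrite lerDl ltW.
have pm : p <= m by rewrite lerDr.
have pp := ltW p0.
have ap : a * p <= 64 * m ^+ 2.
  apply: cube_le; first by rewrite mulr_ge0 ?sqr_ge0.
  have -> : (a * p) ^+ 3 = q ^+ 4 * t ^+ 4.
    transitivity ((a ^+ 3 * p) * p ^+ 2); first by ring.
    by rewrite aE [q ^+ 4]pow4 qE; ring.
  have -> : (64 * m ^+ 2) ^+ 3 = m ^+ 4 * (64 * m) ^+ 2 * 64 by ring.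
  have H1 : q ^+ 4 <= m ^+ 4 by rewrite lerXn2r ?nnegrE.
  have H2 : t ^+ 4 <= (64 * m) ^+ 2.
    by rewrite pow4 lerXn2r ?nnegrE ?sqr_ge0// mulr_ge0.
  have H3 : q ^+ 4 * t ^+ 4 <= m ^+ 4 * (64 * m) ^+ 2 by apply: ler_pM; rewrite ?exprn_ge0.
  have : 0 <= m ^+ 4 * (64 * m) ^+ 2 by rewrite mulr_ge0 ?exprn_ge0// mulr_ge0.
  set z := _ * (64 * m) ^+ 2 in H3 *; lra.
have gm : g <= 12 * m.
  apply: sq_le; first by rewrite mulr_ge0.
  rewrite gE.
  have H : L * p <= (2 * p + delta + a + t ^+ 2) * p by rewrite ler_wpM2r.
  have H1 : p * p <= m ^+ 2 by rewrite expr2 ler_pM.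
  have H2 : delta * p <= m ^+ 2 by rewrite -qE lerXn2r ?nnegrE.
  have H3 : t ^+ 2 * p <= 64 * m * m by rewrite ler_pM ?sqr_ge0.
  have := sqr_ge0 m; nra.
have tw : t * w <= t ^+ 2 + p.
  by have := sqr_ge0 (t - w); have := sqr_ge0 t; rewrite -wE; nra.
have : e <= Ce * (77 * m).
  by rewrite eE ler_pM2l; [lra|have := Ce0; lra].
have : 0 <= m * (Ce - 1) by rewrite mulr_ge0 ?subr_ge0.
have := Q1; lra.
Qed.

Hypothesis strong : 64 * (q + p) <= t ^+ 2.

Let t_gt0 : 0 < t.
Proof.
rewrite lt_def t0 andbT; apply/eqP => t00.
by have := strong; rewrite t00 expr0n /=; have := p0; have := q0; lra.
Qed.

(* a is the bucket fraction at which the variance L p / t^2 equals r *)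
Let apE : a * p = r * t ^+ 2.
Proof.
have E : (a * p) ^+ 3 = (r * t ^+ 2) ^+ 3.
  have -> : (a * p) ^+ 3 = (a ^+ 3 * p) * p ^+ 2 by ring.
  have -> : (r * t ^+ 2) ^+ 3 = (r ^+ 3 * t ^+ 2) * t ^+ 4 by ring.
  rewrite aE (rE t_gt0); ring.
have rt : 0 <= r * t ^+ 2 by rewrite mulr_ge0 ?sqr_ge0.
have ap : 0 <= a * p by rewrite mulr_ge0// ltW.
by apply/le_anti/andP; split; apply: cube_le => //; rewrite E.
Qed.

Let a_delta : 16 * delta <= a.
Proof.
apply: cube_le => //.
rewrite -(ler_pM2r p0) aE.
have qt : (64 * q) ^+ 2 <= t ^+ 4.
  rewrite pow4 lerXn2r ?nnegrE ?mulr_ge0 ?sqr_ge0//.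
  by have := ltW p0; have := strong; lra.
have -> : (16 * delta) ^+ 3 * p = delta ^+ 2 * (64 * q) ^+ 2.
  by rewrite [(64 * q) ^+ 2]exprMn qE; ring.
by rewrite ler_wpM2l ?sqr_ge0.
Qed.

(* 16 delta <= a and 64 p <= t^2 make L large enough for few blocks to flip *)
Let s_half : 1 / 2 <= s ^+ 2.
Proof.
case: LL => [/sL1 ->|[pL dL aL tL]]; first by rewrite expr1n; lra.
have h1 : 16 * delta <= L by exact: le_trans a_delta aL.
have h2 : 64 * p <= L by apply: le_trans tL; apply: le_trans strong; have := p0; have := q0; lra.
by rewrite -(ler_pM2r L0); have := sL; lra.
Qed.

Let s_gt0 : 0 < s.
Proof.
have /andP[s0 _] := s01; rewrite lt_def s0 andbT; apply/eqP => s00.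
by have := s_half; rewrite s00 expr0n /=; lra.
Qed.

Let noise : e ^+ 2 <= 2 * Ce ^+ 2 * (t ^+ 2 * p + L * p).
Proof.
have H : (t * w + g) ^+ 2 <= 2 * (t ^+ 2 * p + L * p).
  by rewrite -gE -wE; have := sqr_ge0 (t * w - g); lra.
by rewrite eE exprMn; have := ler_wpM2l (sqr_ge0 Ce) H; lra.
Qed.

Let snr : (e / (s * t)) ^+ 2 * t ^+ 2 <= 4 * Ce ^+ 2 * (t ^+ 2 * p + L * p).
Proof.
have -> : (e / (s * t)) ^+ 2 * t ^+ 2 = e ^+ 2 / s ^+ 2.
  by field; rewrite (gt_eqF s_gt0) (gt_eqF t_gt0).
rewrite ler_pdivrMr ?exprn_gt0//.
have pp := ltW p0; have L00 := ltW L0.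
have : 0 <= Ce ^+ 2 * (t ^+ 2 * p + L * p).
  by rewrite mulr_ge0 ?sqr_ge0// addr_ge0// mulr_ge0 ?sqr_ge0.
have := noise; rewrite -[X in _ <= X -> _]mulrA -[X in _ -> _ -> _ <= X * _]mulrA.
set z := Ce ^+ 2 * _ => N z0.
have := ler_wpM2l z0 s_half.
lra.
Qed.

(** Variance: each term of [L p / t^2] is at most [p + r], since [a p = r t^2].
    Bias: [(1 - s) L <= 2 (delta + p)]; [a <= L] bounds [(delta t / L)^2] by [r],
    and [p <= L], [t^2 <= L] bound [(p t / L)^2] by [p]. *)
Lemma risk_strong_signal : Q <= (1000 * Ce ^+ 2 + 16) * (p + r).
Proof.
apply: (le_trans (Q2 t_gt0 s_gt0)).
have pp := ltW p0.
have tt0 : 0 < t ^+ 2 by rewrite exprn_gt0.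
have pt : p <= t ^+ 2 by apply: le_trans strong; have := p0; have := q0; lra.
have Lp : L * p <= (3 * p + 2 * r) * t ^+ 2.
  have h1 : p * p <= p * t ^+ 2 by rewrite ler_wpM2l.
  have h2 : delta * p <= r * t ^+ 2.
    apply: cube_le; first by rewrite mulr_ge0// ltW.
    have -> : (r * t ^+ 2) ^+ 3 = (r ^+ 3 * t ^+ 2) * t ^+ 4 by ring.
    have -> : (delta * p) ^+ 3 = (delta ^+ 2 * p ^+ 2) * (delta * p) by ring.
    rewrite rE//; apply: ler_wpM2l; first by rewrite mulr_ge0 ?sqr_ge0.
    rewrite -qE.
    rewrite pow4 lerXn2r ?nnegrE ?sqr_ge0//; have := strong; have := q0; lra.
  have : L * p <= (2 * p + delta + a + t ^+ 2) * p by rewrite ler_wpM2r.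
  have := apE; lra.
have S : (e / (s * t)) ^+ 2 <= 4 * Ce ^+ 2 * (4 * p + 2 * r).
  rewrite -(ler_pM2r tt0); apply: (le_trans snr).
  have C4 : 0 <= 4 * Ce ^+ 2 by rewrite mulr_ge0 ?sqr_ge0.
  rewrite -[leRHS]mulrA; apply: ler_wpM2l => //; lra.
have B : ((1 - s) * t) ^+ 2 <= 8 * (p + r).
  have /andP[s0 s1] := s01.
  case: LL => [/sL1 ->|[pL dL aL tL]].
    by rewrite subrr mul0r expr0n mulr_ge0// addr_ge0.
  have b0 : 0 <= 1 - s by rewrite subr_ge0.
  have b1 : (1 - s) * L <= 2 * (delta + p).
    apply: le_trans sL; rewrite ler_wpM2r ?(ltW L0)//; nra.
  have LL0 : 0 < L ^+ 2 by rewrite exprn_gt0.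
  rewrite -(ler_pM2r LL0) -exprMn mulrAC exprMn.
  have b2 : ((1 - s) * L) ^+ 2 <= (2 * (delta + p)) ^+ 2.
    have b3 := mulr_ge0 b0 (ltW L0).
    by apply: lerXn2r => //; rewrite nnegrE// (le_trans b3).
  apply: (@le_trans _ _ ((2 * (delta + p)) ^+ 2 * t ^+ 2)); first by rewrite ler_pM2r.
  have h1 : p * t ^+ 2 <= L ^+ 2 by rewrite expr2 ler_pM ?sqr_ge0.
  have h2 : delta ^+ 2 * t ^+ 2 <= r * L ^+ 2.
    have -> : delta ^+ 2 * t ^+ 2 = r * a ^+ 2.
      have p2 : p ^+ 2 != 0 by rewrite gt_eqF ?exprn_gt0.
      apply: (mulIf p2).
      have -> : r * a ^+ 2 * p ^+ 2 = r * (a * p) ^+ 2 by ring.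
      rewrite apE; have -> : r * (r * t ^+ 2) ^+ 2 = (r ^+ 3 * t ^+ 2) * t ^+ 2 by ring.
      by rewrite rE//; ring.
    by rewrite ler_wpM2l// lerXn2r ?nnegrE ?(ltW L0).
  have h3 : p * (p * t ^+ 2) <= p * L ^+ 2 by rewrite ler_wpM2l.
  have h4 : (2 * (delta + p)) ^+ 2 <= 8 * delta ^+ 2 + 8 * p ^+ 2.
    by have := sqr_ge0 (delta - p); nra.
  have : (2 * (delta + p)) ^+ 2 * t ^+ 2 <= (8 * delta ^+ 2 + 8 * p ^+ 2) * t ^+ 2.
    by rewrite ler_pM2r.
  move=> h5; apply: (le_trans h5).
  have -> : (8 * delta ^+ 2 + 8 * p ^+ 2) * t ^+ 2 = 8 * (delta ^+ 2 * t ^+ 2) + 8 * (p * (p * t ^+ 2)) by ring.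
  have -> : 8 * (p + r) * L ^+ 2 = 8 * (r * L ^+ 2) + 8 * (p * L ^+ 2) by ring.
  lra.
have : 0 <= Ce ^+ 2 * p by rewrite mulr_ge0 ?sqr_ge0.
have : 0 <= Ce ^+ 2 * r by rewrite mulr_ge0 ?sqr_ge0.
lra.
Qed.

(** Blocks of length one: no bias, and the variance is that with [L = 1]. *)
Lemma risk_fine_blocks : 1 <= a -> Q <= (1000 * Ce ^+ 2 + 16) * (p + p / t ^+ 2).
Proof.
move=> a1.
have L11 : L = 1.
  by case: LL => // -[_ _ aL _]; apply/le_anti; rewrite L1 (le_trans a1).
have s1 := sL1 L11.
apply: (le_trans (Q2 t_gt0 s_gt0)).
have tt0 : 0 < t ^+ 2 by rewrite exprn_gt0.
have S : (e / (s * t)) ^+ 2 <= 4 * Ce ^+ 2 * (p + p / t ^+ 2).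
  rewrite -(ler_pM2r tt0); apply: (le_trans snr).
  have -> : 4 * Ce ^+ 2 * (p + p / t ^+ 2) * t ^+ 2 = 4 * Ce ^+ 2 * (t ^+ 2 * p + p).
    by field; rewrite gt_eqF.
  by rewrite L11 mul1r.
rewrite {2}s1 subrr mul0r expr0n mulr0 addr0.
have : 0 <= p + p / t ^+ 2 by rewrite addr_ge0 ?divr_ge0 ?ltW.
have : 0 <= Ce ^+ 2 * (p + p / t ^+ 2).
  by rewrite mulr_ge0 ?sqr_ge0// addr_ge0 ?divr_ge0 ?ltW.
set z := p + _ in S *; lra.
Qed.

End Rates.

(** * The case distinctions *)

Section RateCases.
Context (R : realType).
Variables (p delta t q w r a K1 K2 Q : R).
Hypotheses (p0 : 0 < p) (p1 : p <= 1) (d0 : 0 < delta) (d1 : delta < 1 / 2) (t0 : 0 <= t).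
Hypotheses (q0 : 0 <= q) (qE : q ^+ 2 = delta * p).
Hypotheses (w0 : 0 <= w) (wE : w ^+ 2 = p).
Hypotheses (r0 : 0 <= r) (rE : 0 < t -> r ^+ 3 * t ^+ 2 = delta ^+ 2 * p ^+ 2).
Hypotheses (a0 : 0 <= a) (aE : a ^+ 3 * p = delta ^+ 2 * t ^+ 4).
Hypotheses (K10 : 0 <= K1) (K20 : 0 <= K2).
Hypothesis weak : t ^+ 2 <= 64 * (q + p) -> Q <= K1 * (q + p).
Hypothesis strong : 64 * (q + p) <= t ^+ 2 -> Q <= K2 * (p + r).
Hypothesis fine_blocks : 64 * (q + p) <= t ^+ 2 -> 1 <= a -> Q <= K2 * (p + p / t ^+ 2).

(* The thresholds of the two bounds and those of the rates agree only up to
   constants; 200 exceeds all the factors lost in between. *)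
Let K := 200 * (K1 + K2).

Let t_gt0 x : 0 <= x -> x < t ^+ 2 -> 0 < t.
Proof.
move=> x0 xt; rewrite lt_def t0 andbT; apply/eqP => tt.
by move: xt; rewrite tt expr0n /=; lra.
Qed.

Let q_gt0 : 0 < q.
Proof.
rewrite lt_def q0 andbT; apply/eqP => q00.
by have := qE; rewrite q00 expr0n /= => /esym/eqP; rewrite gt_eqF ?mulr_gt0.
Qed.

Let rq4 : 0 < t -> r ^+ 3 * t ^+ 2 = q ^+ 4.
Proof. by move=> /rE ->; rewrite pow4 qE; ring. Qed.

Let p_le_r : 0 < t -> p * t ^+ 2 <= delta ^+ 2 -> p <= r.
Proof.
move=> tp H; apply: cube_le => //.
rewrite -(ler_pM2r (exprn_gt0 2 tp)) rE//.
have -> : p ^+ 3 * t ^+ 2 = (p * t ^+ 2) * p ^+ 2 by ring.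
by rewrite ler_wpM2r ?sqr_ge0.
Qed.

Let q_le_r : 0 < t -> t ^+ 2 <= 128 * q -> q <= 6 * r.
Proof.
move=> tp H; apply: cube_le; first by rewrite mulr_ge0.
rewrite -(ler_pM2r q_gt0).
have -> : q ^+ 3 * q = q ^+ 4 by ring.
rewrite -rq4//.
have h : r ^+ 3 * t ^+ 2 <= r ^+ 3 * (128 * q) by rewrite ler_wpM2l ?exprn_ge0.
have : 0 <= r ^+ 3 * q by rewrite mulr_ge0 ?exprn_ge0.
lra.
Qed.

Let Kle (K' x y c : R) : 0 <= K' -> K' <= K1 + K2 -> 0 <= y -> x <= c * y -> c <= 200 ->
  Q <= K' * x -> Q <= K * y.
Proof.
move=> K0 KK y0 xy c2 H; apply: (le_trans H).
apply: (@le_trans _ _ (K' * (200 * y))).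
  by apply: ler_wpM2l => //; apply: (le_trans xy); rewrite ler_wpM2r.
rewrite mulrCA mulrA /K; have : K' * y <= (K1 + K2) * y by rewrite ler_wpM2r.
lra.
Qed.

Let K1l : K1 <= K1 + K2. Proof. by rewrite lerDl. Qed.
Let K2l : K2 <= K1 + K2. Proof. by rewrite lerDr. Qed.

(** For a strong signal, [t^2 >= q] gives [r <= q]. *)
Lemma risk_uniform_rate : Q <= K * (q + p).
Proof.
have m0 : 0 <= q + p by rewrite addr_ge0// ltW.
have [/weak|s] := leP (t ^+ 2) (64 * (q + p)).
  by apply: (Kle (c := 1)) => //; rewrite ?mul1r//; lra.
have tp : 0 < t by apply: (t_gt0 _ s); rewrite mulr_ge0.
have rq : r <= q.
  apply: cube_le => //; rewrite -(ler_pM2r q_gt0).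
  have -> : q ^+ 3 * q = q ^+ 4 by ring.
  rewrite -rq4// ler_wpM2l ?exprn_ge0//; have := p0; have := q0; lra.
apply: (Kle (c := 1) K20 K2l m0 _ _ (strong (ltW s))); lra.
Qed.

(** [r] and [p] cross at [t^2 = delta^2 / p], so [p + r] is of the claimed order on
    each side.  Where the weak-signal bound [q + p] applies above the first
    threshold, [t^2] is within a constant factor of [q + p], which keeps [q] below a
    multiple of the claimed rate. *)
Lemma risk_rate_small_delta : delta <= w -> Q <= K *
  (if t ^+ 2 <= Num.max q p then q + p
   else if t ^+ 2 <= Num.max (delta ^+ 2 / p) p then r else p).
Proof.
move=> dw; case: ifP => [_|/negbT]; first exact: risk_uniform_rate.
rewrite -ltNge gt_max => /andP[qt pt].
have tp : 0 < t by apply: t_gt0 qt.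
have pp := ltW p0; have tt : 0 < t ^+ 2 by rewrite exprn_gt0.
rewrite le_max; case: ifP => [/orP[td|]|/negbT]; last 2 first.
- by rewrite leNgt pt.
- rewrite negb_or -!ltNge => /andP[dt _]; rewrite ltr_pdivrMr// in dt.
  have [/[dup] tm /weak|s] := leP (t ^+ 2) (64 * (q + p)).
    have q6 : q <= 6 * p.
      have [qp|pq] := leP q p; first lra.
      apply: cube_le; first by rewrite mulr_ge0.
      rewrite -(ler_pM2r q_gt0).
      have -> : q ^+ 3 * q = q ^+ 4 by ring.
      rewrite pow4 qE.
      have h : delta ^+ 2 <= 128 * q * p.
        apply: (le_trans (ltW dt)); rewrite ler_wpM2r//; lra.
      have : delta ^+ 2 * p ^+ 2 <= 128 * q * p * p ^+ 2 by rewrite ler_wpM2r ?sqr_ge0.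
      have : 0 <= q * p ^+ 3 by rewrite mulr_ge0 ?exprn_ge0.
      lra.
    by apply: (Kle (c := 7)) => //; lra.
  have rp : r <= p.
    apply: cube_le => //; rewrite -(ler_pM2r tt) rE//.
    have -> : p ^+ 3 * t ^+ 2 = (t ^+ 2 * p) * p ^+ 2 by ring.
    by rewrite ler_wpM2r ?sqr_ge0// ltW.
  by apply: (Kle (c := 2) K20 K2l pp _ _ (strong (ltW s))); lra.
rewrite ler_pdivlMr// in td.
have pr : p <= r by apply: p_le_r => //; rewrite mulrC.
have [/[dup] tm /weak|s] := leP (t ^+ 2) (64 * (q + p)).
  have pq : p <= q.
    have pd : p <= delta.
      rewrite -(@ler_pXn2r _ 2) ?nnegrE ?(ltW d0)//.
      by apply: le_trans td; rewrite expr2 ler_pM2r// ltW.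
    by apply: sq_le => //; rewrite qE expr2 ler_pM2r.
  have q6 : q <= 6 * r by apply: q_le_r => //; lra.
  by apply: (Kle (c := 12)) => //; lra.
by apply: (Kle (c := 2) K20 K2l r0 _ _ (strong (ltW s))); lra.
Qed.

(** Here [p <= q], and beyond [t^2 = w / delta] one has [a >= 1], so the blocks have
    length one. *)
Lemma risk_rate_large_delta : w <= delta -> Q <= K *
  (if t ^+ 2 <= q then q + p
   else if t ^+ 2 <= w / delta then r else p + p / t ^+ 2).
Proof.
move=> wd; case: ifP => [_|/negbT]; first exact: risk_uniform_rate.
rewrite -ltNge => qt.
have tp : 0 < t by apply: t_gt0 qt.
have pp := ltW p0; have tt : 0 < t ^+ 2 by rewrite exprn_gt0.
have w1 : w <= 1.
  by rewrite -(@ler_pXn2r _ 2) ?nnegrE// wE expr1n.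
have pw : p <= w by rewrite -wE expr2 ler_piMl.
have pq : p <= q.
  by apply: sq_le => //; rewrite qE expr2 ler_pM2r// (le_trans pw).
case: ifP => [td|/negbT].
  rewrite ler_pdivlMr// in td.
  have pr : p <= r.
    apply: p_le_r => //.
    rewrite -(ler_pM2r d0) -mulrA -wE.
    have : w ^+ 2 * (t ^+ 2 * delta) <= w ^+ 2 * w by rewrite ler_wpM2l ?sqr_ge0.
    move=> h; apply: (le_trans h).
    by rewrite -!exprSr lerXn2r// nnegrE ltW.
  have [/[dup] tm /weak|s] := leP (t ^+ 2) (64 * (q + p)).
    have q6 : q <= 6 * r by apply: q_le_r => //; lra.
    by apply: (Kle (c := 12)) => //; lra.
  by apply: (Kle (c := 2) K20 K2l r0 _ _ (strong (ltW s))); lra.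
rewrite -ltNge ltr_pdivrMr// => td.
have pt0 : 0 <= p / t ^+ 2 by rewrite divr_ge0// ltW.
have [/[dup] tm /weak|s] := leP (t ^+ 2) (64 * (q + p)).
  have qpt : q <= 64 * (p / t ^+ 2).
    rewrite mulrA ler_pdivlMr//.
    have : q * t ^+ 2 <= q * (128 * q) by rewrite ler_wpM2l//; lra.
    have : delta * p <= 1 / 2 * p by rewrite ler_pM2r// ltW.
    by rewrite -qE; lra.
  by apply: (Kle (c := 64)) => //; [rewrite addr_ge0|lra|lra].
have a1 : 1 <= a.
  apply: cube_le => //; rewrite expr1n -(ler_pM2r p0) mul1r aE pow4.
  have -> : delta ^+ 2 * (t ^+ 2) ^+ 2 = (t ^+ 2 * delta) ^+ 2 by ring.
  rewrite -wE; apply: lerXn2r; rewrite ?nnegrE ?(ltW td)//.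
  by rewrite mulr_ge0 ?(ltW tt) ?(ltW d0).
apply: (Kle (c := 1) K20 K2l _ _ _ (fine_blocks (ltW s) a1)); last 1 first.
- by lra.
- by rewrite addr_ge0.
- by rewrite mul1r.
Qed.

End RateCases.

(** * The number of buckets *)

Section EllStar.
Context (R : realType).

Lemma powR_third (x : R) (m : nat) : 0 <= x -> (x `^ (m%:R / 3)) ^+ 3 = x ^+ m.
Proof.
move=> x0; rewrite -[LHS]powR_mulrn ?powR_ge0// -powRrM divfK//.
by rewrite powR_mulrn.
Qed.

Variables (n d : nat) (delta : R) (theta : 'cV[R]_d).
Hypotheses (d1 : (1 <= d)%N) (dn : (d <= n)%N) (delta0 : 0 < delta).
Let N : R := n%:R.
Let D : R := d%:R.
Let t := enorm theta.
Let ell := ell_star n delta theta.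

(** The balancing term [a] of the number of buckets, as a fraction of [n]. *)
Definition ell_frac : R :=
  delta `^ (2 / 3) * N `^ (4 / 3) * t `^ (4 / 3) / D `^ (1 / 3) / N.

Let D0 : 0 < D. Proof. by rewrite ltr0n. Qed.
Let N0 : 0 < N. Proof. by rewrite ltr0n (leq_trans d1). Qed.
Let t0 : 0 <= t. Proof. exact: enorm_ge0. Qed.

Lemma ell_frac_ge0 : 0 <= ell_frac.
Proof. by rewrite /ell_frac !mulr_ge0 ?invr_ge0 ?powR_ge0// ltW. Qed.

Lemma ell_frac_cube : ell_frac ^+ 3 * (D / N) = delta ^+ 2 * t ^+ 4.
Proof.
rewrite /ell_frac !exprMn !exprVn.
rewrite (powR_third 2 (ltW delta0)) (powR_third 4 (ltW N0)) (powR_third 4 t0).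
rewrite (powR_third 1 (ltW D0)) expr1.
by field; rewrite !gt_eqF.
Qed.

Lemma ell_star_gt0 : (0 < ell)%N.
Proof. by rewrite /ell /ell_star leq_min (leq_trans d1 dn) leq_max d1. Qed.

Lemma ell_star_le : (ell <= n)%N.
Proof. by rewrite /ell /ell_star geq_min leqnn orbT. Qed.

Let x : R := Num.max (N * delta) (Num.max (ell_frac * N) (N * t ^+ 2)).

Let ellE : ell = minn (maxn d (absz (Num.ceil x))) n.
Proof.
rewrite /ell /ell_star /x /ell_frac divfK ?gt_eqF//.
Qed.

Let x0 : 0 <= x.
Proof. by rewrite /x le_max; apply/orP; left; apply: mulr_ge0; exact: ltW. Qed.

Let xceil : ((absz (Num.ceil x))%:R : R) = (Num.ceil x)%:~R.
Proof.
have : (0 <= Num.ceil x)%R by rewrite ceil_ge0; apply: lt_le_trans x0; lra.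
by case: (Num.ceil x).
Qed.

(** One copy of [D / N] pays for the rounding up, as [1 <= D]. *)
Lemma ell_star_upper :
  ell%:R / N <= 2 * (D / N) + delta + ell_frac + t ^+ 2.
Proof.
rewrite ler_pdivrMr//.
have -> : (2 * (D / N) + delta + ell_frac + t ^+ 2) * N =
    2 * D + N * delta + ell_frac * N + N * t ^+ 2 by field; rewrite gt_eqF.
have xle : x <= N * delta + ell_frac * N + N * t ^+ 2.
  have h1 : 0 <= N * delta by rewrite mulr_ge0 ?ltW.
  have h2 : 0 <= ell_frac * N by rewrite mulr_ge0 ?ell_frac_ge0 ?ltW.
  have h3 : 0 <= N * t ^+ 2 by rewrite mulr_ge0 ?sqr_ge0 ?ltW.
  rewrite /x !ge_max; apply/and3P; split; lra.
have D1 : 1 <= D by rewrite ler1n.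
have c1 : ((absz (Num.ceil x))%:R : R) <= x + 1.
  by rewrite xceil; have := ceilB1_lt x; rewrite intrB; lra.
have : ell%:R <= D + (absz (Num.ceil x))%:R.
  rewrite -natrD ler_nat ellE; apply: (leq_trans (geq_minl _ _)).
  by rewrite geq_max leq_addr leq_addl.
lra.
Qed.

Lemma ell_star_lower : ell%:R / N = 1 \/
  [/\ D / N <= ell%:R / N, delta <= ell%:R / N, ell_frac <= ell%:R / N &
      t ^+ 2 <= ell%:R / N].
Proof.
have [en|en] := eqVneq ell n; first by left; rewrite en divff// gt_eqF.
right.
have eE : ell = maxn d (absz (Num.ceil x)).
  by have := ellE; rewrite /minn; case: ifP => // _ E; rewrite E eqxx in en.
have xe : x <= ell%:R.
  apply: (le_trans (ceil_ge x)); rewrite -xceil ler_nat eE leq_maxr//.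
move: xe; rewrite /x !ge_max => /and3P[h1 h2 h3].
split; rewrite ler_pdivlMr// ?[delta * _]mulrC ?[t ^+ 2 * _]mulrC//.
by rewrite divfK ?gt_eqF// ler_nat eE leq_maxl.
Qed.

End EllStar.

(** * Sign changes of the Markov chain *)

Section Flips.
Context (R : realType) (disp : measure_display) (T : measurableType disp).
Variable P : probability T R.
Local Notation Ex f := (expect P f%R).

Lemma Ex_simple (I : finType) (A : I -> set T) (phi : I -> R) :
  (forall s, measurable (A s)) -> (forall s, 0 <= phi s) ->
  Ex (fun w => \sum_s phi s * \1_(A s) w) = (\sum_s phi s * fine (P (A s)))%:E.
Proof.
move=> mA phi0.
rewrite /expect; under eq_integral do rewrite -sumEFin.
rewrite ge0_integral_sum//=; last 2 first.
- move=> s; apply/measurable_EFinP; apply: measurable_funM => //.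
- by move=> s w _; rewrite lee_fin mulr_ge0.
rewrite -sumEFin; apply: eq_bigr => s _.
rewrite -/(expect P (fun w => phi s * \1_(A s) w)%R) ExZ//.
by rewrite /expect integral_indic// setIT EFinM fineK ?fin_num_measure.
Qed.

Variables (delta : R) (n0 : nat) (eta : 'I_n0.+1 -> {RV P >-> R}).
Hypotheses (d0 : 0 <= delta) (chain : sign_markov_chain delta eta).

Let sgn (b : bool) : R := if b then 1 else - 1.

Let eta_pm i w : eta i w = 1 \/ eta i w = - 1.
Proof. by case: chain => H _ _; exact: H. Qed.

(** The past of the chain takes finitely many values, so conditional expectations
    are finite sums over patterns. *)
Definition pattern i w : {ffun 'I_i.+1 -> bool} :=
  [ffun m : 'I_i.+1 => eta (inord m) w == 1].

Let past i (s : {ffun 'I_i.+1 -> bool}) : set T :=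
  [set w | forall m : 'I_n0.+1, (m <= i)%N -> eta m w = sgn (s (inord m))].

Let one_neq_N1 : (1 : R) == - 1 = false.
Proof. by apply/negbTE; rewrite -subr_eq0 opprK; apply/eqP; lra. Qed.

Let pastE i s : (i <= n0)%N -> past s = [set w | pattern i w = s].
Proof.
move=> i_n; apply/seteqP; split => w /= H.
  apply/ffunP => m; rewrite ffunE H; last first.
    by rewrite inordK; [rewrite -ltnS|apply: leq_trans (ltn_ord m) _].
  rewrite inordK; last by apply: leq_trans (ltn_ord m) _.
  by rewrite inord_val /sgn; case: (s m); rewrite ?eqxx// eq_sym one_neq_N1.
move=> m mi; rewrite -H ffunE inordK ?ltnS// inord_val /sgn.
by have [->|->] := eta_pm m w; rewrite ?eqxx// eq_sym one_neq_N1.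
Qed.

Let meas_eta_eq i (r : R) : measurable (eta i @^-1` [set r]).
Proof. by rewrite -[_ @^-1` _]setTI; exact: measurable_funP. Qed.

Let meas_past i (s : {ffun 'I_i.+1 -> bool}) : measurable (past s).
Proof.
rewrite (_ : past s = \bigcap_(m in [set m : 'I_n0.+1 | (m <= i)%N])
    (eta m @^-1` [set sgn (s (inord m))])).
  by apply: fin_bigcap_measurable; [exact: finite_finset|move=> m _].
by apply/seteqP; split.
Qed.

Definition flip m w : bool := eta (inord m.+1) w != eta (inord m) w.

Let meas_flip m : measurable [set w | flip m w].
Proof.
rewrite (_ : [set w | _] = ~` ((eta (inord m.+1) @^-1` [set 1] `&` eta (inord m) @^-1` [set 1])
   `|` (eta (inord m.+1) @^-1` [set -1] `&` eta (inord m) @^-1` [set -1]))).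
  by apply: measurableC; apply: measurableU; apply: measurableI.
apply/seteqP; split => w /=; rewrite /flip.
  by move=> /eqP ne [[a b]|[a b]]; apply: ne; rewrite a b.
move=> H; apply/eqP => E; apply: H.
by have [e1|e1] := eta_pm (inord m) w; [left|right]; rewrite E e1.
Qed.

(* the Markov property, multiplied out so that null patterns cause no trouble *)
Let flip_past i (s : {ffun 'I_i.+1 -> bool}) : (i < n0)%N ->
  fine (P (past s `&` [set w | flip i w])) = delta * fine (P (past s)).
Proof.
move=> i_n; have mp := meas_past s; have mf := meas_flip i.
have [P0|Pn0] := eqVneq (P (past s)) 0%E.
  rewrite P0 /= mulr0; have : (P (past s `&` [set w | flip i w]) <= P (past s))%E.
    by apply: le_measure; rewrite ?inE//; exact: measurableI.
  by rewrite P0 => H; rewrite (_ : P _ = 0%E)//; apply/eqP; rewrite eq_le H measure_ge0.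
case: chain => _ _ /(_ (inord i) (inord i.+1)).
have iE : (inord i : 'I_n0.+1) = i :> nat by rewrite inordK// ltnS ltnW.
have i1E : (inord i.+1 : 'I_n0.+1) = i.+1 :> nat by rewrite inordK// ltnS.
rewrite iE i1E => /(_ erefl (fun m => sgn (s (inord m)))).
have Spm m : sgn (s (inord m)) = 1 \/ sgn (s (inord m)) = - 1.
  by rewrite /sgn; case: (s _); [left|right].
move=> /(_ (fun m => Spm m)) /(_ Pn0)[_].
rewrite /cprob -/(past s).
have -> : eta (inord i.+1) @^-1` [set - sgn (s (inord (inord i : 'I_n0.+1)))] `&` past s =
    past s `&` [set w | flip i w].
  rewrite setIC; apply/seteqP; split => w /= [wp wf]; split => //.
    rewrite /flip wf (wp (inord i)) ?iE//.
    by rewrite eq_sym -subr_eq0 opprK /sgn; case: ifP => _; apply/eqP; lra.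
  move: wf; rewrite /flip (wp (inord i)) ?iE//.
  have [->|->] := eta_pm (inord i.+1) w; rewrite /sgn; case: (s _) => //;
    by rewrite ?eqxx ?opprK.
move=> H; rewrite -H divfK//.
by rewrite fine_eq0// fin_num_measure.
Qed.

(* exp(flips/2), stopped at time i *)
Let growth i w : R := \prod_(m < i) (if flip m w then expR (1 / 2) else 1).

Let phi i (s : {ffun 'I_i.+1 -> bool}) : R :=
  \prod_(m < i) (if s (inord m.+1) != s (inord m) then expR (1 / 2) else 1).

Let growthE i w : (i <= n0)%N -> growth i w = phi (pattern i w).
Proof.
move=> i_n; apply: eq_bigr => m _; rewrite !ffunE /flip.
have mi := ltn_ord m.
rewrite !inordK ?ltnS// ?(ltnW mi)//.
have [->|->] := eta_pm (inord m.+1) w; have [->|->] := eta_pm (inord m) w;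
  by rewrite ?eqxx ?[-1 == _]eq_sym ?one_neq_N1.
Qed.

Let decomp i (f : {ffun 'I_i.+1 -> bool} -> R) w : (i <= n0)%N ->
  f (pattern i w) = \sum_s f s * \1_(past s) w.
Proof.
move=> i_n; rewrite (bigD1 (pattern i w))//= big1 ?addr0.
  by rewrite indicE mem_set ?mulr1// pastE.
move=> s ne; rewrite indicE memNset ?mulr0// pastE//= => E.
by rewrite E eqxx in ne.
Qed.

(* On each pattern the conditional factor is 1 + (exp(1/2) - 1) delta, and
   exp(1/2) <= 2. *)
Let growth_step i : (i < n0)%N ->
  (Ex (growth i.+1) <= (1 + delta)%:E * Ex (growth i))%E.
Proof.
move=> i_n; have i_n' := ltnW i_n.
have phi0 (s : {ffun 'I_i.+1 -> bool}) : 0 <= phi s.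
  by apply: prodr_ge0 => m _; case: ifP => _; rewrite ?expR_ge0.
have -> : Ex (growth i) = (\sum_s phi s * fine (P (past (s : {ffun 'I_i.+1 -> bool}))))%:E.
  rewrite -Ex_simple//; apply: eq_Ex => w.
  by rewrite growthE// (decomp (@phi i)).
(* growth i.+1 as a simple function: the value at time i, plus the increment on
   the patterns followed by a flip (first component true) *)
pose A (p : bool * {ffun 'I_i.+1 -> bool}) :=
  if p.1 then past p.2 `&` [set w | flip i w] else past p.2.
pose c := expR (1 / 2) - 1 : R.
have c0 : 0 <= c by have := expR_ge1Dx (1 / 2 : R); rewrite /c; lra.
have c1 : c <= 1.
  have h := expR_ge1Dx (- (1 / 2) : R).
  have E : expR (1 / 2) * expR (- (1 / 2)) = 1 :> R by exact: expRxMexpNx_1.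
  have e0 := expR_gt0 (1 / 2 : R); rewrite /c.
  have : expR (1 / 2) * (1 / 2) <= expR (1 / 2) * expR (- (1 / 2)) :> R.
    by rewrite ler_pM2l//; lra.
  rewrite E; lra.
pose psi (p : bool * {ffun 'I_i.+1 -> bool}) := if p.1 then c * phi p.2 else phi p.2.
have -> : Ex (growth i.+1) = (\sum_p psi p * fine (P (A p)))%:E.
  rewrite -Ex_simple; last 2 first.
  - by move=> [[] s]; rewrite /A /=; [apply: measurableI|].
  - by move=> [[] s]; rewrite /psi /= ?mulr_ge0.
  apply: eq_Ex => w.
  rewrite /growth big_ord_recr /= -/(growth i w) growthE//.
  have -> : \sum_p psi p * \1_(A p) w =
      \sum_(s : {ffun 'I_i.+1 -> bool}) (c * phi s * \1_(past s `&` [set w | flip i w]) w) +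
      \sum_(s : {ffun 'I_i.+1 -> bool}) (phi s * \1_(past s) w).
    rewrite -(pair_bigA _ (fun b s => psi (b, s) * \1_(A (b, s)) w)) /= big_bool.
    by [].
  have -> : \sum_(s : {ffun 'I_i.+1 -> bool})
      (c * phi s * \1_(past s `&` [set w | flip i w]) w) =
      c * \1_[set w | flip i w] w * \sum_(s : {ffun 'I_i.+1 -> bool}) (phi s * \1_(past s) w).
    by rewrite mulr_sumr; apply: eq_bigr => s _; rewrite indicI /=; ring.
  rewrite -(decomp (@phi i))// indicE.
  case: (boolP (flip i w)) => f.
    by rewrite mem_set//= mulr1n /c mulr1; set u := expR _; ring.
  by rewrite memNset /=; [rewrite mulr0n mulr0 mul0r mulr1 add0r|apply/negP].
rewrite -EFinM lee_fin.
rewrite -(pair_bigA _ (fun b s => psi (b, s) * fine (P (A (b, s))))) /= big_bool /=.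
rewrite /psi /A /= mulrDl mul1r [leRHS]addrC lerD2r mulr_sumr.
apply: ler_sum => s _; rewrite flip_past//.
have f0 : 0 <= fine (P (past s)) by rewrite fine_ge0// measure_ge0.
have : 0 <= delta * (phi s * fine (P (past s))) by rewrite !mulr_ge0.
set z := delta * _ => z0.
have -> : c * phi s * (delta * fine (P (past s))) = c * z by rewrite /z; ring.
by rewrite ler_piMl.
Qed.

Definition flips w : R := \sum_(m < n0) (flip m w)%:R.

Lemma measurable_flips : measurable_fun setT flips.
Proof.
apply: measurable_sum => m.
rewrite (_ : (fun w => _) = \1_[set w | flip m w]); first exact: measurable_indic.
apply/funext => w; rewrite indicE; case: (boolP (flip m w)) => f; first by rewrite mem_set.
by rewrite memNset//; apply/negP.
Qed.

(** By induction [E exp(flips/2) <= (1 + delta)^n0 <= exp(n0 delta)]. *)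
Lemma flips_tail (b : R) :
  (P [set w | (n0%:R * delta + b <= flips w / 2)%R] <= (expR (- b))%:E)%E.
Proof.
have mfl := measurable_flips.
have E i : (i <= n0)%N -> (Ex (growth i) <= ((1 + delta) ^+ i)%:E)%E.
  elim: i => [_|i IH i_n].
    by rewrite (_ : growth 0 = fun=> 1) ?Ex_cst//; apply/funext => w; rewrite /growth big_ord0.
  apply: (le_trans (growth_step i_n)); rewrite exprS EFinM.
  by apply: lee_wpmul2l; [rewrite lee_fin addr_ge0|apply: IH; exact: ltnW].
have -> : expR (- b) = expR (n0%:R * delta) * expR (- (n0%:R * delta + b)).
  by rewrite -expRD; congr expR; ring.
apply: markov_exp; first by mfun.
apply: (@le_trans _ _ (Ex (growth n0))).
  rewrite le_eqVlt; apply/orP; left; apply/eqP; apply: eq_Ex => w.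
  rewrite /flips mulr_suml expR_sum; apply: eq_bigr => m _.
  by case: ifP => _; rewrite ?mul0r ?expR0.
apply: (le_trans (E n0 (leqnn _))); rewrite lee_fin expRM_natl.
by rewrite lerXn2r ?nnegrE ?addr_ge0 ?expR_ge0// expR_ge1Dx.
Qed.

End Flips.

(** * The noise vectors *)

Lemma measurable_sum_cond (R : realType) (d0 : measure_display) (T0 : measurableType d0)
    (I : finType) (p : pred I) (h : I -> T0 -> R) :
  (forall i, p i -> measurable_fun setT (h i)) ->
  measurable_fun setT (fun x => \sum_(i | p i) h i x).
Proof.
move=> mh.
rewrite (_ : (fun x => _) = fun x => \sum_i (if p i then h i else cst 0) x); last first.
  by apply/funext => x; rewrite big_mkcond; apply: eq_bigr => i _; case: ifP.
by apply: measurable_sum => i; case: ifPn => // /mh.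
Qed.

Section VectorNoise.
Context (R : realType) (disp : measure_display) (T : measurableType disp).
Variable P : probability T R.
Local Notation Ex f := (expect P f%R).

Lemma measurable_coord (d : nat) (a : 'I_d) :
  measurable_fun setT (fun x : borel_cV R d => (x : 'cV[R]_d) a 0).
Proof.
apply: (measurability _ (RGenOpens.measurableE R)) => _ [_ [b [c ->] <-]].
rewrite setTI; apply: sub_sigma_algebra.
apply: open_comp; last exact: interval_open.
by move=> x _; exact: coord_continuous.
Qed.

Lemma measurable_edot (d : nat) (v : 'cV[R]_d) :
  measurable_fun setT (fun x : borel_cV R d => edot v (x : 'cV[R]_d)).
Proof.
by apply: measurable_sum => a; apply: measurable_funM => //; exact: measurable_coord.
Qed.

Lemma lee_prod_nneg (I : finType) (f g : I -> \bar R) :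
  (forall i, (0 <= f i)%E) -> (forall i, (f i <= g i)%E) ->
  (\prod_i f i <= \prod_i g i)%E.
Proof.
move=> f0 fg; suff : (0 <= \prod_i f i)%E /\ (\prod_i f i <= \prod_i g i)%E by case.
apply: (big_ind2 (fun x y : \bar R => (0 <= x)%E /\ (x <= y)%E)) => //.
move=> x1 x2 y1 y2 [x0 x12] [y0 y12]; split; first exact: mule_ge0.
exact: lee_pmul.
Qed.

Variables (n d : nat) (xi : 'I_n -> {RV P >-> borel_cV R d}).
Hypotheses (ind_xi : mutually_independent xi).
Hypotheses (iso_xi : forall i, isotropic P (xi i)) (sub_xi : forall i, sub_gaussian P (xi i)).

Let sg J := g_sigma_algebraType (cylinder xi J).

Lemma meas_xi i v : measurable_fun setT (fun w => edot v (xi i w : 'cV[R]_d)).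
Proof. by apply: (measurableT_comp (measurable_edot v)). Qed.

Lemma meas_xi_cyl (J : {set 'I_n}) i v : i \in J ->
  measurable_fun (setT : set (sg J)) (fun w => edot v (xi i w : 'cV[R]_d)).
Proof.
by move=> iJ; apply: (measurableT_comp (measurable_edot v)); exact: measurable_fun_coord.
Qed.

Lemma subgP i v : (Ex (fun w => expR (edot v (xi i w))) <= (expR (enorm v ^+ 2 / 2))%:E)%E.
Proof. by have := sub_xi i v; rewrite unlock. Qed.

(** The Laplace transforms of independent vectors multiply: the concatenated
    noise vector is again 1-sub-Gaussian. *)
Lemma joint_subg (c : 'I_n -> 'cV[R]_d) :
  (Ex (fun w => expR (\sum_j edot (c j) (xi j w)))
    <= (expR (\sum_j enorm (c j) ^+ 2 / 2))%:E)%E.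
Proof.
rewrite (@eq_Ex _ _ _ _ _ (fun w => \prod_j expR (edot (c j) (xi j w)))%R); last first.
  by move=> w; rewrite expR_sum.
rewrite /expect.
rewrite (cylinder_integral_prod ind_xi (J := fun j => [set j]%SET)
  (f := fun j w => expR (edot (c j) (xi j w)))); last 3 first.
- by move=> a b ab; rewrite disjoints1 inE.
- move=> a; apply: (measurableT_comp (@measurable_expR R)).
  by apply: meas_xi_cyl; rewrite inE.
- by move=> a w; exact: expR_ge0.
rewrite expR_sum -prodEFin.
apply: lee_prod_nneg => j; last exact: subgP.
by apply: Ex_ge0 => w; exact: expR_ge0.
Qed.

Lemma isotropic_coord i a : Ex (fun w => (xi i w : 'cV[R]_d) a 0 ^+ 2) = 1%:E.
Proof.
have := iso_xi i a a; rewrite unlock !mxE eqxx => <-.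
by apply: eq_Ex => w; rewrite mxE big_ord1 mxE.
Qed.

Let coord (q : 'I_n * 'I_d) w : R := (xi q.1 w : 'cV[R]_d) q.2 0.

Let coordE (c : 'I_n -> 'cV[R]_d) w :
  \sum_j edot (c j) (xi j w) = \sum_q c q.1 q.2 0 * coord q w.
Proof. by rewrite pair_bigA. Qed.

Let coord_sq (c : 'I_n -> 'cV[R]_d) :
  \sum_j enorm (c j) ^+ 2 = \sum_q c q.1 q.2 0 ^+ 2.
Proof.
rewrite -(pair_bigA _ (fun i j => c i j 0 ^+ 2)); apply: eq_bigr => j _.
by rewrite enorm_sq; apply: eq_bigr => a _; rewrite expr2.
Qed.

(** The concatenated vector has unit coordinate variances and is sub-Gaussian,
    which by [second_moment_sum] makes it isotropic. *)
Lemma joint_second_moment (c : 'I_n -> 'cV[R]_d) :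
  Ex (fun w => (\sum_j edot (c j) (xi j w)) ^+ 2) = (\sum_j enorm (c j) ^+ 2)%:E.
Proof.
rewrite coord_sq.
rewrite (@eq_Ex _ _ _ _ _ (fun w => (\sum_q c q.1 q.2 0 * coord q w) ^+ 2)%R); last first.
  by move=> w; rewrite coordE.
apply: (second_moment_sum (X := coord) _ _ _ (fun q => c q.1 q.2 0)).
- by move=> q; apply: (measurableT_comp (measurable_coord q.2)).
- move=> c' v.
  pose cc j : 'cV[R]_d := \col_a (v * c' (j, a)).
  have := joint_subg cc.
  rewrite (@eq_Ex _ _ _ _ _ (fun w => expR (v * \sum_i c' i * coord i w))%R); last first.
    move=> w; rewrite coordE mulr_sumr; congr expR; apply: eq_bigr => -[j a] _.
    by rewrite mxE mulrA.
  rewrite -mulr_suml coord_sq.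
  have -> // : \sum_q cc q.1 q.2 0 ^+ 2 = v ^+ 2 * \sum_i c' i ^+ 2.
  by rewrite mulr_sumr; apply: eq_bigr => -[j a] _; rewrite mxE exprMn.
- by move=> q; exact: isotropic_coord.
Qed.

(** The Laplace transform for frozen sign averages [c]. *)
Lemma linear_tail (c : 'I_n -> R) (z : 'cV[R]_d) (l : R) :
  (forall j, c j ^+ 2 <= 1) -> enorm z <= 2 ->
  (Ex (fun w => expR (l * \sum_j c j * edot z (xi j w))) <= (expR (2 * l ^+ 2 * n%:R))%:E)%E.
Proof.
move=> c1 z2.
have := joint_subg (fun j => (l * c j) *: z).
rewrite (@eq_Ex _ _ _ _ _ (fun w => expR (l * \sum_j c j * edot z (xi j w)))%R); last first.
  by move=> w; congr expR; rewrite mulr_sumr; apply: eq_bigr => j _; rewrite edotZl mulrA.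
move=> /le_trans; apply; rewrite lee_fin ler_expR.
apply: (@le_trans _ _ (\sum_(j < n) (2 * l ^+ 2))); last first.
  by rewrite sumr_const card_ord -[leLHS]mulr_natr.
apply: ler_sum => j _; rewrite enormZ exprMn real_normK ?num_real// exprMn.
have z4 : enorm z ^+ 2 <= 4.
  have -> : 4 = 2 ^+ 2 :> R by rewrite expr2; lra.
  by rewrite lerXn2r ?nnegrE ?enorm_ge0.
have h : c j ^+ 2 * enorm z ^+ 2 <= 1 * 4 by apply: ler_pM => //; exact: sqr_ge0.
have := ler_wpM2l (sqr_ge0 l) h; lra.
Qed.

Section Blocks.
Variables (k ell : nat).
Hypotheses (k0 : (0 < k)%N) (nkl : n = (k * ell)%N).

Lemma block_count (i : 'I_ell) : \sum_(j < n | (j %/ k == i)%N) (1 : R) = k%:R.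
Proof.
have lt m : (m < k)%N -> (i * k + m < n)%N.
  move=> mk; rewrite nkl; have := ltn_ord i => il.
  apply: (@leq_trans (i.+1 * k)); first by rewrite mulSn addnC ltn_add2r.
  by rewrite mulnC leq_mul2l il orbT.
pose h (m : 'I_k) : 'I_n := Ordinal (lt m (ltn_ord m)).
pose h' (j : 'I_n) : 'I_k := Ordinal (ltn_pmod j k0).
rewrite (reindex_onto h h') /=; last first.
  by move=> j /eqP ji; apply/val_inj; rewrite /= -ji -divn_eq.
rewrite (eq_bigl xpredT); first by rewrite sumr_const card_ord.
move=> m; rewrite divnMDl// divn_small// addn0 eqxx /=.
by apply/eqP/val_inj; rewrite /= modnMDl modn_small.
Qed.

Variable z : 'cV[R]_d.
Hypothesis z2 : enorm z <= 2.

Let z4 : enorm z ^+ 2 <= 4.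
Proof.
have -> : 4 = 2 ^+ 2 :> R by rewrite expr2; lra.
by rewrite lerXn2r ?nnegrE ?enorm_ge0.
Qed.

Let K : R := k%:R.
Let K_gt0 : 0 < K. Proof. by rewrite ltr0n. Qed.
Let q : R := (2 * Num.sqrt K)^-1.
Let qq : q ^+ 2 * K = 1 / 4.
Proof.
rewrite /q exprVn exprMn sqr_sqrtr ?ltW//.
by field; rewrite gt_eqF.
Qed.

(** The factor [1/(2 sqrt k)] gives the block sum the variance proxy [|z|^2/4],
    which is at most 1 for a point of the net. *)
Definition block_dot (i : 'I_ell) w : R :=
  q * \sum_(j < n | (j %/ k == i)%N) edot z (xi j w).

Let bc (i : 'I_ell) (v : R) (j : 'I_n) : 'cV[R]_d :=
  (if (j %/ k == i)%N then v * q else 0) *: z.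

Let bcE i v w : \sum_j edot (bc i v j) (xi j w) = v * block_dot i w.
Proof.
rewrite /block_dot mulrA mulr_sumr [RHS]big_mkcond; apply: eq_bigr => j _.
by rewrite /bc edotZl; case: ifP => _; rewrite ?mul0r.
Qed.

Let bc_sq i v : \sum_j enorm (bc i v j) ^+ 2 = v ^+ 2 * (enorm z ^+ 2 / 4).
Proof.
rewrite (eq_bigr (fun j : 'I_n => (if (j %/ k == i)%N then 1 else 0) *
   (v ^+ 2 * q ^+ 2 * enorm z ^+ 2))); last first.
  move=> j _; rewrite /bc enormZ exprMn real_normK ?num_real//.
  by case: ifP => _; rewrite ?mul1r ?exprMn// expr0n /= !mul0r.
rewrite -mulr_suml -big_mkcond /= block_count.
have -> : k%:R * (v ^+ 2 * q ^+ 2 * enorm z ^+ 2) =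
  v ^+ 2 * enorm z ^+ 2 * (q ^+ 2 * K) by rewrite /K; ring.
by rewrite qq; field.
Qed.

Lemma meas_block_dot i : measurable_fun setT (block_dot i).
Proof.
rewrite /block_dot; apply: measurable_funM => //.
by apply: measurable_sum_cond => j _; exact: meas_xi.
Qed.

Lemma block_dot_subg i : subg P (block_dot i) 1.
Proof.
move=> v; have := joint_subg (bc i v).
rewrite (@eq_Ex _ _ _ _ _ (fun w => expR (v * block_dot i w))%R); last by move=> w; rewrite bcE.
move=> /le_trans; apply; rewrite lee_fin ler_expR -mulr_suml bc_sq.
have := ler_wpM2l (sqr_ge0 v) z4; lra.
Qed.

Lemma block_dot_moment i : Ex (fun w => block_dot i w ^+ 2) = (enorm z ^+ 2 / 4)%:E.
Proof.
have := joint_second_moment (bc i 1); rewrite bc_sq expr1n mul1r => <-.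
by apply: eq_Ex => w; rewrite bcE mul1r.
Qed.

(** The blocks are disjoint, so the Laplace transform is a product of those of
    single squares. *)
Lemma chi_mgf (l : R) : `|l| <= 1 / 32 ->
  (Ex (fun w => expR (l * \sum_(i < ell) (block_dot i w ^+ 2 - enorm z ^+ 2 / 4)))
    <= (expR (chi_const R * l ^+ 2 * ell%:R))%:E)%E.
Proof.
move=> l32; set tau := enorm z ^+ 2 / 4.
rewrite (@eq_Ex _ _ _ _ _
  (fun w => \prod_(i < ell) expR (l * (block_dot i w ^+ 2 - tau)))%R); last first.
  by move=> w; rewrite mulr_sumr expR_sum.
rewrite /expect.
rewrite (cylinder_integral_prod ind_xi (J := fun i : 'I_ell => [set j : 'I_n | (j %/ k == i)%N]%SET)
  (f := fun i w => expR (l * (block_dot i w ^+ 2 - tau)))); last 3 first.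
- move=> a b ab; rewrite -setI_eq0; apply/eqP/setP => j; rewrite !inE.
  by apply/negbTE; apply: contra ab => /andP[/eqP ja /eqP jb]; apply/eqP/val_inj; rewrite /= -ja -jb.
- move=> i.
  have mb : measurable_fun (setT : set (sg [set j : 'I_n | (j %/ k == i)%N]%SET)) (block_dot i).
    rewrite /block_dot; apply: measurable_funM => //.
    apply: measurable_sum_cond => j ji.
    by apply: meas_xi_cyl; rewrite inE.
  apply: (measurableT_comp (@measurable_expR R)); apply: measurable_funM => //.
  by apply: measurable_funB => //; apply: measurable_funX.
- by move=> i w; exact: expR_ge0.
have -> : expR (chi_const R * l ^+ 2 * ell%:R) = \prod_(i < ell) expR (chi_const R * l ^+ 2).
  by rewrite prodr_const card_ord expRM_natr.
rewrite -prodEFin; apply: lee_prod_nneg => i; first by apply: Ex_ge0 => w; exact: expR_ge0.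
apply: (subg_quad_mgf (meas_block_dot i) (block_dot_subg i)) => //.
- rewrite divr_ge0 ?sqr_ge0//= /tau; have := z4; lra.
- exact: block_dot_moment.
Qed.

End Blocks.
End VectorNoise.

(** * Decomposition of the sample covariance *)

Section Decomposition.
Context (R : realType).
Variables (n d ell k : nat).
Hypotheses (k0 : (0 < k)%N) (ell0 : (0 < ell)%N) (nkl : n = (k * ell)%N).
Variables (theta : 'cV[R]_d) (e : 'I_n -> R) (x : 'I_n -> 'cV[R]_d).

Let K : R := k%:R.
Let L : R := ell%:R.
Let K_gt0 : 0 < K. Proof. by rewrite ltr0n. Qed.
Let L_gt0 : 0 < L. Proof. by rewrite ltr0n. Qed.

Definition sign_mean (i : 'I_ell) : R := K^-1 * \sum_(j < n | (j %/ k == i)%N) e j.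

Definition noise_mean : 'M[R]_(d, ell) :=
  \matrix_(a, i) (K^-1 * \sum_(j < n | (j %/ k == i)%N) x j a 0).

(** The factor [s^2] by which averaging over blocks shrinks the spike. *)
Definition sign_energy : R := L^-1 * \sum_i sign_mean i ^+ 2.

(** Averaging noise against the sign averages; its weights are at most 1 in
    absolute value, see [cross_noise_dot]. *)
Definition cross_noise : 'cV[R]_d := L^-1 *: (noise_mean *m (\row_i sign_mean i)^T).

(** Centred: the averaged noise in a block has covariance [I/k]. *)
Definition wishart_noise : 'M[R]_d := L^-1 *: (noise_mean *m noise_mean^T) - (K^-1)%:M.

Definition perturbation : 'M[R]_d :=
  theta *m cross_noise^T + cross_noise *m theta^T + wishart_noise.

Lemma Sigma_hat_decomposition :
  Sigma_hat ell (fun j => e j *: theta + x j) =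
  (K^-1)%:M + sign_energy *: (theta *m theta^T) + perturbation.
Proof.
rewrite /Sigma_hat.
have -> : block_means ell (fun j => e j *: theta + x j) =
    theta *m (\row_i sign_mean i) + noise_mean.
  apply/matrixP => a i; rewrite !mxE big_ord1 !mxE.
  have -> : (n %/ ell)%N = k by rewrite nkl mulnK.
  rewrite -/K /sign_mean mulrCA -mulrDr; congr (_ * _).
  by rewrite mulr_sumr -big_split; apply: eq_bigr => j _; rewrite !mxE mulrC.
set H := \row_i sign_mean i.
rewrite linearD /= trmx_mul mulmxDl !mulmxDr.
have HH : H *m H^T = (\sum_i sign_mean i ^+ 2)%:M.
  apply/matrixP => i j; rewrite !ord1 !mxE eqxx mulr1n.
  by apply: eq_bigr => a _; rewrite !mxE expr2.
rewrite !scalerDr.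
have E1 : L^-1 *: (theta *m H *m (H^T *m theta^T)) = sign_energy *: (theta *m theta^T).
  rewrite -mulmxA (mulmxA H) HH mul_scalar_mx -scalemxAr scalerA //.
have E2 : L^-1 *: (theta *m H *m noise_mean^T) = theta *m cross_noise^T.
  by rewrite /cross_noise -/H linearZ /= trmx_mul trmxK -scalemxAr mulmxA.
have E3 : L^-1 *: (noise_mean *m (H^T *m theta^T)) = cross_noise *m theta^T.
  by rewrite /cross_noise -/H -scalemxAl mulmxA.
rewrite E1 E2 E3 /perturbation /wishart_noise.
set A := sign_energy *: _; set B := theta *m _; set C := cross_noise *m _.
set D := L^-1 *: _; set F := _%:M.
clearbody A B C D F; apply/matrixP => i j; rewrite !mxE; ring.
Qed.

Lemma wishart_noise_sym : wishart_noise^T = wishart_noise.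
Proof. by rewrite /wishart_noise linearB /= linearZ /= trmx_mul trmxK tr_scalar_mx. Qed.

Lemma perturbation_sym : perturbation^T = perturbation.
Proof.
rewrite /perturbation; have := wishart_noise_sym; move: wishart_noise => W sW.
rewrite !linearD /= sW !trmx_mul !trmxK.
by congr (_ + _); rewrite addrC.
Qed.

Let rank1 (u v y z : 'cV[R]_d) : edot y ((u *m v^T) *m z) = edot y u * edot v z.
Proof.
have -> : (u *m v^T) *m z = edot v z *: u; last by rewrite edotZr mulrC.
rewrite -mulmxA; apply/matrixP => i j; rewrite !ord1 mxE big_ord1 mulrC mxE [RHS]mxE.
by congr (_ * _); apply: eq_bigr => a _; rewrite mxE.
Qed.

Lemma perturbation_quad (eps m : R) : enorm cross_noise <= eps ->
  (forall y, `|edot y (wishart_noise *m y)| <= m * edot y y) ->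
  forall y, `|edot y (perturbation *m y)| <= (2 * (enorm theta * eps) + m) * edot y y.
Proof.
rewrite /perturbation; move: wishart_noise => W ce H y; rewrite !mulmxDl !edotDr !rank1.
rewrite (edotC cross_noise y) (edotC theta y) [edot y cross_noise * _]mulrC.
have h1 : `|edot y theta * edot y cross_noise| <= enorm theta * eps * edot y y.
  rewrite normrM -enorm_sq expr2.
  have a1 := ler_edot y theta; have a2 := ler_edot y cross_noise.
  have y0 := enorm_ge0 y; have t0 := enorm_ge0 theta.
  apply: (@le_trans _ _ ((enorm y * enorm theta) * (enorm y * eps))).
    apply: ler_pM => //; apply: (le_trans a2); exact: ler_wpM2l.
  by rewrite le_eqVlt; apply/orP; left; apply/eqP; ring.
have h2 := H y.
move: h1 h2; rewrite !ler_norml; lra.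
Qed.

Let noise_mean_dot (z : 'cV[R]_d) i :
  (noise_mean^T *m z) i 0 = K^-1 * \sum_(j < n | (j %/ k == i)%N) edot z (x j).
Proof.
rewrite mxE.
transitivity (\sum_a \sum_(j < n | (j %/ k == i)%N) K^-1 * (z a 0 * x j a 0)).
  apply: eq_bigr => a _; rewrite !mxE -mulrA mulr_suml mulr_sumr.
  by apply: eq_bigr => j _; congr (_ * _); rewrite mulrC.
rewrite exchange_big mulr_sumr; apply: eq_bigr => j _.
by rewrite /edot mulr_sumr.
Qed.

Lemma wishart_noise_quad (z : 'cV[R]_d) :
  edot z (wishart_noise *m z) =
  L^-1 * (\sum_(i < ell) (K^-1 * \sum_(j < n | (j %/ k == i)%N) edot z (x j)) ^+ 2)
    - K^-1 * enorm z ^+ 2.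
Proof.
rewrite /wishart_noise mulmxBl edotBr mul_scalar_mx edotZr -enorm_sq.
congr (_ - _); rewrite -scalemxAl edotZr; congr (_ * _).
rewrite -mulmxA edotC edot_mulmx.
by apply: eq_bigr => i _; rewrite noise_mean_dot expr2.
Qed.

Definition block_of (j : 'I_n) : 'I_ell.
Proof.
apply: (@Ordinal ell (j %/ k)%N).
by rewrite ltn_divLR// mulnC -nkl.
Defined.

Lemma cross_noise_dot (z : 'cV[R]_d) :
  edot cross_noise z = n%:R^-1 * \sum_j sign_mean (block_of j) * edot z (x j).
Proof.
rewrite /cross_noise edotZl edot_mulmx.
have -> : n%:R^-1 = L^-1 * K^-1 :> R by rewrite nkl natrM invfM mulrC.
rewrite -mulrA; congr (_ * _).
rewrite (partition_big block_of xpredT)//= mulr_sumr.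
apply: eq_bigr => i _; rewrite noise_mean_dot 2!mxE mulrCA; congr (_ * _).
rewrite mulr_sumr; apply: eq_big => [j|j /eqP ji]; last by congr (sign_mean _ * _); apply/val_inj.
by [].
Qed.

Hypothesis e_pm : forall j, e j = 1 \/ e j = - 1.

Hypothesis count : forall i : 'I_ell, \sum_(j < n | (j %/ k == i)%N) (1 : R) = K.

Lemma sign_mean_sq i : sign_mean i ^+ 2 <= 1.
Proof.
have : `|sign_mean i| <= 1.
  rewrite /sign_mean normrM gtr0_norm ?invr_gt0// ler_pdivrMl// mulr1 -(count i).
  apply: (le_trans (ler_norm_sum _ _ _)); apply: ler_sum => j _.
  by have [->|->] := e_pm j; rewrite ?normrN1 ?normr1.
have -> : sign_mean i ^+ 2 = `|sign_mean i| ^+ 2 by rewrite real_normK ?num_real.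
move=> h; by rewrite expr_le1.
Qed.

Lemma sign_energy_ge0 : 0 <= sign_energy.
Proof. by rewrite mulr_ge0 ?invr_ge0 ?(ltW L_gt0)//; apply: sumr_ge0 => i _; exact: sqr_ge0. Qed.

Lemma sign_energy_le1 : sign_energy <= 1.
Proof.
rewrite /sign_energy ler_pdivrMl// mulr1.
apply: (@le_trans _ _ (\sum_(i < ell) 1)); first by apply: ler_sum => i _; exact: sign_mean_sq.
by rewrite sumr_const card_ord.
Qed.

Lemma sign_mean_const (i : 'I_ell) (c : R) : (forall j : 'I_n, (j %/ k)%N = i -> e j = c) ->
  sign_mean i = c.
Proof.
move=> H; rewrite /sign_mean (eq_bigr (fun=> c * 1)); last first.
  by move=> j /eqP ji; rewrite mulr1 H.
by rewrite -mulr_sumr count mulrCA mulVf ?mulr1// gt_eqF.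
Qed.

Lemma sign_energy_defect (f : R) :
  \sum_i (1 - sign_mean i ^+ 2) <= f -> (1 - sign_energy) * L <= f.
Proof.
rewrite sumrB sumr_const card_ord mulrBl mul1r /sign_energy mulrAC mulVf ?mul1r//.
by rewrite gt_eqF.
Qed.

End Decomposition.

Section SignFlips.
Context (R : realType).
Variables (n0 ell k : nat).
Hypotheses (k0 : (0 < k)%N) (ell0 : (0 < ell)%N) (nkl : n0.+1 = (k * ell)%N).
Variables (e : 'I_n0.+1 -> R).
Hypothesis e_pm : forall j, e j = 1 \/ e j = - 1.
Hypothesis count : forall i : 'I_ell, \sum_(j < n0.+1 | (j %/ k == i)%N) (1 : R) = k%:R.

Let fl (m : nat) : R := (e (inord m.+1) != e (inord m))%:R.

Let pm_sq j : e j ^+ 2 = 1.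
Proof. by have [->|->] := e_pm j; rewrite ?sqrrN expr1n. Qed.

(** A block without sign change has average [1] or [-1] and no defect; in the
    others the defect is at most 1. *)
Lemma block_defect (i : 'I_ell) :
  1 - sign_mean k e i ^+ 2 <= \sum_(m < n0 | (m %/ k == i)%N) fl m.
Proof.
have [/existsP[m /andP[mi fm]]|/existsPn nf] :=
    boolP [exists m : 'I_n0, (m %/ k == i)%N && (e (inord m.+1) != e (inord m))].
  rewrite (bigD1 m)//= {1}/fl fm; apply: (@le_trans _ _ 1); first by rewrite gerBl sqr_ge0.
  by rewrite lerDl; apply: sumr_ge0 => m' _; rewrite /fl ler0n.
have cst r : (r < k)%N -> e (inord (i * k + r)) = e (inord (i * k)).
  elim: r => [|r IH rk]; first by rewrite addn0.
  have lt : (i * k + r < n0)%N.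
    rewrite -ltnS nkl -addnS; apply: (@leq_trans (i.+1 * k)).
      by rewrite mulSn addnC ltn_add2r.
    by rewrite mulnC leq_mul2l ltn_ord orbT.
  have := nf (Ordinal lt); rewrite /= divnMDl// divn_small ?addn0 ?(ltnW rk)//.
  by rewrite eqxx /= negbK => /eqP; rewrite addnS => ->; apply: IH; exact: ltnW.
rewrite (@sign_mean_const _ _ _ _ k0 _ count i (e (inord (i * k)))); last first.
  move=> j ji; rewrite -(cst (j %% k)%N (ltn_pmod _ k0)) -ji -divn_eq.
  by rewrite inord_val.
by rewrite pm_sq subrr; apply: sumr_ge0 => m _; rewrite /fl ler0n.
Qed.

Lemma sign_energy_flips :
  (1 - sign_energy ell k e) * ell%:R <= \sum_(m < n0) fl m.
Proof.
apply: sign_energy_defect => //.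
apply: (@le_trans _ _ (\sum_(i < ell) \sum_(m < n0 | (m %/ k == i)%N) fl m)).
  by apply: ler_sum => i _; exact: block_defect.
have lt (m : 'I_n0) : (m %/ k < ell)%N.
  by rewrite ltn_divLR// mulnC -nkl ltnS ltnW.
rewrite [leRHS](partition_big (fun m => Ordinal (lt m)) xpredT)//=.
Qed.

Lemma sign_energy_unit : k = 1%N -> sign_energy ell k e = 1.
Proof.
move=> k1; rewrite /sign_energy (eq_bigr (fun=> 1)).
  by rewrite sumr_const card_ord mulVf// pnatr_eq0 -lt0n.
move=> i _.
have lt : (i < n0.+1)%N by rewrite nkl k1 mul1n.
rewrite (@sign_mean_const _ _ _ _ k0 _ count i (e (Ordinal lt))) ?pm_sq//.
move=> j; rewrite k1 divn1 => ji; congr e; exact/val_inj.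
Qed.

End SignFlips.

(** * Deviations in a fixed direction *)

Section ModelTails.
Context (R : realType) (disp : measure_display) (T : measurableType disp).
Variable P : probability T R.
Local Notation Ex f := (expect P f%R).

Lemma union_bound (I : eqType) (s : seq I) (B : I -> set T) (q : R) :
  (forall z, z \in s -> measurable (B z)) ->
  (forall z, z \in s -> (P (B z) <= q%:E)%E) ->
  measurable (\big[setU/set0]_(z <- s) B z) /\
  (P (\big[setU/set0]_(z <- s) B z) <= ((size s)%:R * q)%:E)%E.
Proof.
elim: s => [_ _|z s IH mB PB].
  by rewrite big_nil mul0r measure0.
have [||m1 p1] := IH.
- by move=> y ys; apply: mB; rewrite inE ys orbT.
- by move=> y ys; apply: PB; rewrite inE ys orbT.
have mz : measurable (B z) by apply: mB; rewrite mem_head.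
rewrite big_cons; split; first exact: measurableU.
apply: (le_trans (measureU2 _ _ _)) => //.
have -> : (size (z :: s))%:R * q = q + (size s)%:R * q by rewrite /= -natr1; ring.
by rewrite EFinD; apply: leeD => //; apply: PB; rewrite mem_head.
Qed.

Section Generated.
Context {d' : measure_display} {T' : measurableType d'} {I : finType}.
Variable X : I -> {RV P >-> T'}.

(** Generators of the sigma-algebra of a family.  Under this sigma-algebra on the
    sample space the identity is a random element that stands for the whole
    family. *)
Definition gen_of : set (set T) := \bigcup_i preimage_set_system setT (X i) measurable.

Lemma measurable_gen i : measurable_fun (setT : set (g_sigma_algebraType gen_of)) (X i).
Proof.
move=> _ B mB; rewrite setTI; apply: sub_sigma_algebra.
by exists i => //; exists B => //; rewrite setTI.
Qed.

Lemma measurable_id_gen : measurable_fun setT (idfun : T -> g_sigma_algebraType gen_of).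
Proof.
move=> _ B mB; rewrite setTI.
suff : <<s gen_of >> `<=` measurable by exact.
apply: smallest_sub; first exact: sigma_algebra_measurable.
move=> _ [i _ [C mC <-]]; exact: measurable_funP.
Qed.

End Generated.

Variables (n d k ell : nat) (eta : 'I_n -> {RV P >-> R}) (xi : 'I_n -> {RV P >-> borel_cV R d}).
Hypotheses (k0 : (0 < k)%N) (ell0 : (0 < ell)%N) (nkl : n = (k * ell)%N).
Hypotheses (ind_xi : mutually_independent xi).
Hypotheses (iso_xi : forall i, isotropic P (xi i)) (sub_xi : forall i, sub_gaussian P (xi i)).
Hypotheses (ind_xe : independent_families xi eta).
Hypotheses (eta_pm : forall i w, eta i w = 1 \/ eta i w = - 1).

Let coef (j : 'I_n) w : R := sign_mean k (fun i => eta i w) (block_of k0 nkl j).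

Lemma meas_coef j : measurable_fun setT (coef j).
Proof.
rewrite /coef /sign_mean; apply: measurable_funM => //.
by apply: measurable_sum_cond => i _.
Qed.

Let coef_gen j : measurable_fun (setT : set (g_sigma_algebraType (gen_of eta))) (coef j).
Proof.
rewrite /coef /sign_mean; apply: measurable_funM => //.
by apply: measurable_sum_cond => i _; exact: measurable_gen.
Qed.

(** The weights depend only on the signs, which are independent of the noise:
    freeze them and use the bound for deterministic weights. *)
Lemma cross_mgf (z : 'cV[R]_d) (l : R) : enorm z <= 2 ->
  (Ex (fun w => expR (l * \sum_j coef j w * edot z (xi j w)))
     <= (expR (2 * l ^+ 2 * n%:R))%:E)%E.
Proof.
move=> z2.
pose T1 := g_sigma_algebraType (gen_of xi).
pose T2 := g_sigma_algebraType (gen_of eta).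
pose X1 : {RV P >-> T1} :=
  HB.pack (idfun : T -> T1) (isMeasurableFun.Build _ _ _ _ _ (@measurable_id_gen _ _ _ xi)).
pose X2 : {RV P >-> T2} :=
  HB.pack (idfun : T -> T2) (isMeasurableFun.Build _ _ _ _ _ (@measurable_id_gen _ _ _ eta)).
pose H (p : T1 * T2) : \bar R := (expR (l * \sum_j coef j p.2 * edot z (xi j p.1)))%:E.
apply: (@indep_integral_le _ _ _ _ _ _ T1 T2 X1 X2 H).
- by move=> A B mA mB; exact: ind_xe.
- apply/measurable_EFinP; apply: (measurableT_comp (@measurable_expR R)).
  apply: measurable_funM => //; apply: measurable_sum => j; apply: measurable_funM.
    exact: (measurableT_comp (coef_gen j) measurable_snd).
  have mxi : measurable_fun (setT : set T1) (fun x => edot z (xi j x)).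
    by apply: (measurableT_comp (measurable_edot z)); exact: measurable_gen.
  exact: (measurableT_comp mxi measurable_fst).
- by move=> p; rewrite lee_fin expR_ge0.
move=> y; have c1 j : coef j y ^+ 2 <= 1.
  by apply: sign_mean_sq => // i; exact: block_count.
exact: (linear_tail ind_xi sub_xi l c1 z2).
Qed.

(** The level [16 d] beats the Laplace transform [exp(8 d)] by [exp(-8 d)], which
    survives a union over [exp(6 d)] points. *)
Lemma cross_tail (z : 'cV[R]_d) (l : R) : enorm z <= 2 -> l ^+ 2 * n%:R = 4 * d%:R ->
  (P [set w | (16 * d%:R <= l * \sum_j coef j w * edot z (xi j w))%R]
     <= (expR (- (8 * d%:R)))%:E)%E.
Proof.
move=> z2 l2.
have -> : expR (- (8 * d%:R)) = expR (2 * l ^+ 2 * n%:R) * expR (- (16 * d%:R)) :> R.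
  by rewrite -expRD -mulrA l2; congr expR; ring.
apply: markov_exp; last exact: cross_mgf.
apply: measurable_funM => //; apply: measurable_sum => j.
apply: measurable_funM; [exact: meas_coef|exact: meas_xi].
Qed.

Lemma meas_cross (z : 'cV[R]_d) (l : R) :
  measurable [set w | 16 * d%:R <= l * \sum_j coef j w * edot z (xi j w)].
Proof.
rewrite -[X in measurable X]setTI; apply: measurable_fun_le => //.
apply: measurable_funM => //; apply: measurable_sum => j.
apply: measurable_funM; [exact: meas_coef|exact: meas_xi].
Qed.

Lemma chi_const_ge0 : 0 <= chi_const R.
Proof.
rewrite /chi_const; have := expR_ge0 (1 : R); have := expR_ge0 (2 : R).
set u := expR 2; set v := expR 1 => u0 v0.
by have := mulr_ge0 u0 v0; lra.
Qed.

Let Z (z : 'cV[R]_d) w : R :=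
  \sum_(i < ell) (block_dot xi k z i w ^+ 2 - enorm z ^+ 2 / 4).

Let meas_Z z : measurable_fun setT (Z z).
Proof.
apply: measurable_sum => i; apply: measurable_funB => //.
by apply: measurable_funX; exact: meas_block_dot.
Qed.

Lemma chi_tail (z : 'cV[R]_d) (l : R) : enorm z <= 2 -> `|l| <= 1 / 32 ->
  l ^+ 2 * ell%:R <= d%:R ->
  (P [set w | ((8 + chi_const R) * d%:R <= l * Z z w)%R] <= (expR (- (8 * d%:R)))%:E)%E.
Proof.
move=> z2 l32 l2.
have : (P [set w | ((8 + chi_const R) * d%:R <= l * Z z w)%R] <=
   (expR (chi_const R * l ^+ 2 * ell%:R) * expR (- ((8 + chi_const R) * d%:R)))%:E)%E.
  apply: markov_exp; first by apply: measurable_funM.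
  exact: chi_mgf.
move=> /le_trans; apply; rewrite lee_fin -expRD ler_expR.
have := ler_wpM2l chi_const_ge0 l2; rewrite mulrA; lra.
Qed.

Lemma meas_chi (z : 'cV[R]_d) (l : R) :
  measurable [set w | (8 + chi_const R) * d%:R <= l * Z z w].
Proof.
rewrite -[X in measurable X]setTI; apply: measurable_fun_le => //.
by apply: measurable_funM.
Qed.

End ModelTails.

(** * Risk on the good event *)

Section DeterministicRisk.
Context (R : realType).

Definition risk_const (Ce : R) : R := 200 * ((400 * Ce + 256) + (1000 * Ce ^+ 2 + 16)).

(** Free of probability: the three noise estimates imply all the rates, for every
    choice of the leading eigenvector. *)
Lemma deterministic_risk (n0 d : nat) (delta : R) (theta : 'cV[R]_d)
    (vmax : 'M[R]_d -> 'cV[R]_d) (sgn : 'I_n0.+1 -> R) (x : 'I_n0.+1 -> 'cV[R]_d) (Ce : R) :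
  let n := n0.+1 in let ell := ell_star n delta theta in let k := (n %/ ell)%N in
  (1 <= d)%N -> (d <= n)%N -> 0 < delta -> delta < 1 / 2 -> (ell %| n)%N ->
  top_eigenvector_choice vmax -> (forall j, sgn j = 1 \/ sgn j = - 1) -> 1 <= Ce ->
  2 * enorm (cross_noise ell k sgn x) <= Ce * Num.sqrt (d%:R / n%:R) ->
  (forall y, `|edot y (wishart_noise ell k x *m y)|
      <= Ce * Num.sqrt (ell%:R / n%:R * (d%:R / n%:R)) * edot y y) ->
  \sum_(m < n0) (sgn (inord m.+1) != sgn (inord m))%:R <= 2 * (n%:R * delta + d%:R) ->
  let Q := loss (theta_tilde vmax ell (fun j => sgn j *: theta + x j)) theta ^+ 2 in
  [/\ delta <= Num.sqrt (d%:R / n%:R) -> Q <= risk_const Ce * rate_small_delta n delta theta,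
      Num.sqrt (d%:R / n%:R) <= delta -> Q <= risk_const Ce * rate_large_delta n delta theta &
      Q <= risk_const Ce * (Num.sqrt (delta * d%:R / n%:R) + d%:R / n%:R)].
Proof.
move=> n ell k d1 dn delta0 delta2 elln top sgn_pm Ce1 Hc HW Hf Q.
have K10 : 0 <= 400 * Ce + 256 by clear -Ce1; lra.
have K20 : 0 <= 1000 * Ce ^+ 2 + 16 by clear; have := sqr_ge0 Ce; lra.
have ell0 : (0 < ell)%N by exact: ell_star_gt0.
have nkl : n = (k * ell)%N by rewrite /k divnK.
have k0 : (0 < k)%N by rewrite divn_gt0// dvdn_leq.
have N0 : 0 < n%:R :> R by rewrite ltr0n.
have D0 : 0 < d%:R :> R by rewrite ltr0n.
have L0' : 0 < ell%:R :> R by rewrite ltr0n.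
pose p : R := d%:R / n%:R; have p0 : 0 < p by rewrite divr_gt0.
have p1 : p <= 1 by rewrite ler_pdivrMr// mul1r ler_nat.
pose t := enorm theta; have t0 : 0 <= t by exact: enorm_ge0.
pose L : R := ell%:R / n%:R; have L0 : 0 < L by rewrite divr_gt0.
have L1 : L <= 1 by rewrite ler_pdivrMr// mul1r ler_nat; exact: ell_star_le.
pose q := Num.sqrt (delta * d%:R / n%:R).
have q0 : 0 <= q by exact: sqrtr_ge0.
have qE : q ^+ 2 = delta * p by rewrite sqr_sqrtr ?mulrA// !mulr_ge0// ?invr_ge0 ltW.
pose w := Num.sqrt p; have w0 : 0 <= w by exact: sqrtr_ge0.
have wE : w ^+ 2 = p by rewrite sqr_sqrtr// ltW.
pose g := Num.sqrt (L * p); have g0 : 0 <= g by exact: sqrtr_ge0.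
have gE : g ^+ 2 = L * p by rewrite sqr_sqrtr// mulr_ge0 ?ltW.
pose r := (delta * d%:R / n%:R / t) `^ (2 / 3).
have r0 : 0 <= r by exact: powR_ge0.
have rE : 0 < t -> r ^+ 3 * t ^+ 2 = delta ^+ 2 * p ^+ 2.
  move=> tp; rewrite /r (powR_third 2); last first.
    by rewrite !mulr_ge0 ?invr_ge0// ltW.
  by rewrite /p; field; rewrite !gt_eqF.
pose a := ell_frac n delta theta.
have a0 : 0 <= a by exact: ell_frac_ge0.
have aE : a ^+ 3 * p = delta ^+ 2 * t ^+ 4 by exact: ell_frac_cube.
have LU : L <= 2 * p + delta + a + t ^+ 2 by exact: ell_star_upper.
have LL : L = 1 \/ [/\ p <= L, delta <= L, a <= L & t ^+ 2 <= L] by exact: ell_star_lower.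
pose e := Ce * (t * w + g).
pose s2 := sign_energy ell k sgn.
have count : forall i : 'I_ell, \sum_(j < n | (j %/ k == i)%N) (1 : R) = k%:R.
  by move=> i; exact: block_count.
have s20 : 0 <= s2 by exact: sign_energy_ge0.
have s21 : s2 <= 1 by exact: sign_energy_le1.
pose s := Num.sqrt s2.
have sE : s ^+ 2 = s2 by rewrite sqr_sqrtr.
have s01 : 0 <= s <= 1.
  by rewrite sqrtr_ge0 /= -(@ler_pXn2r _ 2) ?nnegrE ?sqrtr_ge0// sE expr1n.
have sL : (1 - s ^+ 2) * L <= 2 * (delta + p).
  rewrite sE /L mulrA ler_pdivrMr//.
  have -> : 2 * (delta + p) * n%:R = 2 * (n%:R * delta + d%:R).
    by rewrite /p; field; rewrite gt_eqF.
  apply: le_trans Hf; exact: sign_energy_flips.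
have sL1 : L = 1 -> s = 1.
  move=> L11; have en : ell = n.
    have N1 : n%:R != 0 :> R by rewrite gt_eqF.
    by apply/eqP; rewrite -(eqr_nat R) -[X in X == _](divfK N1) -/L L11 mul1r.
  have k1 : k = 1%N by rewrite /k en divnn.
  by rewrite /s /s2 sign_energy_unit// sqrtr1.
have SE := Sigma_hat_decomposition ell0 nkl theta sgn x.
rewrite -/s2 -sE in SE.
have sP := perturbation_sym ell k theta sgn x.
have He y : `|edot y (perturbation ell k theta sgn x *m y)| <= e * edot y y.
  have h := perturbation_quad theta (lexx (enorm (cross_noise ell k sgn x))) HW y.
  apply: (le_trans h).
  rewrite ler_wpM2r ?edot_ge0// /e mulrDr lerD2r mulrCA [leRHS]mulrCA ler_wpM2l//.
have [Sv v1] : Sigma_hat ell (fun j => sgn j *: theta + x j) *m vmax (Sigma_hat ell (fun j => sgn j *: theta + x j)) =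
    lambda_max (Sigma_hat ell (fun j => sgn j *: theta + x j)) *: vmax (Sigma_hat ell (fun j => sgn j *: theta + x j)) /\
    enorm (vmax (Sigma_hat ell (fun j => sgn j *: theta + x j))) = 1.
  apply: top; rewrite SE; move: (perturbation _ _ _ _ _) sP => E symE.
  by rewrite !linearD /= linearZ /= tr_scalar_mx symE trmx_mul trmxK.
have Q1 : Q <= 4 * t ^+ 2 + 2 * e.
  exact: (spiked_loss_coarse SE He s01 Sv v1).
have Q2 : 0 < t -> 0 < s -> Q <= 50 * (e / (s * t)) ^+ 2 + 2 * ((1 - s) * t) ^+ 2.
  move=> tp sp; apply: (spiked_loss_fine SE sP He s01 Sv v1) => //.
  by apply/eqP => th0; move: tp; rewrite /t th0 enorm0 ltxx.
have weak : t ^+ 2 <= 64 * (q + p) -> Q <= (400 * Ce + 256) * (q + p).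
  by apply: (@risk_weak_signal R p delta t L q w g a Ce e Q).
have strong : 64 * (q + p) <= t ^+ 2 -> Q <= (1000 * Ce ^+ 2 + 16) * (p + r).
  exact: (risk_strong_signal p0 t0 L0 q0 qE wE gE r0 rE a0 aE LU LL (erefl e) s01 sL sL1 Q2).
have fine_blocks : 64 * (q + p) <= t ^+ 2 -> 1 <= a ->
    Q <= (1000 * Ce ^+ 2 + 16) * (p + p / t ^+ 2).
  exact: (risk_fine_blocks p0 t0 L0 L1 q0 qE wE gE a0 aE LL (erefl e) s01 sL sL1 Q2).
split.
- move=> dw; rewrite /rate_small_delta.
  have -> : delta ^+ 2 * n%:R / d%:R = delta ^+ 2 / p by rewrite /p; field; rewrite !gt_eqF.
  exact: (risk_rate_small_delta p0 delta0 t0 q0 qE r0 rE K10 K20 weak strong).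
- move=> wd; rewrite /rate_large_delta.
  exact: (risk_rate_large_delta p0 p1 delta0 delta2 t0 q0 qE w0 wE r0 rE a0 aE K10 K20 weak strong fine_blocks).
- exact: (risk_uniform_rate p0 delta0 t0 q0 qE r0 rE K10 K20 weak strong).
Qed.

End DeterministicRisk.

Section GoodEvent.
Context (R : realType) (disp : measure_display) (T : measurableType disp).
Variable P : probability T R.

(** [22] covers the cross noise, [2 * (4/3) * 8]; the second summand covers the
    Wishart noise, with the factor 3 from the net, 4 from the normalisation of
    [block_dot], and 32 from the range of [l]. *)
Definition noise_const : R := 22 + 12 * (32 * (8 + chi_const R)).

Lemma noise_const_ge1 : 1 <= noise_const.
Proof. by have := chi_const_ge0 R; rewrite /noise_const; lra. Qed.

Variables (n0 d : nat) (delta : R) (k ell : nat).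
Let n := n0.+1.
Variables (eta : 'I_n -> {RV P >-> R}) (xi : 'I_n -> {RV P >-> borel_cV R d}).
Hypotheses (d1 : (1 <= d)%N) (dl : (d <= ell)%N) (k0 : (0 < k)%N) (nkl : n = (k * ell)%N).
Hypotheses (delta0 : 0 < delta) (Hmodel : model delta eta xi).

Let ell0 : (0 < ell)%N. Proof. exact: leq_trans dl. Qed.
Let N0 : 0 < n%:R :> R. Proof. by rewrite ltr0n. Qed.
Let D0 : 0 < d%:R :> R. Proof. by rewrite ltr0n. Qed.
Let L0 : 0 < ell%:R :> R. Proof. by rewrite ltr0n. Qed.
Let KE : n%:R = k%:R * ell%:R :> R. Proof. by rewrite nkl natrM. Qed.
Let K0 : 0 < k%:R :> R. Proof. by rewrite ltr0n. Qed.

Let w : R := Num.sqrt (d%:R / n%:R).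
Let wE : w ^+ 2 = d%:R / n%:R.
Proof. by rewrite sqr_sqrtr// divr_ge0 ?ltW. Qed.
Let w0 : 0 < w. Proof. by rewrite sqrtr_gt0 divr_gt0. Qed.

Let b : R := Num.sqrt (d%:R / ell%:R).
Let bE : b ^+ 2 = d%:R / ell%:R.
Proof. by rewrite sqr_sqrtr// divr_ge0 ?ltW. Qed.
Let b0 : 0 < b. Proof. by rewrite sqrtr_gt0 divr_gt0. Qed.
Let b1 : b <= 1.
Proof.
rewrite -(@ler_pXn2r _ 2) ?nnegrE ?(ltW b0)// bE expr1n ler_pdivrMr// mul1r.
by rewrite ler_nat.
Qed.

(** A union bound over the net: three events of probability [exp(-8 d)] for each
    of at most [exp(6 d)] points cost at most [3 exp(-d)], and the sign changes
    cost [exp(-d)].  With 5 in place of 4 the inequality is strict. *)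
Lemma good_event : exists2 E : set T, measurable E &
  ((1 - 5 * expR (- d%:R))%:E < P E)%E /\
  forall o, E o ->
    [/\ 2 * enorm (cross_noise ell k (fun j => eta j o) (fun j => xi j o : 'cV[R]_d))
          <= noise_const * w,
        forall y, `|edot y (wishart_noise ell k (fun j => xi j o : 'cV[R]_d) *m y)|
          <= noise_const * Num.sqrt (ell%:R / n%:R * (d%:R / n%:R)) * edot y y &
        \sum_(m < n0) (eta (inord m.+1) o != eta (inord m) o)%:R
          <= 2 * (n%:R * delta + d%:R)].
Proof.
have [chain ind_xi _ xi_ok ind_xe] := Hmodel.
have iso_xi i : isotropic P (xi i) by case: (xi_ok i).
have sub_xi i : sub_gaussian P (xi i) by case: (xi_ok i).
have eta_pm i o : eta i o = 1 \/ eta i o = - 1 by case: chain => H _ _; exact: H.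
have [s net_s] := net_exists R d1; have [size_s s2 _] := net_s.
pose Bu (z : 'cV[R]_d) := [set o | 16 * d%:R <= (2 * w) *
   \sum_j sign_mean k (fun i => eta i o) (block_of k0 nkl j) * edot z (xi j o)].
pose Bp (z : 'cV[R]_d) (l : R) := [set o | (8 + chi_const R) * d%:R <=
   l * \sum_(i < ell) (block_dot xi k z i o ^+ 2 - enorm z ^+ 2 / 4)].
(* the largest parameter, up to constants, with l^2 ell <= d and |l| <= 1/32 *)
pose l := b / 32.
have l32 : `|l| <= 1 / 32 by rewrite ger0_norm /l; have := b0; have := b1; lra.
have lN32 : `|- l| <= 1 / 32 by rewrite normrN.
have l2 : l ^+ 2 * ell%:R <= d%:R.
  have -> : l ^+ 2 * ell%:R = d%:R / 1024.
    rewrite /l expr_div_n bE; have -> : 32 ^+ 2 = 1024 :> R by rewrite expr2; lra.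
    by field; rewrite gt_eqF.
  have := D0; lra.
have lN2 : (- l) ^+ 2 * ell%:R <= d%:R by rewrite sqrrN.
pose B z := Bu z `|` (Bp z l `|` Bp z (- l)).
have mBu z : measurable (Bu z) by exact: meas_cross.
have mBp z l' : measurable (Bp z l') by exact: meas_chi.
have mB z : measurable (B z) by do 2 apply: measurableU => //.
have PB z : z \in s -> (P (B z) <= (3 * expR (- (8 * d%:R)))%:E)%E.
  move=> zs; have z2 := s2 z zs.
  apply: (le_trans (measureU2 _ _ _)) => //; first exact: measurableU.
  have -> : 3 * expR (- (8 * d%:R)) = expR (- (8 * d%:R)) +
     (expR (- (8 * d%:R)) + expR (- (8 * d%:R))) :> R by ring.
  rewrite EFinD; apply: leeD.
    apply: cross_tail => //.
    by rewrite exprMn wE; field; rewrite gt_eqF.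
  apply: (le_trans (measureU2 _ _ _)) => //.
  by rewrite EFinD; apply: leeD; exact: chi_tail.
have [mU PU] := union_bound (fun z _ => mB z) PB.
set U := \big[setU/set0]_(z <- s) B z in mU PU.
pose F := [set o | n0%:R * delta + d%:R <= flips eta o / 2].
have mF : measurable F.
  rewrite -[X in measurable X]setTI; apply: measurable_fun_le => //.
  by apply: measurable_funM => //; exact: (measurable_flips chain).
have PF : (P F <= (expR (- d%:R))%:E)%E by exact: (flips_tail (ltW delta0) chain).
exists (~` (F `|` U)); first by apply: measurableC; exact: measurableU.
split.
  rewrite probability_setC; last exact: measurableU.
  have h : (P (F `|` U) <= (4 * expR (- d%:R))%:E)%E.
    apply: (le_trans (measureU2 _ _ _)) => //.
    have -> : 4 * expR (- d%:R) = expR (- d%:R) + 3 * expR (- d%:R) :> R by ring.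
    rewrite EFinD; apply: leeD => //.
    apply: (le_trans PU); rewrite lee_fin mulrCA ler_pM2l//.
    apply: (@le_trans _ _ (net_bound R d * expR (- (8 * d%:R)))).
      by rewrite ler_wpM2r ?expR_ge0.
    by rewrite /net_bound -expRD ler_expR; have := D0; lra.
  have PFU : P (F `|` U) \is a fin_num by rewrite fin_num_measure//; exact: measurableU.
  move: h; rewrite -(fineK PFU) lee_fin -EFinB lte_fin.
  have := expR_gt0 (- d%:R : R); lra.
move=> o /not_orP[nF nU].
have nB z : z \in s -> ~ B z o.
  by move=> zs Bz; apply: nU; rewrite /U -bigcup_seq; exists z.
have count : forall i : 'I_ell, \sum_(j < n | (j %/ k == i)%N) (1 : R) = k%:R.
  by move=> i; exact: block_count.
split.
- have : enorm (cross_noise ell k (fun j => eta j o) (fun j => xi j o : 'cV[R]_d)) <= 4 / 3 * (8 * w).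
    apply: (net_enorm_le net_s); first by rewrite mulr_ge0 ?ltW.
    move=> z zs; rewrite (cross_noise_dot k0 nkl).
    have : ~ Bu z o by move=> h; apply: (nB z zs); left.
    rewrite /Bu /=; set S := \sum_j _ => /negP; rewrite -ltNge => h.
    rewrite mulrC ler_pdivrMr// -(@ler_pM2l _ (2 * w)) ?mulr_gt0//.
    have -> : 2 * w * (8 * w * n%:R) = 16 * (w ^+ 2 * n%:R) by ring.
    by rewrite wE divfK ?gt_eqF// ltW.
  have := w0; have := chi_const_ge0 R; rewrite /noise_const => c0 w0'.
  have := mulr_ge0 c0 (ltW w0'); lra.
- pose g : R := Num.sqrt (ell%:R / n%:R * (d%:R / n%:R)).
  have g0 : 0 <= g by exact: sqrtr_ge0.
  have gb : g = d%:R / (n%:R * b).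
    apply/eqP; rewrite -(@eqrXn2 _ 2)// ?divr_ge0 ?mulr_ge0 ?(ltW b0)//.
    rewrite sqr_sqrtr; last by rewrite !mulr_ge0 ?invr_ge0 ?ltW.
    by rewrite expr_div_n exprMn bE; apply/eqP; field; rewrite !gt_eqF.
  move=> y.
  have := @net_quad_le R d s net_s (wishart_noise ell k (fun j => xi j o : 'cV[R]_d))
    (4 * (32 * (8 + chi_const R)) * g).
  have c0 := chi_const_ge0 R.
  have m0 : 0 <= 4 * (32 * (8 + chi_const R)) * g by rewrite mulr_ge0//; lra.
  move=> /(_ (wishart_noise_sym _ _ _) m0) H.
  apply: (@le_trans _ _ (3 * (4 * (32 * (8 + chi_const R)) * g) * edot y y)); last first.
    rewrite ler_wpM2r ?edot_ge0// -/g mulrA ler_wpM2r//; rewrite /noise_const; lra.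
  apply: H => z zs.
  rewrite wishart_noise_quad.
  set Z := \sum_(i < ell) (block_dot xi k z i o ^+ 2 - enorm z ^+ 2 / 4).
  have -> : ell%:R^-1 * (\sum_(i < ell) (k%:R^-1 * \sum_(j < n | (j %/ k == i)%N)
       edot z (xi j o)) ^+ 2) - k%:R^-1 * enorm z ^+ 2 = 4 / n%:R * Z.
    rewrite /Z sumrB sumr_const card_ord mulrBr.
    have -> : 4 / n%:R * (enorm z ^+ 2 / 4 *+ ell) = k%:R^-1 * enorm z ^+ 2.
      by rewrite -[_ *+ ell]mulr_natr KE; field; rewrite !gt_eqF.
    congr (_ - _); rewrite !mulr_sumr; apply: eq_bigr => i _.
    rewrite /block_dot; set S := \sum_(j < n | _) _.
    have rk2 : Num.sqrt k%:R ^+ 2 = k%:R :> R by rewrite sqr_sqrtr// ltW.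
    have rk0 : Num.sqrt k%:R != 0 :> R by rewrite gt_eqF// sqrtr_gt0.
    move: (Num.sqrt k%:R) rk2 rk0 => rk rk2 rk0; rewrite KE -rk2.
    by field; rewrite rk0 gt_eqF.
  have h1 : l * Z < (8 + chi_const R) * d%:R.
    by rewrite ltNge; apply/negP => h; apply: (nB z zs); right; left.
  have h2 : - l * Z < (8 + chi_const R) * d%:R.
    by rewrite ltNge; apply/negP => h; apply: (nB z zs); right; right.
  have l0 : 0 < l by rewrite divr_gt0.
  rewrite normrM gtr0_norm ?divr_gt0//.
  have hZ : l * `|Z| <= (8 + chi_const R) * d%:R.
    rewrite -{1}(gtr0_norm l0) -normrM ler_norml; apply/andP; split; last exact: ltW.
    by move: h2; rewrite mulNr; lra.
  rewrite -(@ler_pM2l _ l)// mulrCA.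
  apply: (@le_trans _ _ (4 / n%:R * ((8 + chi_const R) * d%:R))).
    by rewrite ler_wpM2l// divr_ge0// ltW.
  rewrite le_eqVlt; apply/orP; left; apply/eqP; rewrite gb /l.
  by field; rewrite !gt_eqF.
- have : ~ F o by exact: nF.
  rewrite /F /= => /negP; rewrite -ltNge => h.
  have : flips eta o = \sum_(m < n0) (eta (inord m.+1) o != eta (inord m) o)%:R by [].
  have : n0%:R * delta <= n%:R * delta by rewrite ler_pM2r// ler_nat.
  move=> h1 h2; rewrite -h2; lra.
Qed.

End GoodEvent.

Theorem proposition11 (R : realType) :
  exists K c0 c1 : R, [/\ 0 < K, 0 < c0, 0 < c1 &
  forall (n d : nat) (delta : R) (theta : 'cV[R]_d),
    (1 <= d)%N -> (d <= n)%N -> 0 < delta -> delta < 1 / 2 ->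
  let ell := ell_star n delta theta in
    (ell %| n)%N ->
  forall (disp : measure_display) (T : measurableType disp)
    (P : probability T R)
    (eta : 'I_n -> {RV P >-> R}) (xi : 'I_n -> {RV P >-> borel_cV R d})
    (vmax : 'M[R]_d -> 'cV[R]_d),
    model delta eta xi -> top_eigenvector_choice vmax ->
  let estimate (w : T) := theta_tilde vmax ell (observation theta eta xi w) in
  with_prob_gt P (1 - c1 * expR (- c0 * d%:R))
    [set w |
      (delta <= Num.sqrt (d%:R / n%:R) ->
         loss (estimate w) theta ^+ 2 <= K * rate_small_delta n delta theta) /\
      (Num.sqrt (d%:R / n%:R) <= delta ->
         loss (estimate w) theta ^+ 2 <= K * rate_large_delta n delta theta)]
  /\
  with_prob_gt P (1 - c1 * expR (- c0 * d%:R))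
    [set w | loss (estimate w) theta ^+ 2 <=
       K * (Num.sqrt (delta * d%:R / n%:R) + d%:R / n%:R)]].
Proof.
exists (risk_const (noise_const R)), 1, 5.
have C1 := noise_const_ge1 R.
split => //.
  by rewrite /risk_const; have := sqr_ge0 (noise_const R); lra.
case=> [|n0] d delta theta d1 dn delta0 delta2 ell elln disp T P eta xi vmax Hm top estimate.
  by have := leq_trans d1 dn.
have ell0 : (0 < ell)%N by exact: ell_star_gt0.
pose k := (n0.+1 %/ ell)%N.
have nkl : n0.+1 = (k * ell)%N by rewrite /k divnK.
have k0 : (0 < k)%N by rewrite divn_gt0// dvdn_leq.
have dl : (d <= ell)%N by rewrite /ell /ell_star leq_min dn leq_max leqnn.
have [E mE [PE HE]] := good_event d1 dl k0 nkl delta0 Hm.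
have eta_pm i o : eta i o = 1 \/ eta i o = - 1.
  by case: Hm => -[H _ _] _ _ _ _; exact: H.
have HR o : E o -> _ := fun Eo => let: And3 a b c := HE o Eo in
  deterministic_risk d1 dn delta0 delta2 elln top (fun j => eta_pm j o) C1 a b c.
rewrite mulN1r.
split; exists E; split => // o /HR[r1 r2 r3].
- by split.
- exact: r3.
Qed.
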